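(* Let $\gamma>0$ be irrational and let $\mathbb{H}_{\gamma}=\{(z_1,z_2)\in\mathbb{C}^2:|z_1|^{\gamma}<|z_2|<1\}$. The Bergman projection $\mathbf{B}_{\gamma}$ of $\mathbb{H}_\gamma$ is a bounded operator from $L^p(\mathbb{H}_{\gamma})$ to $A^p(\mathbb{H}_{\gamma})$ if and only if $p=2$.
   Context: For a domain $\Omega\subset\mathbb{C}^2$, $L^p(\Omega)$ is taken with respect to Lebesgue measure $dV$, and $A^p(\Omega)=\mathcal{O}(\Omega)\cap L^p(\Omega)$. The Bergman projection $\mathbf{B}_\Omega$ is the orthogonal projection $L^2(\Omega)\to A^2(\Omega)$; it is given by $\mathbf{B}_\Omega f(z)=\int_\Omega \mathbb{B}_\Omega(z,w)f(w)\,dV(w)$ with $\mathbb{B}_\Omega$ the Bergman kernel, and this integral formula is used to define $\mathbf{B}_\Omega$ on $L^p(\Omega)$ whenever the integral is defined. Throughout, $p\in(1,\infty)$. *)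

(* Defs.v *)
From HB Require Import structures.
From mathcomp Require Import all_boot all_order all_algebra.
From mathcomp Require Import all_classical all_reals all_analysis.
From mathcomp Require Import complex.
Set Implicit Arguments. Unset Strict Implicit. Unset Printing Implicit Defensive.
Import Order.TTheory GRing.Theory Num.Theory.
Local Open Scope classical_set_scope.
Local Open Scope ring_scope.

Section BergmanDefs.
Variable R : realType.

(* points of C^2 = R^4, a point (z1,z2) = (x1+iy1, x2+iy2) being stored as
   (((x1, y1), x2), y2) *)
Definition pt := (((measurableTypeR R * measurableTypeR R) * measurableTypeR R)
                  * measurableTypeR R)%type.

Definition dV := (((@lebesgue_measure R \x @lebesgue_measure R)
                     \x @lebesgue_measure R) \x @lebesgue_measure R)%E.

Definition cz1 (p : pt) : R[i] := Complex p.1.1.1 p.1.1.2.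
Definition cz2 (p : pt) : R[i] := Complex p.1.2 p.2.
Definition pt_of (w1 w2 : R[i]) : pt :=
  (((complex.Re w1, complex.Im w1), complex.Re w2), complex.Im w2).

Definition cabs (z : R[i]) : R :=
  Num.sqrt (complex.Re z ^+ 2 + complex.Im z ^+ 2).
Definition cconj (z : R[i]) : R[i] := Complex (complex.Re z) (- complex.Im z).

Definition Hgamma (gamma : R) : set pt :=
  [set p | cabs (cz1 p) `^ gamma < cabs (cz2 p) < 1].

Definition holomorphic_at (f : pt -> R[i]) (z : pt) : Prop :=
  exists a b : R[i], forall e : R, 0 < e -> exists d : R, 0 < d /\
    forall h1 h2 : R[i],
      Num.sqrt (cabs h1 ^+ 2 + cabs h2 ^+ 2) < d ->
      cabs (f (pt_of (cz1 z + h1) (cz2 z + h2)) - f z - (a * h1 + b * h2))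
        <= e * Num.sqrt (cabs h1 ^+ 2 + cabs h2 ^+ 2).

Definition holomorphic_on (D : set pt) (f : pt -> R[i]) : Prop :=
  forall z, D z -> holomorphic_at f z.

Definition cmeasurable (D : set pt) (f : pt -> R[i]) : Prop :=
  measurable_fun D (fun x => complex.Re (f x)) /\
  measurable_fun D (fun x => complex.Im (f x)).

Definition Lp (p : R) (D : set pt) (f : pt -> R[i]) : Prop :=
  cmeasurable D f /\
  (\int[dV]_(x in D) ((cabs (f x)) `^ p)%:E < +oo)%E.

Definition Lpnorm (p : R) (D : set pt) (f : pt -> R[i]) : R :=
  (fine (\int[dV]_(x in D) ((cabs (f x)) `^ p)%:E)) `^ p^-1.

Definition Ap (p : R) (D : set pt) (f : pt -> R[i]) : Prop :=
  holomorphic_on D f /\ Lp p D f.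

Definition cintegrable (D : set pt) (f : pt -> R[i]) : Prop :=
  dV.-integrable D (fun x => (complex.Re (f x))%:E) /\
  dV.-integrable D (fun x => (complex.Im (f x))%:E).

Definition cint (D : set pt) (f : pt -> R[i]) : R[i] :=
  Complex (Rintegral dV D (fun x => complex.Re (f x)))
          (Rintegral dV D (fun x => complex.Im (f x))).

Definition is_bergman_kernel (D : set pt) (K : pt -> pt -> R[i]) : Prop :=
  (forall w, D w -> Ap 2 D (fun z => K z w)) /\
  (forall h w, Ap 2 D h -> D w ->
     h w = cint D (fun z => h z * cconj (K z w))).

Definition bergman_op (D : set pt) (K : pt -> pt -> R[i]) (f : pt -> R[i])
  : pt -> R[i] := fun z => cint D (fun w => K z w * f w).

Definition bergman_bounded_Lp (p : R) (D : set pt) (K : pt -> pt -> R[i])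
  : Prop :=
  exists C : R, forall f, Lp p D f ->
    (forall z, D z -> cintegrable D (fun w => K z w * f w)) /\
    Ap p D (bergman_op D K f) /\
    Lpnorm p D (bergman_op D K f) <= C * Lpnorm p D f.

End BergmanDefs.

(* Main.v *)
Require Import Defs.
From HB Require Import structures.
From mathcomp Require Import all_boot all_order all_algebra.
From mathcomp Require Import all_classical all_reals all_analysis.
From mathcomp Require Import complex.
From mathcomp Require Import measurable_realfun ring lra.
Import Order.TTheory GRing.Theory Num.Theory.
Import numFieldNormedType.Exports.
Local Open Scope classical_set_scope.
Local Open Scope ring_scope.
Set Implicit Arguments. Unset Strict Implicit. Unset Printing Implicit Defensive.

(* For p = 2 the operator is the orthogonal projection, which contracts the norm.
   The orthogonal projection commutes with the torus action (z1, z2) -> (u z1, v z2), so it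
   maps a function of weight (a, -m) to a holomorphic function of the same weight, that is to
   a multiple of e = z1^a / z2^m.  Integrating over the dyadic shells |z2| ~ 2^-k, where
   |e| ~ 2^(-k (a/gamma - m)) and the volume is ~ 2^(-k (2/gamma + 2)), one sees that e is in
   L^q exactly when q (a/gamma - m) + 2/gamma + 2 > 0.  As gamma is irrational, the numbers
   a - gamma m are dense, so for every q > 2 some such e is in L^2 but not in L^q.
   Testing against f_n = e |e|^(q-2) cut off to |z2| >= 2^-n gives B f_n = C_n e with
   C_n |e|_2^2 = I_n, the integral of |e|^q over the truncated domain.  If p > 2, take q = p:
   then f_1 is bounded but B f_1 is not in L^p.  If p < 2, take q = p / (p - 1): then
   |f_n|_p = I_n^(1/p) while |B f_n|_p is proportional to I_n, and I_n tends to infinity.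
   Completeness of A^2, needed for the existence of the projection, comes from a Cauchy
   estimate: the circle mean of a holomorphic function makes its values averages against
   translates of a torus invariant bump function, to which derivatives can be moved. *)

(** * Complex numbers and complex derivatives *)

(** The kernel is given only through its reproducing property, so the values of [bergman_op] become
    accessible once an orthogonal projection is known to exist: the kernel functions lie in A^2,
    hence cannot tell f from its projection. The same property bounds point evaluations, so a
    minimizing sequence converges pointwise. What remains is holomorphy of the limit, and this is
    the task of the Cauchy estimate. It is stated as a quadratic Taylor remainder controlled by the
    L^2 norm, a bound that survives pointwise limits. The critical exponent 2 comes from the window
    for a - gamma m: it must exceed -(1 + gamma) for e to be in L^2, and be at most -(2/q)(1 +
    gamma) for e to leave L^q. This interval is nonempty for every q > 2 and collapses as q tends to
    2. For rational gamma the values a - gamma m are discrete and miss it when q is close to 2. The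
    exponent a is taken positive so that a function with the weight of e has to vanish on z1 = 0,
    where logarithmic coordinates break down. *)

Section ComplexModulus.
Variable R : realType.
Implicit Types (z w : R[i]) (x y : R).
Local Notation cabs := (@cabs R).

Lemma cabs_normc z : cabs z = Normc.normc z.
Proof. by case: z. Qed.

Lemma cabs_ge0 z : 0 <= cabs z. Proof. exact: sqrtr_ge0. Qed.

Lemma cabs_sqr z : cabs z ^+ 2 = complex.Re z ^+ 2 + complex.Im z ^+ 2.
Proof. by rewrite sqr_sqrtr// addr_ge0// sqr_ge0. Qed.

Lemma cabs0 : cabs 0 = 0.
Proof. by rewrite /Defs.cabs /= expr0n /= addr0 sqrtr0. Qed.

Lemma cabs1 : cabs 1 = 1.
Proof. by rewrite /Defs.cabs /= expr0n expr1n /= addr0 sqrtr1. Qed.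

Lemma cabsM z w : cabs (z * w) = cabs z * cabs w.
Proof. by rewrite !cabs_normc Normc.normcM. Qed.

Lemma cabsV z : cabs z^-1 = (cabs z)^-1.
Proof. by rewrite !cabs_normc Normc.normcV. Qed.

Lemma cabsN z : cabs (- z) = cabs z.
Proof. by rewrite /Defs.cabs; case: z => a b /=; rewrite !sqrrN. Qed.

Lemma cabsD z w : cabs (z + w) <= cabs z + cabs w.
Proof. by rewrite !cabs_normc; exact: le_normcD. Qed.

Lemma cabsB z w : cabs (z - w) <= cabs z + cabs w.
Proof. by rewrite -(cabsN w) cabsD. Qed.

Lemma cabs_subD z w : cabs z - cabs w <= cabs (z - w).
Proof. by rewrite lerBlDr; apply: le_trans (cabsD _ _); rewrite subrK. Qed.

Lemma cabs0_eq0 z : cabs z = 0 -> z = 0.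
Proof. by rewrite cabs_normc; exact: Normc.eq0_normc. Qed.

Lemma cabs_gt0 z : (0 < cabs z) = (z != 0).
Proof.
rewrite lt_neqAle cabs_ge0 andbT eq_sym; congr (~~ _).
by apply/eqP/eqP => [/cabs0_eq0//|->]; rewrite cabs0.
Qed.

Lemma cabsX z n : cabs (z ^+ n) = cabs z ^+ n.
Proof. by elim: n => [|n IH]; rewrite ?expr0 ?cabs1// !exprS cabsM IH. Qed.

Lemma cabs_real x : cabs (x%:C)%C = `|x|.
Proof. by rewrite /Defs.cabs /= expr0n addr0 sqrtr_sqr. Qed.

Lemma ler_normr_cabs_Re z : `|complex.Re z| <= cabs z.
Proof. by rewrite -sqrtr_sqr ler_wsqrtr// lerDl sqr_ge0. Qed.

Lemma ler_normr_cabs_Im z : `|complex.Im z| <= cabs z.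
Proof. by rewrite -sqrtr_sqr ler_wsqrtr// lerDr sqr_ge0. Qed.

Lemma cabs_le_ReIm z : cabs z <= `|complex.Re z| + `|complex.Im z|.
Proof.
rewrite -(@ler_pXn2r _ 2) ?nnegrE ?cabs_ge0 ?addr_ge0//.
by rewrite cabs_sqr sqrrD !real_normK ?num_real// addrAC lerDl mulrn_wge0 ?mulr_ge0.
Qed.

Lemma ReD z w : complex.Re (z + w) = complex.Re z + complex.Re w.
Proof. by case: z; case: w. Qed.
Lemma ImD z w : complex.Im (z + w) = complex.Im z + complex.Im w.
Proof. by case: z; case: w. Qed.
Lemma ReN z : complex.Re (- z) = - complex.Re z. Proof. by case: z. Qed.
Lemma ImN z : complex.Im (- z) = - complex.Im z. Proof. by case: z. Qed.
Lemma ReB z w : complex.Re (z - w) = complex.Re z - complex.Re w.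
Proof. by rewrite ReD ReN. Qed.
Lemma ImB z w : complex.Im (z - w) = complex.Im z - complex.Im w.
Proof. by rewrite ImD ImN. Qed.
Lemma ReM z w :
  complex.Re (z * w) = complex.Re z * complex.Re w - complex.Im z * complex.Im w.
Proof. by case: z; case: w. Qed.
Lemma ImM z w :
  complex.Im (z * w) = complex.Re z * complex.Im w + complex.Im z * complex.Re w.
Proof. by case: z; case: w. Qed.

Lemma complex_eqP z w :
  complex.Re z = complex.Re w -> complex.Im z = complex.Im w -> z = w.
Proof. by case: z; case: w => /= ? ? ? ? -> ->. Qed.

Lemma cabs_le_norm2 (h1 h2 : R[i]) :
  cabs h1 <= Num.sqrt (cabs h1 ^+ 2 + cabs h2 ^+ 2) /\
  cabs h2 <= Num.sqrt (cabs h1 ^+ 2 + cabs h2 ^+ 2).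
Proof.
by split; rewrite -{1}[cabs _]ger0_norm ?cabs_ge0// -sqrtr_sqr ler_wsqrtr// ?lerDl ?lerDr sqr_ge0.
Qed.

Lemma sqrt_sqrD_le x y : 0 <= x -> 0 <= y -> Num.sqrt (x ^+ 2 + y ^+ 2) <= x + y.
Proof.
move=> x0 y0; rewrite -[leRHS]ger0_norm ?addr_ge0// -sqrtr_sqr ler_wsqrtr//.
by rewrite sqrrD addrAC lerDl mulrn_wge0 ?mulr_ge0.
Qed.

End ComplexModulus.

Section RealDerivative.
Variable R : realType.
Implicit Types (f : R -> R) (x d : R).

(** The quotient-free form matches [holomorphic_at] and [cdiff], so the real derivatives of the
    components of a complex function can be read off by projection. *)
Lemma is_derive_epsP f x d :
  is_derive x 1 f d <->
  (forall e, 0 < e -> exists t, 0 < t /\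
     forall h, `|h| < t -> `|f (x + h) - f x - d * h| <= e * `|h|).
Proof.
split=> [[fd fx] e e0|H].
- have : h^-1 *: (f (h *: 1 + x) - f x) @[h --> 0^'] --> d.
    by rewrite -fx; exact: fd.
  move=> /cvgrPdist_le /(_ e e0) [t /= t0 Ht]; exists t; split=> // h ht.
  have [->|h0] := eqVneq h 0; first by rewrite addr0 mulr0 subrr subr0 normr0 mulr0.
  have := Ht h; rewrite /ball_ /= sub0r normrN => /(_ ht h0).
  rewrite {1}/GRing.scale /= {1}/GRing.scale /= mulr1 (addrC h) => le.
  have -> : f (x + h) - f x - d * h = - (h * (d - h^-1 * (f (x + h) - f x))).
    by rewrite mulrBr mulrA divff// mul1r opprB (mulrC h).
  by rewrite normrN normrM mulrC ler_wpM2r.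
- have cv : h^-1 *: (f (h *: 1 + x) - f x) @[h --> 0^'] --> d.
    apply/cvgrPdist_le => e e0; have [t [t0 Ht]] := H e e0.
    exists t => //= h; rewrite /ball_ /= sub0r normrN => ht h0.
    rewrite {1}/GRing.scale /= {1}/GRing.scale /= mulr1 (addrC h).
    have := Ht h ht.
    have -> : f (x + h) - f x - d * h = - (h * (d - h^-1 * (f (x + h) - f x))).
      by rewrite mulrBr mulrA divff// mul1r opprB (mulrC h).
    by rewrite normrN normrM mulrC ler_pM2r ?normr_gt0.
  by split; [apply/cvg_ex; exists d | exact: cvg_lim].
Qed.

End RealDerivative.

Section ComplexDerivative.
Variable R : realType.
Implicit Types (s z w d : R[i]) (f g : R[i] -> R[i]).

Definition cdiff f s d := forall e : R, 0 < e -> exists t : R, 0 < t /\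
  forall h, cabs h < t -> cabs (f (s + h) - f s - d * h) <= e * cabs h.

Lemma cdiff_cst z s : cdiff (fun=> z) s 0.
Proof.
by move=> e e0; exists 1; split=> // h _; rewrite subrr mul0r subr0 cabs0 mulr_ge0 ?cabs_ge0 ?ltW.
Qed.

Lemma cdiff_id s : cdiff id s 1.
Proof.
move=> e e0; exists 1; split=> // h _.
have -> : id (s + h) - id s - 1 * h = 0 by rewrite /=; ring.
by rewrite cabs0 mulr_ge0 ?cabs_ge0 ?ltW.
Qed.

Lemma cdiff_lip f s d : cdiff f s d -> exists t : R, 0 < t /\
  forall h, cabs h < t -> cabs (f (s + h) - f s) <= (cabs d + 1) * cabs h.
Proof.
move=> /(_ 1 ltr01)[t [t0 H]]; exists t; split=> // h /H; rewrite mul1r => le.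
have -> : f (s + h) - f s = (f (s + h) - f s - d * h) + d * h by rewrite subrK.
by apply: le_trans (cabsD _ _) _; rewrite cabsM mulrDl mul1r addrC lerD2l.
Qed.

Lemma cdiff_cont f s d : cdiff f s d -> forall e : R, 0 < e -> exists t : R, 0 < t /\
  forall h, cabs h < t -> cabs (f (s + h) - f s) <= e.
Proof.
move=> /cdiff_lip[t [t0 H]] e e0.
have c0 : 0 < cabs d + 1 by rewrite ltr_wpDl ?cabs_ge0.
exists (Num.min t (e / (cabs d + 1))); split.
  by rewrite lt_min t0 divr_gt0.
move=> h; rewrite lt_min => /andP[/H le lt]; apply: le_trans le _.
by rewrite mulrC -ler_pdivlMr// ltW.
Qed.

Lemma cdiffM f g s a b : cdiff f s a -> cdiff g s b ->
  cdiff (fun x => f x * g x) s (a * g s + f s * b).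
Proof.
move=> fa gb e e0.
(* [M] is the sum of the coefficients that the four error terms below put in front of [k]. *)
set M := cabs (g s) + cabs (f s) + cabs b + 1.
have M0 : 0 < M by rewrite ltr_wpDl// !addr_ge0 ?cabs_ge0.
have e3 : 0 < e / (3 * M) by rewrite divr_gt0// mulr_gt0.
have [t1 [t10 H1]] := fa _ e3.
have [t2 [t20 H2]] := gb _ e3.
have [t3 [t30 H3]] := cdiff_cont fa e3.
have [t4 [t40 H4]] := cdiff_cont fa ltr01.
exists (Num.min (Num.min t1 t2) (Num.min t3 t4)); split; first by rewrite !lt_min t10 t20 t30.
move=> h; rewrite !lt_min => /andP[/andP[h1 h2] /andP[h3 h4]].
have {}H1 := H1 _ h1; have {}H2 := H2 _ h2; have {}H3 := H3 _ h3; have {}H4 := H4 _ h4.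
have -> : f (s + h) * g (s + h) - f s * g s - (a * g s + f s * b) * h =
  (f (s + h) - f s - a * h) * g s + f s * (g (s + h) - g s - b * h) + (f (s + h) - f s) * (g (s + h) - g s - b * h) + (f (s + h) - f s) * (b * h) by ring.
have h0 := cabs_ge0 h.
have E : e * cabs h = e / (3 * M) * cabs h * (3 * M).
  by field; rewrite gt_eqF.
set k := e / (3 * M) * cabs h in E H1 H2.
have k0 : 0 <= k by rewrite mulr_ge0// ltW.
have ek : 0 < e / (3 * M) by [].
rewrite E; apply: le_trans (cabsD _ _) _; apply: le_trans (lerD (cabsD _ _) (lexx _)) _.
apply: le_trans (lerD (lerD (cabsD _ _) (lexx _)) (lexx _)) _.
rewrite !cabsM.
have A1 : cabs (f (s + h) - f s - a * h) * cabs (g s) <= k * cabs (g s) by rewrite ler_wpM2r ?cabs_ge0.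
have A2 : cabs (f s) * cabs (g (s + h) - g s - b * h) <= k * cabs (f s) by rewrite mulrC ler_wpM2r ?cabs_ge0.
have A4 : cabs (f (s + h) - f s) * (cabs b * cabs h) <= k * cabs b.
  by rewrite mulrCA mulrC ler_wpM2r ?cabs_ge0// ler_wpM2r.
have A3 : cabs (f (s + h) - f s) * cabs (g (s + h) - g s - b * h) <= k.
  by rewrite -[leRHS]mul1r; apply: ler_pM; rewrite ?cabs_ge0.
have gs := cabs_ge0 (g s); have fs := cabs_ge0 (f s); have bs := cabs_ge0 b.
have -> : k * (3 * M) = 3 * (k * cabs (g s)) + 3 * (k * cabs (f s)) + 3 * (k * cabs b) + 3 * k by rewrite /M; ring.
have := mulr_ge0 k0 gs; have := mulr_ge0 k0 fs; have := mulr_ge0 k0 bs.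
by lra.
Qed.

Lemma cdiffX n s : exists d, cdiff (fun x => x ^+ n) s d.
Proof.
elim: n => [|n [d IH]]; first by exists 0; exact: cdiff_cst.
exists (1 * s ^+ n + s * d).
by under eq_fun do rewrite exprS; exact: cdiffM (cdiff_id s) IH.
Qed.

Lemma cdiffV s : s != 0 -> cdiff GRing.inv s (- s ^- 2).
Proof.
move=> s0 e e0; have S0 : 0 < cabs s by rewrite cabs_gt0.
(* The first bound keeps |s + h| above |s| / 2; with it the second makes the remainder h^2 / (s^2 (s
   + h)) at most e |h|. *)
exists (Num.min (cabs s / 2) (e * cabs s ^+ 3 / 2)); split.
  by rewrite lt_min !divr_gt0// mulr_gt0// exprn_gt0.
move=> h; rewrite lt_min => /andP[h1 h2].
have sh : cabs s / 2 <= cabs (s + h).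
  by have := cabs_subD s (- h); rewrite opprK cabsN; lra.
have SH0 : 0 < cabs (s + h) by apply: lt_le_trans sh; rewrite divr_gt0.
have sh0 : s + h != 0 by rewrite -cabs_gt0.
have -> : (s + h)^-1 - s^-1 - - s ^- 2 * h = h ^+ 2 / (s ^+ 2 * (s + h)).
  by field; rewrite ?s0 ?sh0.
rewrite cabsM cabsV cabsM !cabsX expr2 mulrAC ler_wpM2r ?cabs_ge0//.
rewrite ler_pdivrMr ?mulr_gt0 ?exprn_gt0//; apply: le_trans (ltW h2) _.
have -> : e * cabs s ^+ 3 / 2 = e * (cabs s ^+ 2 * (cabs s / 2)) by ring.
by rewrite ler_pM2l// ler_pM2l ?exprn_gt0.
Qed.

Lemma cdiff_comp f g s d c : cdiff g s c -> cdiff f (g s) d ->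
  cdiff (f \o g) s (d * c).
Proof.
move=> gc fd e e0; have [t1 [t10 H1]] := cdiff_lip gc.
set M := cabs c + 1 in H1; have M0 : 0 < M by rewrite ltr_wpDl ?cabs_ge0.
set N := cabs d + 1; have N0 : 0 < N by rewrite ltr_wpDl ?cabs_ge0.
have [t2 [t20 H2]] := fd _ (divr_gt0 e0 (mulr_gt0 (ltr0n _ 2) M0)).
have [t3 [t30 H3]] := gc _ (divr_gt0 e0 (mulr_gt0 (ltr0n _ 2) N0)).
exists (Num.min (Num.min t1 t3) (t2 / M)); split; first by rewrite !lt_min t10 t30 divr_gt0.
move=> h; rewrite !lt_min => /andP[/andP[/H1 h1 /H3 h3] h2].
have h0 := cabs_ge0 h.
have {}h2 : cabs (g (s + h) - g s) < t2.
  by apply: le_lt_trans h1 _; rewrite mulrC -ltr_pdivlMr.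
have := H2 _ h2; rewrite (addrC (g s)) subrK => {}H2 /=.
have -> : f (g (s + h)) - f (g s) - d * c * h =
  (f (g (s + h)) - f (g s) - d * (g (s + h) - g s)) + d * (g (s + h) - g s - c * h) by ring.
apply: le_trans (cabsD _ _) _; rewrite cabsM.
have A : e / (2 * M) * cabs (g (s + h) - g s) <= e / 2 * cabs h.
  have -> : e / 2 * cabs h = e / (2 * M) * (M * cabs h) by field; rewrite gt_eqF.
  by rewrite ler_wpM2l// ltW// divr_gt0// mulr_gt0.
have B : cabs d * cabs (g (s + h) - g s - c * h) <= e / 2 * cabs h.
  have -> : e / 2 * cabs h = N * (e / (2 * N) * cabs h) by field; rewrite gt_eqF.
  by apply: ler_pM; rewrite ?cabs_ge0// /N lerDl.
by move: A B H2; lra.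
Qed.

Lemma cz1_pt_of w1 w2 : cz1 (pt_of w1 w2) = w1. Proof. by case: w1. Qed.
Lemma cz2_pt_of w1 w2 : cz2 (pt_of w1 w2) = w2. Proof. by case: w2. Qed.
Lemma pt_of_cz (p : pt R) : pt_of (cz1 p) (cz2 p) = p.
Proof. by move: p => [[[? ?] ?] ?]. Qed.

Lemma holomorphic_cdiff_comp (F : pt R -> R[i]) u v s a b :
  holomorphic_at F (pt_of (u s) (v s)) -> cdiff u s a -> cdiff v s b ->
  exists d, cdiff (fun x => F (pt_of (u x) (v x))) s d.
Proof.
move=> [A [B HF]] ua vb; exists (A * a + B * b) => e e0.
rewrite cz1_pt_of cz2_pt_of in HF.
have [t1 [t10 H1]] := cdiff_lip ua; have [t2 [t20 H2]] := cdiff_lip vb.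
set M := (cabs a + 1) + (cabs b + 1).
have M0 : 0 < M by rewrite addr_gt0// ltr_wpDl ?cabs_ge0.
set N := (cabs A + 1) + (cabs B + 1).
have N0 : 0 < N by rewrite addr_gt0// ltr_wpDl ?cabs_ge0.
have [t3 [t30 H3]] := HF _ (divr_gt0 e0 (mulr_gt0 (ltr0n _ 2) M0)).
have [t4 [t40 H4]] := ua _ (divr_gt0 e0 (mulr_gt0 (ltr0n _ 2) N0)).
have [t5 [t50 H5]] := vb _ (divr_gt0 e0 (mulr_gt0 (ltr0n _ 2) N0)).
exists (Num.min (Num.min (Num.min t1 t2) (Num.min t4 t5)) (t3 / M)); split.
  by rewrite !lt_min t10 t20 t40 t50 divr_gt0.
move=> h; rewrite !lt_min => /andP[/andP[/andP[/H1 h1 /H2 h2] /andP[/H4 h4 /H5 h5]] h3].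
have h0 := cabs_ge0 h.
set k1 := u (s + h) - u s in h1 h4 *; set k2 := v (s + h) - v s in h2 h5 *.
have kM : Num.sqrt (cabs k1 ^+ 2 + cabs k2 ^+ 2) <= M * cabs h.
  by apply: le_trans (sqrt_sqrD_le (cabs_ge0 _) (cabs_ge0 _)) _; rewrite mulrDl lerD.
have {}H3 : cabs (F (pt_of (u (s + h)) (v (s + h))) - F (pt_of (u s) (v s)) - (A * k1 + B * k2)) <=
    e / (2 * M) * Num.sqrt (cabs k1 ^+ 2 + cabs k2 ^+ 2).
  have := H3 k1 k2; rewrite /k1 /k2 !(addrC (u s)) !(addrC (v s)) !subrK; apply.
  by rewrite -/k1 -/k2; apply: le_lt_trans kM _; rewrite mulrC -ltr_pdivlMr.
have -> : F (pt_of (u (s + h)) (v (s + h))) - F (pt_of (u s) (v s)) - (A * a + B * b) * h =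
   (F (pt_of (u (s + h)) (v (s + h))) - F (pt_of (u s) (v s)) - (A * k1 + B * k2))
   + (A * (k1 - a * h) + B * (k2 - b * h)) by ring.
apply: le_trans (cabsD _ _) _.
apply: le_trans (lerD (lexx _) (cabsD _ _)) _; rewrite !cabsM.
have X : e / (2 * M) * Num.sqrt (cabs k1 ^+ 2 + cabs k2 ^+ 2) <= e / 2 * cabs h.
  have -> : e / 2 * cabs h = e / (2 * M) * (M * cabs h) by field; rewrite gt_eqF.
  by rewrite ler_wpM2l// ltW// divr_gt0// mulr_gt0.
have Y : cabs A * cabs (k1 - a * h) + cabs B * cabs (k2 - b * h) <= e / 2 * cabs h.
  have -> : e / 2 * cabs h = (cabs A + 1) * (e / (2 * N) * cabs h) + (cabs B + 1) * (e / (2 * N) * cabs h).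
    by rewrite /N in N0 *; field; rewrite gt_eqF.
  by apply: lerD; apply: ler_pM; rewrite ?cabs_ge0// lerDl.
by move: X Y H3; lra.
Qed.

Lemma holomorphic_prod u v (z : pt R) a b :
  cdiff u (cz1 z) a -> cdiff v (cz2 z) b ->
  holomorphic_at (fun p => u (cz1 p) * v (cz2 p)) z.
Proof.
move=> ua vb; set s1 := cz1 z in ua *; set s2 := cz2 z in vb *.
exists (a * v s2), (u s1 * b) => e e0.
set M := cabs (v s2) + cabs (u s1) + (cabs b + 1).
have M0 : 0 < M by rewrite ltr_wpDl ?addr_ge0 ?cabs_ge0 ?ltr_wpDl ?cabs_ge0.
have eM : 0 < e / (2 * M) by rewrite divr_gt0// mulr_gt0.
have [t1 [t10 H1]] := ua _ eM; have [t2 [t20 H2]] := vb _ eM.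
have [t3 [t30 H3]] := cdiff_cont ua eM.
have [t4 [t40 H4]] := cdiff_lip vb.
exists (Num.min (Num.min t1 t2) (Num.min t3 t4)); split; first by rewrite !lt_min t10 t20 t30.
move=> h1 h2; rewrite !lt_min => /andP[/andP[l1 l2] /andP[l3 l4]].
have [n1 n2] := cabs_le_norm2 h1 h2.
set n := Num.sqrt _ in l1 l2 l3 l4 n1 n2 *.
have {}H1 := H1 _ (le_lt_trans n1 l1); have {}H2 := H2 _ (le_lt_trans n2 l2).
have {}H3 := H3 _ (le_lt_trans n1 l3); have {}H4 := H4 _ (le_lt_trans n2 l4).
rewrite !cz1_pt_of !cz2_pt_of -/s1 -/s2.
have -> : u (s1 + h1) * v (s2 + h2) - u s1 * v s2 - (a * v s2 * h1 + u s1 * b * h2) =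
  (u (s1 + h1) - u s1 - a * h1) * v s2 + u s1 * (v (s2 + h2) - v s2 - b * h2)
  + (u (s1 + h1) - u s1) * (v (s2 + h2) - v s2) by ring.
apply: le_trans (cabsD _ _) _; apply: le_trans (lerD (cabsD _ _) (lexx _)) _; rewrite !cabsM.
set k := e / (2 * M) in eM H1 H2 H3.
have n0 : 0 <= n by exact: sqrtr_ge0.
have E : e * n = 2 * (k * n * cabs (v s2) + k * n * cabs (u s1) + k * ((cabs b + 1) * n)).
  by rewrite /k /M in M0 *; field; rewrite gt_eqF.
have A1 : cabs (u (s1 + h1) - u s1 - a * h1) * cabs (v s2) <= k * n * cabs (v s2).
  rewrite ler_wpM2r ?cabs_ge0//; apply: le_trans H1 _; rewrite ler_wpM2l// ltW//.
have A2 : cabs (u s1) * cabs (v (s2 + h2) - v s2 - b * h2) <= k * n * cabs (u s1).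
  rewrite mulrC ler_wpM2r ?cabs_ge0//; apply: le_trans H2 _; rewrite ler_wpM2l// ltW//.
have A3 : cabs (u (s1 + h1) - u s1) * cabs (v (s2 + h2) - v s2) <= k * ((cabs b + 1) * n).
  apply: ler_pM; rewrite ?cabs_ge0//; apply: le_trans H4 _.
  by rewrite ler_wpM2l// addr_ge0 ?cabs_ge0.
have kn : 0 <= k * n by rewrite mulr_ge0// ltW.
have := mulr_ge0 kn (cabs_ge0 (v s2)); have := mulr_ge0 kn (cabs_ge0 (u s1)).
have : 0 <= k * ((cabs b + 1) * n) by rewrite pmulr_rge0// mulr_ge0 ?addr_ge0 ?cabs_ge0.
by rewrite E; lra.
Qed.

Definition cexp (s : R[i]) : R[i] :=
  Complex (expR (complex.Re s) * cos (complex.Im s)) (expR (complex.Re s) * sin (complex.Im s)).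

Lemma cexpD s w : cexp (s + w) = cexp s * cexp w.
Proof.
case: s w => [x y] [u v]; apply: complex_eqP; rewrite ?ReM ?ImM /= expRD ?cosD ?sinD; ring.
Qed.

Lemma cexp0 : cexp 0 = 1.
Proof. by rewrite /cexp /= expR0 cos0 sin0 mulr0 mulr1. Qed.

Lemma cabs_cexp s : cabs (cexp s) = expR (complex.Re s).
Proof.
rewrite /cabs /= !exprMn -mulrDr cos2Dsin2 mulr1 sqrtr_sqr ger0_norm// ltW// expR_gt0//.
Qed.

Lemma cexp_neq0 s : cexp s != 0.
Proof. by rewrite -cabs_gt0 cabs_cexp expR_gt0. Qed.

Lemma cexpMn s n : cexp (s *+ n) = cexp s ^+ n.
Proof. by elim: n => [|n IH]; rewrite ?mulr0n ?cexp0// mulrS cexpD IH exprS. Qed.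

Lemma cexp_2pi s : cexp (s + Complex 0 (2 * pi)) = cexp s.
Proof.
by rewrite cexpD /cexp /= expR0 mulrC (_ : 2 * pi = pi *+ 2) ?cos2pi ?sin2pi ?mulr0 ?mulr1 ?mul1r// mulr_natl.
Qed.

(** The real derivatives of exp, cos and sin enter at this one point; the functional equation
    [cexpD] carries the result everywhere. *)
Lemma cdiff_cexp0 : cdiff cexp 0 1.
Proof.
move=> e e0.
have e8 : 0 < e / 8 by rewrite divr_gt0.
have [t1 [t10 H1]] := (is_derive_epsP expR 0 1).1 (is_derive_eq (is_derive_expR 0) (expR0 _)) _ e8.
have [t2 [t20 H2]] := (is_derive_epsP cos 0 0).1 (is_derive_eq (is_derive_cos 0) (etrans (congr1 -%R (sin0 _)) (oppr0 _))) _ e8.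
have [t3 [t30 H3]] := (is_derive_epsP sin 0 1).1 (is_derive_eq (is_derive_sin 0) (cos0 _)) _ e8.
(* The bound 1 yields [expR x <= 2]; the bound [e / 8] controls the cross term
   [(expR x - 1) * y]. *)
set E := Num.min 1 (e / 8).
have E0 : 0 < E by rewrite lt_min ltr01.
have [t4 [t40 H4]] := (is_derive_epsP expR 0 1).1 (is_derive_eq (is_derive_expR 0) (expR0 _)) _ (ltr01 : (0:R) < 1).
exists (Num.min (Num.min t1 t2) (Num.min (Num.min t3 t4) (E / 2))); split.
  by rewrite !lt_min t10 t20 t30 t40 divr_gt0.
move=> [x y]; rewrite !lt_min => /andP[/andP[l1 l2] /andP[/andP[l3 l4] l5]].
have X := ler_normr_cabs_Re (Complex x y); have Y := ler_normr_cabs_Im (Complex x y).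
rewrite /= in X Y; set n := cabs _ in l1 l2 l3 l4 l5 X Y *.
have n0 : 0 <= n := cabs_ge0 _.
have := H1 _ (le_lt_trans X l1); have := H2 _ (le_lt_trans Y l2).
have := H3 _ (le_lt_trans Y l3); have := H4 _ (le_lt_trans X l4).
rewrite !add0r cexp0 expR0 cos0 sin0 !mul1r mul0r !subr0 => h4 h3 h2 h1.
have ex1 : `|expR x - 1| <= E.
  have -> : expR x - 1 = (expR x - 1 - x) + x by rewrite subrK.
  by apply: le_trans (ler_normD _ _) _; lra.
have ex2 : expR x <= 2.
  have := le_trans (ler_norm _) ex1; rewrite /E le_min => /andP[]; lra.
have ex0 := expR_gt0 x.
have ex3 : `|expR x - 1| <= e / 8 by apply: le_trans ex1 _; rewrite ge_min lexx orbT.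
apply: le_trans (cabs_le_ReIm _) _; rewrite !ReB !ImB /=.
have -> : expR x * cos y - 1 - x = expR x * (cos y - 1) + (expR x - 1 - x) by ring.
have -> : expR x * sin y - 0 - y = expR x * (sin y - y) + (expR x - 1) * y by ring.
have A k : `|expR x * k| <= 2 * `|k| by rewrite normrM gtr0_norm// ler_wpM2r.
have B : `|(expR x - 1) * y| <= e / 8 * n by rewrite normrM; apply: ler_pM.
apply: le_trans (lerD (ler_normD _ _) (ler_normD _ _)) _.
have k1 : e / 8 * `|x| <= e / 8 * n by rewrite ler_pM2l.
have k2 : e / 8 * `|y| <= e / 8 * n by rewrite ler_pM2l.
have := A (cos y - 1); have := A (sin y - y).
have : 0 <= e * n by rewrite pmulr_rge0.
lra.
Qed.

Lemma cdiff_cexp s : cdiff cexp s (cexp s).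
Proof.
move=> e e0.
have c0 : 0 < cabs (cexp s) by rewrite cabs_gt0 cexp_neq0.
have [t [t0 H]] := cdiff_cexp0 (divr_gt0 e0 c0); exists t; split=> // h /H.
rewrite add0r cexp0 mul1r cexpD => le.
have -> : cexp s * cexp h - cexp s - cexp s * h = cexp s * (cexp h - 1 - h) by ring.
by rewrite cabsM mulrC -ler_pdivlMr// mulrAC.
Qed.

End ComplexDerivative.

(** * The mean value property *)

Section Goursat.
Variable R : realType.

Lemma MVT_cc (f df : R -> R) (a b : R) : a <= b ->
  (forall x, a <= x <= b -> is_derive x 1 f (df x)) ->
  exists2 c, a <= c <= b & f b - f a = df c * (b - a).
Proof.
move=> ab H.
have [||c /[!in_itv]/= cab ->] := @MVT_segment R f df a b ab.
- by move=> c; rewrite in_itv /= => /andP[c1 c2]; apply: H; rewrite !ltW.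
- apply: derivable_within_continuous => c; rewrite in_itv /= => /H dc; exact: ex_derive.
- by exists c.
Qed.

(** The second difference over the corners of a rectangle, additive under subdivision just as a
    contour integral is. *)
Definition dd (W : R -> R -> R) x1 x2 y1 y2 := W x2 y2 - W x1 y2 - W x2 y1 + W x1 y1.

(** The second differences of the four quarters add up to that of the rectangle, so one of them has
    at least a fourth of its modulus. *)
Lemma dd_quarter W x w y v :
  exists a b, (a = x \/ a = x + w / 2) /\ (b = y \/ b = y + v / 2) /\
  `|dd W x (x + w) y (y + v)| <= 4 * `|dd W a (a + w / 2) b (b + v / 2)|.
Proof.
apply: contrapT => H.
have K a b : (a = x \/ a = x + w / 2) -> (b = y \/ b = y + v / 2) ->
  4 * `|dd W a (a + w / 2) b (b + v / 2)| < `|dd W x (x + w) y (y + v)|.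
  by move=> ha hb; rewrite ltNge; apply/negP => le; apply: H; exists a, b.
have k1 := K _ _ (or_introl erefl) (or_introl erefl).
have k2 := K _ _ (or_introl erefl) (or_intror erefl).
have k3 := K _ _ (or_intror erefl) (or_introl erefl).
have k4 := K _ _ (or_intror erefl) (or_intror erefl).
have xw : x + w / 2 + w / 2 = x + w by field.
have yv : y + v / 2 + v / 2 = y + v by field.
rewrite ?xw ?yv in k1 k2 k3 k4.
set x' := x + w / 2 in k1 k2 k3 k4; set y' := y + v / 2 in k1 k2 k3 k4.
have E : dd W x (x + w) y (y + v) = dd W x x' y y' + dd W x x' y' (y + v)
  + dd W x' (x + w) y y' + dd W x' (x + w) y' (y + v) by rewrite /dd; ring.
have := ler_normD (dd W x x' y y' + dd W x x' y' (y + v) + dd W x' (x + w) y y') (dd W x' (x + w) y' (y + v)).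
have := ler_normD (dd W x x' y y' + dd W x x' y' (y + v)) (dd W x' (x + w) y y').
have := ler_normD (dd W x x' y y') (dd W x x' y' (y + v)).
rewrite -E; lra.
Qed.

(** Each interval is one half of its predecessor; the supremum of the left ends lies in all of
    them. *)
Lemma nested_point (u : nat -> R) (w : R) : 0 <= w ->
  (forall n, u n.+1 = u n \/ u n.+1 = u n + w / 2 ^+ n.+1) ->
  exists c, forall n, u n <= c <= u n + w / 2 ^+ n.
Proof.
move=> w0 H.
have p n : 0 <= w / 2 ^+ n by rewrite divr_ge0 ?exprn_ge0.
have half n : w / 2 ^+ n = w / 2 ^+ n.+1 + w / 2 ^+ n.+1.
  by rewrite exprS; field; rewrite expf_neq0.
have st n : u n <= u n.+1 /\ u n.+1 + w / 2 ^+ n.+1 <= u n + w / 2 ^+ n.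
  by rewrite (half n); have := p n.+1; have [->|->] := H n => ?; split; lra.
have inc n k : u n <= u (n + k)%N /\ u (n + k)%N + w / 2 ^+ (n + k) <= u n + w / 2 ^+ n.
  elim: k => [|k [h1 h2]]; first by rewrite addn0.
  by rewrite addnS; have [s1 s2] := st (n + k)%N; split; [exact: le_trans s1|exact: le_trans h2].
have ub m n : u m <= u n + w / 2 ^+ n.
  have [i1 i2] := inc m n; have [j1 j2] := inc n m; have := p (n + m)%N.
  by move: i1 i2 j1 j2; rewrite (addnC n); lra.
exists (sup (range u)) => n; apply/andP; split.
  apply: ub_le_sup; last by exists n.
  by exists (u 0%N + w / 2 ^+ 0) => _ [m _ <-]; exact: ub.
by apply: ge_sup; [exists (u 0%N), 0%N | move=> _ [m _ <-]; exact: ub].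
Qed.

(** After n bisections the second difference has shrunk by a factor of at most 4^n, whereas the
    hypothesis at the common point of the quarters bounds it by e (w + v)^2 / 4^n. The factors
    cancel and e is arbitrary. *)
Lemma dd_eq0 W x w y v : 0 <= w -> 0 <= v ->
  (forall x0 y0 : R, x <= x0 <= x + w -> y <= y0 <= y + v -> forall e : R, 0 < e ->
     exists t : R, 0 < t /\ forall x1 x2 y1 y2 : R, x <= x1 -> x1 <= x0 -> x0 <= x2 -> x2 <= x + w ->
       y <= y1 -> y1 <= y0 -> y0 <= y2 -> y2 <= y + v -> x2 - x1 < t -> y2 - y1 < t ->
       `|dd W x1 x2 y1 y2| <= e * ((x2 - x1) + (y2 - y1)) ^+ 2) ->
  dd W x (x + w) y (y + v) = 0.
Proof.
move=> w0 v0 H.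
(* One bisection: from a level and a lower left corner to the corner of a quarter that keeps a
   fourth of the modulus. Choice turns this into a recursion. *)
pose P (q : nat * (R * R)) (q' : R * R) :=
  (q'.1 = q.2.1 \/ q'.1 = q.2.1 + w / 2 ^+ q.1.+1) /\
  (q'.2 = q.2.2 \/ q'.2 = q.2.2 + v / 2 ^+ q.1.+1) /\
  `|dd W q.2.1 (q.2.1 + w / 2 ^+ q.1) q.2.2 (q.2.2 + v / 2 ^+ q.1)| <=
   4 * `|dd W q'.1 (q'.1 + w / 2 ^+ q.1.+1) q'.2 (q'.2 + v / 2 ^+ q.1.+1)|.
have [nx nxP] : {f : nat * (R * R) -> R * R & forall q, P q (f q)}.
  apply: choice => -[n [a b]]; have [a' [b' h]] := dd_quarter W a (w / 2 ^+ n) b (v / 2 ^+ n).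
  have E (c : R) : c / 2 ^+ n.+1 = c / 2 ^+ n / 2 by rewrite exprS; field; rewrite expf_neq0.
  by exists (a', b'); rewrite /P /= !E.
pose fix s (n : nat) : R * R := if n is m.+1 then nx (m, s m) else (x, y).
have [x0 X0] : exists c, forall n, (s n).1 <= c <= (s n).1 + w / 2 ^+ n.
  by apply: nested_point => // n; have [] := nxP (n, s n).
have [y0 Y0] : exists c, forall n, (s n).2 <= c <= (s n).2 + v / 2 ^+ n.
  by apply: nested_point => // n; have [_ []] := nxP (n, s n).
have D n : `|dd W x (x + w) y (y + v)| <=
   4 ^+ n * `|dd W (s n).1 ((s n).1 + w / 2 ^+ n) (s n).2 ((s n).2 + v / 2 ^+ n)|.
  elim: n => [|n IH]; first by rewrite !expr0 !divr1 mul1r.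
  apply: le_trans IH _; have [_ [_ ]] := nxP (n, s n).
  by rewrite (exprSr 4) -(mulrA (4 ^+ n)) ler_pM2l ?exprn_gt0.
have half (c : R) n : c / 2 ^+ n = c / 2 ^+ n.+1 + c / 2 ^+ n.+1.
  by rewrite exprS; field; rewrite expf_neq0.
have p (c : R) n : 0 <= c -> 0 <= c / 2 ^+ n by move=> c0; rewrite divr_ge0 ?exprn_ge0.
have IN n : [/\ x <= (s n).1, (s n).1 + w / 2 ^+ n <= x + w, y <= (s n).2 & (s n).2 + v / 2 ^+ n <= y + v].
  elim: n => [|n [i1 i2 i3 i4]]; first by rewrite !expr0 !divr1.
  rewrite !(half _ n) in i2 i4; have pw := p w n.+1 w0; have pv := p v n.+1 v0.
  have [/= h1 [h2 _]] := nxP (n, s n).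
  by clear - i1 i2 i3 i4 pw pv h1 h2; case: h1 => ->; case: h2 => ->; split; lra.
have key e : 0 < e -> `|dd W x (x + w) y (y + v)| <= e * (w + v) ^+ 2.
  move=> e0.
  have X00 : x <= x0 <= x + w by have := X0 0%N; rewrite /= expr0 divr1.
  have Y00 : y <= y0 <= y + v by have := Y0 0%N; rewrite /= expr0 divr1.
  have [t [t0 Ht]] := H x0 y0 X00 Y00 e e0.
  have [n [nw nv]] : exists n, w / 2 ^+ n < t /\ v / 2 ^+ n < t.
    (* Enough because n < 2^n. *)
    pose n := (Num.truncn ((w + v) / t)).+1; exists n.
    have N : (w + v) / t < n%:R by apply: truncnS_gt; rewrite divr_ge0// ?addr_ge0// ltW.
    have N2 : (n%:R : R) <= 2 ^+ n by rewrite -natrX ler_nat ltnW// ltn_expl.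
    have : w + v < 2 ^+ n * t by rewrite -ltr_pdivrMr//; exact: lt_le_trans N2.
    by move=> lt; split; rewrite ltr_pdivrMr ?exprn_gt0// mulrC; lra.
  have [i1 i2 i3 i4] := IN n; have /andP[x1 x2] := X0 n; have /andP[y1 y2] := Y0 n.
  have := Ht _ _ _ _ i1 x1 x2 i2 i3 y1 y2 i4.
  rewrite !(addrAC _ _ (- _)) !subrr !add0r => /(_ nw nv) le.
  apply: le_trans (D n) _; apply: le_trans (ler_wpM2l (exprn_ge0 _ _) le) _ => //.
  have -> : w / 2 ^+ n + v / 2 ^+ n = (w + v) / 2 ^+ n by rewrite mulrDl.
  rewrite exprMn exprVn -exprM mulnC exprM (_ : 2 ^+ 2 = 4 :> R); last by ring.
  by rewrite le_eqVlt; apply/orP; left; apply/eqP; field; rewrite expf_neq0.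
apply/eqP; rewrite -normr_eq0 eq_le normr_ge0 andbT; apply/ler_addgt0Pr => e e0; rewrite add0r.
have q0 : 0 < (w + v) ^+ 2 + 1 by rewrite ltr_wpDl ?sqr_ge0.
apply: le_trans (key _ (divr_gt0 e0 q0)) _.
by rewrite mulrAC ler_pdivrMr// ler_pM2l// lerDl.
Qed.

(* When [A] and [B] are antiderivatives of [P ds] and [Q dt], the integral of the closed form
   [P ds + Q dt] along a rectangle is a second difference of [B - A], so that Goursat's
   bisection argument needs no integrals. *)
Lemma goursat_dd (A B P Q : R -> R -> R) x w y v : 0 <= w -> 0 <= v ->
  (forall s t : R, x <= s <= x + w -> y <= t <= y + v -> is_derive s 1 (A ^~ t) (P s t)) ->
  (forall s t : R, x <= s <= x + w -> y <= t <= y + v -> is_derive t 1 (B s) (Q s t)) ->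
  (forall s t : R, x <= s <= x + w -> y <= t <= y + v -> exists p1 p2 q2 : R, forall e : R, 0 < e ->
     exists r : R, 0 < r /\ forall h k : R, `|h| < r -> `|k| < r ->
       `|P (s + h) (t + k) - P s t - (p1 * h + p2 * k)| <= e * (`|h| + `|k|) /\
       `|Q (s + h) (t + k) - Q s t - (p2 * h + q2 * k)| <= e * (`|h| + `|k|)) ->
  dd B x (x + w) y (y + v) = dd A x (x + w) y (y + v).
Proof.
move=> w0 v0 HA HB HPQ.
suff : dd (fun s t => B s t - A s t) x (x + w) y (y + v) = 0.
  by move/eqP; rewrite /dd => /eqP ?; lra.
apply: dd_eq0 => // x0 y0 Hx0 Hy0 e e0.
have [p1 [p2 [q2 H]]] := HPQ _ _ Hx0 Hy0.
have [r [r0 Hr]] := H _ (divr_gt0 e0 (ltr0n _ 4)).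
exists r; split=> // x1 x2 y1 y2 a1 a2 a3 a4 b1 b2 b3 b4 lx ly.
have sub (c c1 c2 l u : R) : l <= c1 -> c2 <= u -> c1 <= c <= c2 -> l <= c <= u.
  by move=> lc cu /andP[h1 h2]; rewrite (le_trans lc h1) (le_trans h2 cu).
have x12 := le_trans a2 a3; have y12 := le_trans b2 b3.
have DA s : x1 <= s <= x2 -> is_derive s 1 (fun s => A s y2 - A s y1) (P s y2 - P s y1).
  by move=> /(sub _ _ _ _ _ a1 a4) hs; apply: is_deriveB; apply: HA => //; apply: (sub _ _ _ _ _ b1 b4); rewrite lexx y12.
have DB t : y1 <= t <= y2 -> is_derive t 1 (fun t => B x2 t - B x1 t) (Q x2 t - Q x1 t).
  by move=> /(sub _ _ _ _ _ b1 b4) ht; apply: is_deriveB; apply: HB => //; apply: (sub _ _ _ _ _ a1 a4); rewrite lexx x12.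
have [s /andP[s1 s2] Es] := MVT_cc x12 DA.
have [t /andP[t1 t2] Et] := MVT_cc y12 DB.
(* Closedness enters here: [p2] is both the t-derivative of [P] and the s-derivative of [Q], so it
   may be subtracted from both mean-value slopes, and two small factors remain. *)
have -> : dd (fun s t => B s t - A s t) x1 x2 y1 y2 =
   (Q x2 t - Q x1 t - p2 * (x2 - x1)) * (y2 - y1) - (P s y2 - P s y1 - p2 * (y2 - y1)) * (x2 - x1).
  by move: Es Et; rewrite /dd; clear; lra.
have nb (c c1 c2 c0 : R) : c1 <= c -> c <= c2 -> c1 <= c0 -> c0 <= c2 -> c2 - c1 < r -> `|c - c0| < r /\ `|c - c0| <= c2 - c1.
  by clear; move=> *; split; [rewrite ltr_norml | rewrite ler_norml]; apply/andP; split; lra.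
have [n1 n1'] := nb s _ _ _ s1 s2 a2 a3 lx; have [n2 n2'] := nb t _ _ _ t1 t2 b2 b3 ly.
have [n3 n3'] := nb x2 _ _ _ (le_trans a2 a3) (lexx _) a2 a3 lx.
have [n4 n4'] := nb x1 _ _ _ (lexx _) (le_trans a2 a3) a2 a3 lx.
have [n5 n5'] := nb y2 _ _ _ (le_trans b2 b3) (lexx _) b2 b3 ly.
have [n6 n6'] := nb y1 _ _ _ (lexx _) (le_trans b2 b3) b2 b3 ly.
have [Ps2 _] := Hr _ _ n1 n5; have [Ps1 _] := Hr _ _ n1 n6.
have [_ Qt2] := Hr _ _ n3 n2; have [_ Qt1] := Hr _ _ n4 n2.
rewrite !(addrC x0) !(addrC y0) !subrK in Ps2 Ps1 Qt2 Qt1.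
set L := (x2 - x1) + (y2 - y1).
have bd2 (a b c c' d d' : R) : `|a| <= e / 4 * (c + c') -> `|b| <= e / 4 * (d + d') -> c + c' <= L -> d + d' <= L -> `|a - b| <= e / 2 * L.
  move=> ha hb hc hd; apply: le_trans (ler_normB _ _) _; clear - e0 ha hb hc hd.
  have := ler_wpM2l (ltW e0) hc; have := ler_wpM2l (ltW e0) hd; lra.
have PP := bd2 _ _ _ _ _ _ Ps2 Ps1 (lerD n1' n5') (lerD n1' n6').
have QQ := bd2 _ _ _ _ _ _ Qt2 Qt1 (lerD n3' n2') (lerD n4' n2').
have EP : P s y2 - P x0 y0 - (p1 * (s - x0) + p2 * (y2 - y0)) - (P s y1 - P x0 y0 - (p1 * (s - x0) + p2 * (y1 - y0))) = P s y2 - P s y1 - p2 * (y2 - y1) by ring.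
have EQ : Q x2 t - Q x0 y0 - (p2 * (x2 - x0) + q2 * (t - y0)) - (Q x1 t - Q x0 y0 - (p2 * (x1 - x0) + q2 * (t - y0))) = Q x2 t - Q x1 t - p2 * (x2 - x1) by ring.
rewrite EP in PP; rewrite EQ in QQ.
have dx : 0 <= x2 - x1 by rewrite subr_ge0 (le_trans a2).
have dy : 0 <= y2 - y1 by rewrite subr_ge0 (le_trans b2).
apply: le_trans (ler_normB _ _) _; rewrite !normrM (ger0_norm dx) (ger0_norm dy).
apply: le_trans (lerD (ler_wpM2r dy QQ) (ler_wpM2r dx PP)) _.
have -> : e * (x2 - x1 + (y2 - y1)) ^+ 2 = e * L * L by rewrite /L; ring.
have L0 : 0 <= L by rewrite addr_ge0.
have : e * L * (y2 - y1) + e * L * (x2 - x1) = e * L * L by rewrite /L; ring.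
have : 0 <= e * L * L by rewrite !mulr_ge0 // ltW.
clear; lra.
Qed.

Lemma goursat (A B P Q : R -> R -> R) x1 x2 y1 y2 : x1 <= x2 -> y1 <= y2 ->
  (forall s t : R, x1 <= s <= x2 -> y1 <= t <= y2 -> is_derive s 1 (A ^~ t) (P s t)) ->
  (forall s t : R, x1 <= s <= x2 -> y1 <= t <= y2 -> is_derive t 1 (B s) (Q s t)) ->
  (forall s t : R, x1 <= s <= x2 -> y1 <= t <= y2 -> exists p1 p2 q2 : R, forall e : R, 0 < e ->
     exists r : R, 0 < r /\ forall h k : R, `|h| < r -> `|k| < r ->
       `|P (s + h) (t + k) - P s t - (p1 * h + p2 * k)| <= e * (`|h| + `|k|) /\
       `|Q (s + h) (t + k) - Q s t - (p2 * h + q2 * k)| <= e * (`|h| + `|k|)) ->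
  dd B x1 x2 y1 y2 = dd A x1 x2 y1 y2.
Proof.
rewrite -subr_ge0 => hx; rewrite -subr_ge0 => hy.
have -> : x2 = x1 + (x2 - x1) by rewrite subrKC.
have -> : y2 = y1 + (y2 - y1) by rewrite subrKC.
exact: goursat_dd.
Qed.

(** The fundamental theorem is applied at an interior point, which is why the primitives below start
    strictly to the left of the segment where they are differentiated. *)
Lemma is_derive_primitive (f : R -> R) (a x u : R) : a < x -> x < u ->
  (forall t, a <= t <= u -> derivable f t 1) ->
  is_derive x 1 (fun y => \int[lebesgue_measure]_(t in `[a, y]) f t) (f x).
Proof.
move=> ax xu df.
have cf : {within `[a, u], continuous f}.
  by apply: derivable_within_continuous => t; rewrite in_itv /=; exact: df.
have fint := continuous_compact_integrable (@segment_compact _ a u) cf.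
have cx : {for x, continuous f}.
  by apply: differentiable_continuous; apply/derivable1_diffP; apply: df; rewrite !ltW.
have [d1 d2] := continuous_FTC1 xu fint ax cx.
rewrite derive1E in d2; exact: DeriveDef d1 d2.
Qed.

(* The left end [s -> -oo] plays the role of the centre of the disc with coordinate [exp (s + i t)]. *)
Lemma periodic_mean (P Q : R -> R -> R) (eta T l : R) : 0 < eta -> 0 < T ->
  (forall s t : R, s < eta -> exists p1 p2 q2 : R, forall e : R, 0 < e ->
     exists r : R, 0 < r /\ forall h k : R, `|h| < r -> `|k| < r ->
       `|P (s + h) (t + k) - P s t - (p1 * h + p2 * k)| <= e * (`|h| + `|k|) /\
       `|Q (s + h) (t + k) - Q s t - (p2 * h + q2 * k)| <= e * (`|h| + `|k|)) ->
  (forall s, P s T = P s 0) ->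
  (forall e, 0 < e -> exists X, forall s t, s < X -> `|Q s t - l| <= e) ->
  lebesgue_measure.-integrable `[0, T] (EFin \o Q 0) /\
  \int[lebesgue_measure]_(t in `[0, T]) Q 0 t = T * l.
Proof.
move=> eta0 T0 Hlin Pper Qlim.
have dP (s t : R) : s < eta -> derivable (P ^~ t) s 1.
  move=> se; have [p1 [p2 [q2 H]]] := Hlin s t se.
  suff : is_derive s 1 (P ^~ t) p1 by move=> ?; exact: ex_derive.
  apply/is_derive_epsP => e e0; have [r [r0 Hr]] := H e e0; exists r; split=> // h hr.
  have := (Hr h 0 hr); rewrite normr0 => /(_ r0)[+ _].
  by rewrite !addr0 mulr0 addr0.
have dQ (s t : R) : s < eta -> derivable (Q s) t 1.
  move=> se; have [p1 [p2 [q2 H]]] := Hlin s t se.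
  suff : is_derive t 1 (Q s) q2 by move=> ?; exact: ex_derive.
  apply/is_derive_epsP => e e0; have [r [r0 Hr]] := H e e0; exists r; split=> // h hr.
  have := (Hr 0 h); rewrite normr0 => /(_ r0 hr)[_ +].
  by rewrite !addr0 mulr0 !add0r.
pose B s y := \int[lebesgue_measure]_(t in `[(-1 : R), y]) Q s t.
have dB (s t : R) : s < eta -> 0 <= t -> is_derive t 1 (B s) (Q s t).
  move=> se t0; apply: (@is_derive_primitive (Q s) (-1) t (t + 1)).
  - by apply: lt_le_trans t0; rewrite ltrN10.
  - by rewrite ltrDl.
  - by move=> *; exact: dQ.
(* The sides t = 0 and t = T of the rectangle cancel by periodicity of [P], so the integral of [Q]
   over a circle does not depend on the radius. *)
have cst s : s < 0 -> B 0 T - B 0 0 = B s T - B s 0.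
  move=> s0; pose A x y := \int[lebesgue_measure]_(t in `[s - 1, x]) P t y.
  have hA (x y : R) : s <= x <= 0 -> 0 <= y <= T -> is_derive x 1 (A ^~ y) (P x y).
    move=> /andP[x1 x2] _.
    have ax : s - 1 < x by rewrite ltrBlDr (le_lt_trans x1)// ltrDl.
    have xe : x < eta / 2 by rewrite (le_lt_trans x2)// divr_gt0.
    apply: (is_derive_primitive ax xe).
    by move=> t /andP[_ t2]; apply: dP; rewrite (le_lt_trans t2)// ltr_pdivrMr// ltr_pMr// ltr1n.
  have hB (x y : R) : s <= x <= 0 -> 0 <= y <= T -> is_derive y 1 (B x) (Q x y).
    by move=> /andP[_ x2] /andP[y1 _]; apply: (dB) y1; exact: le_lt_trans eta0.
  have hL (x y : R) (hx : s <= x <= 0) (hy : 0 <= y <= T) := Hlin x y (le_lt_trans (proj2 (andP hx)) eta0).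
  have := goursat (ltW s0) (ltW T0) hA hB hL.
  have EA x : A x T = A x 0 by rewrite /A; apply: eq_Rintegral => t _; exact: Pper.
  rewrite /dd !EA => E.
  have Z : A 0 0 - A s 0 - A 0 0 + A s 0 = 0 by clear; ring.
  by rewrite Z in E; clear - E; lra.
split.
  apply: continuous_compact_integrable; first exact: segment_compact.
  by apply: derivable_within_continuous => t _; exact: dQ.
have -> : \int[lebesgue_measure]_(t in `[0, T]) Q 0 t = B 0 T - B 0 0.
  have cQ : {within `[(-1 : R), T], continuous (Q 0)}.
    by apply: derivable_within_continuous => t _; exact: dQ.
  have iQ := continuous_compact_integrable (@segment_compact _ (-1) T) cQ.
  rewrite /B Rintegral_itvB //=; last 2 first.
  - by rewrite bnd_simp lerN10.
  - by rewrite bnd_simp ltW.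
  rewrite Rintegral_itv_obnd_cbnd//; apply: integrableS iQ => //.
  by apply: subset_itvScc; rewrite ?bnd_simp// lerN10.
apply/eqP; rewrite -subr_eq0 -normr_eq0 eq_le normr_ge0 andbT; apply/ler_addgt0Pr => e e0; rewrite add0r.
have [X HX] := Qlim _ (divr_gt0 e0 T0).
pose s := Num.min X 0 - 1.
have sm : s < Num.min X 0 by rewrite ltrBlDr ltrDl.
move: sm; rewrite lt_min => /andP[sX s0].
rewrite (cst s s0).
(* On a circle this small the mean is a value of [Q], which is within e / T of [l]. *)
have [c c0T ->] : exists2 c, 0 <= c <= T & B s T - B s 0 = Q s c * (T - 0).
  apply: MVT_cc (ltW T0) _ => c /andP[c0 _]; apply: dB => //; exact: lt_trans eta0.
rewrite subr0 (mulrC T) -mulrBl normrM (gtr0_norm T0) -ler_pdivlMr//; exact: HX.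
Qed.

(** The forms Im F ds + Re F dt and - Re F ds + Im F dt are, up to sign, the imaginary and the real
    part of F (ds + i dt). The Cauchy-Riemann equations make them closed, and each yields one
    component of the mean. *)
Lemma circle_mean (F : R[i] -> R[i]) (eta : R) (l : R[i]) : 0 < eta ->
  (forall s, complex.Re s < eta -> exists d, cdiff F s d) ->
  (forall s, F (s + Complex 0 (2 * pi)) = F s) ->
  (forall e, 0 < e -> exists X, forall s, complex.Re s < X -> cabs (F s - l) <= e) ->
  (lebesgue_measure.-integrable `[0, 2 * pi] (EFin \o (fun t => complex.Re (F (Complex 0 t)))) /\
   \int[lebesgue_measure]_(t in `[0, 2 * pi]) complex.Re (F (Complex 0 t)) = 2 * pi * complex.Re l) /\
  (lebesgue_measure.-integrable `[0, 2 * pi] (EFin \o (fun t => complex.Im (F (Complex 0 t)))) /\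
   \int[lebesgue_measure]_(t in `[0, 2 * pi]) complex.Im (F (Complex 0 t)) = 2 * pi * complex.Im l).
Proof.
move=> eta0 HF Fper Flim.
have pi0 : 0 < 2 * pi :> R by rewrite mulr_gt0// pi_gt0.
have per s : F (Complex s (2 * pi)) = F (Complex s 0).
  by rewrite -[RHS]Fper; congr F; apply: complex_eqP; rewrite ?ReD ?ImD /= ?addr0 ?add0r.
have lin (s t : R) : s < eta -> exists d : R[i], forall e : R, 0 < e ->
     exists r : R, 0 < r /\ forall h k : R, `|h| < r -> `|k| < r ->
       cabs (F (Complex (s + h) (t + k)) - F (Complex s t) - d * Complex h k) <= e * (`|h| + `|k|).
  move=> se; have [d Hd] := HF (Complex s t) se; exists d => e e0.
  have [r [r0 Hr]] := Hd e e0; exists (r / 2); split; first by rewrite divr_gt0.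
  move=> h k hr kr; have hk := cabs_le_ReIm (Complex h k); rewrite /= in hk.
  have := Hr (Complex h k); rewrite (_ : Complex s t + Complex h k = Complex (s + h) (t + k))//.
  have lt : cabs (Complex h k) < r by apply: le_lt_trans hk _; clear - hr kr; lra.
  by move=> /(_ lt) le; apply: le_trans le _; rewrite ler_pM2l.
split.
- apply: (@periodic_mean (fun s t => complex.Im (F (Complex s t))) (fun s t => complex.Re (F (Complex s t))) eta) => //.
  + move=> s t /(lin s t)[d Hd]; exists (complex.Im d), (complex.Re d), (- complex.Im d) => e /Hd[r [r0 Hr]].
    exists r; split=> // h k hr kr; have {}Hr := Hr h k hr kr.
    have := le_trans (ler_normr_cabs_Im _) Hr; have := le_trans (ler_normr_cabs_Re _) Hr.
    rewrite !ReB !ImB ReM ImM /= => H1 H2; split.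
    * by rewrite addrC (addrC (_ * h)) addrC.
    * by rewrite mulNr.
  + by move=> s; rewrite per.
  + move=> e /Flim[X HX]; exists X => s t sX; rewrite -ReB; apply: le_trans (ler_normr_cabs_Re _) _; exact: HX.
- apply: (@periodic_mean (fun s t => - complex.Re (F (Complex s t))) (fun s t => complex.Im (F (Complex s t))) eta) => //.
  + move=> s t /(lin s t)[d Hd]; exists (- complex.Re d), (complex.Im d), (complex.Re d) => e /Hd[r [r0 Hr]].
    exists r; split=> // h k hr kr; have {}Hr := Hr h k hr kr.
    have := le_trans (ler_normr_cabs_Im _) Hr; have := le_trans (ler_normr_cabs_Re _) Hr.
    rewrite !ReB !ImB ReM ImM /= => H1 H2; split.
    * by apply: le_trans H1; rewrite -normrN le_eqVlt; apply/orP; left; apply/eqP; congr (`|_|); ring.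
    * by rewrite (addrC (_ * h)).
  + by move=> s; rewrite per.
  + move=> e /Flim[X HX]; exists X => s t sX; rewrite -ImB; apply: le_trans (ler_normr_cabs_Im _) _; exact: HX.
Qed.

End Goursat.

(** * Invariance of Lebesgue measure *)

Section MeasurePreserving.
Context d (T : measurableType d) (R : realType) (mu : {measure set T -> \bar R}).

Definition mpres (phi : T -> T) := measurable_fun setT phi /\
  forall A, measurable A -> mu (phi @^-1` A) = mu A.

Lemma mpres_comp phi psi : mpres phi -> mpres psi -> mpres (phi \o psi).
Proof.
move=> [m1 h1] [m2 h2]; split; first exact: measurableT_comp.
move=> A mA; rewrite comp_preimage h2 ?h1//.
by rewrite -[X in measurable X]setTI; exact: m1.
Qed.

Lemma mpres_integral phi (f : T -> \bar R) : mpres phi ->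
  measurable_fun [set: T] f -> (forall x, (0 <= f x)%E) ->
  (\int[mu]_x f (phi x) = \int[mu]_x f x)%E.
Proof.
move=> [mphi hphi] mf f0.
have := @ge0_integral_pushforward _ _ _ _ R phi mphi mu setT f measurableT mf (fun x _ => f0 x).
rewrite preimage_setT => <-.
apply: eq_measure_integral => A mA _; exact: hphi.
Qed.

Lemma mpres_integrable phi (f : T -> \bar R) : mpres phi ->
  mu.-integrable setT f -> mu.-integrable setT (f \o phi).
Proof.
move=> hphi /integrableP[mf fi]; apply/integrableP; split.
  by apply: measurableT_comp => //; case: hphi.
rewrite (@mpres_integral phi (fun x => `|f x|%E))//.
exact: measurableT_comp.
Qed.

Lemma mpres_Rintegral phi (f : T -> R) : mpres phi ->
  mu.-integrable setT (EFin \o f) ->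
  \int[mu]_x f (phi x) = \int[mu]_x f x.
Proof.
move=> hphi fi; rewrite /Rintegral; congr fine.
have fi2 := mpres_integrable hphi fi; have [mphi _] := hphi.
have := @integral_pushforward _ _ _ _ R phi mphi mu setT (EFin \o f) (measurable_int _ fi).
rewrite preimage_setT => /(_ fi2 measurableT) <-.
apply: eq_measure_integral => A mA _; by rewrite -[RHS](proj2 hphi).
Qed.

End MeasurePreserving.

(** * Products of sigma-finite measures and maps acting fibre by fibre *)

Section SigmaFiniteProduct.
Context d1 d2 (T1 : measurableType d1) (T2 : measurableType d2) (R : realType).
Variables (m1 : {sigma_finite_measure set T1 -> \bar R}) (m2 : {sigma_finite_measure set T2 -> \bar R}).
Lemma product_sigma_finite : sigma_finite setT (m1 \x m2)%E.
Proof.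
have /sigma_finiteP[F [TF ndF Foo]] := sigma_finiteT m1.
have /sigma_finiteP[G [TG ndG Goo]] := sigma_finiteT m2.
exists (fun n => F n `*` G n).
  apply/seteqP; split=> // -[x y] _.
  have : (\bigcup_i F i) x by rewrite -TF.
  have : (\bigcup_i G i) y by rewrite -TG.
  move=> [j _ Gy] [i _ Fx]; exists (maxn i j) => //; split => /=.
    by move: x Fx; exact/subsetPset/ndF/leq_maxl.
  by move: y Gy; exact/subsetPset/ndG/leq_maxr.
move=> k; have [mF Fk] := Foo k; have [mG Gk] := Goo k.
split; first exact: measurableX.
have -> : (m1 \x m2)%E (F k `*` G k) = (m1 (F k) * m2 (G k))%E by exact: product_measure1E.
by rewrite lte_mul_pinfty// ge0_fin_numE.
Qed.

Let M12 : {measure set (T1 * T2) -> \bar R} := (m1 \x m2)%E.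
(** Carrying sigma-finiteness along with the product lets it be iterated; [sfprod4E] identifies the
    fourfold product of Lebesgue measures with [dV]. *)
Definition sfprod : sigma_finite_measure (T1 * T2)%type R :=
  HB.pack_for (sigma_finite_measure (T1 * T2)%type R) (M12 : set (T1 * T2) -> \bar R) M12 (@Measure_isSigmaFinite.Build _ _ _ M12 product_sigma_finite).

End SigmaFiniteProduct.

Section SkewProduct.
Context d1 d2 (T1 : measurableType d1) (T2 : measurableType d2) (R : realType).
Variables (m1 : {sigma_finite_measure set T1 -> \bar R})
  (m2 : {sigma_finite_measure set T2 -> \bar R}).

(** Over each x the section of the preimage is the preimage of the section, so the measures already
    agree under the outer integral. *)
Lemma mpres_skewr (psi : T1 * T2 -> T2) : measurable_fun setT psi ->
  (forall x, mpres m2 (fun y => psi (x, y))) ->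
  mpres (m1 \x m2)%E (fun p => (p.1, psi p)).
Proof.
move=> mpsi H; split; first exact: measurable_fun_pair.
move=> A mA /=; rewrite /product_measure1; apply: eq_integral => x _ /=.
have [_ /(_ _ (measurable_xsection x mA)) <-] := H x.
by congr (m2 _); apply/seteqP; split => y; rewrite /xsection /= !inE.
Qed.

Lemma mpres_skewl (psi : T1 * T2 -> T1) : measurable_fun setT psi ->
  (forall y, mpres m1 (fun x => psi (x, y))) ->
  mpres (m1 \x m2)%E (fun p => (psi p, p.2)).
Proof.
move=> mpsi H.
have mphi : measurable_fun setT (fun p : T1 * T2 => (psi p, p.2)) by exact: measurable_fun_pair.
split=> // A mA.
(* The fibres now lie over the second coordinate, which calls for the other order of integration;
   both orders define the same measure by uniqueness. *)
have E B : measurable B -> (m1 \x m2)%E B = (m1 \x^ m2)%E B.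
  by apply: product_measure_unique => ? ? ? ?; exact: product_measure2E.
have mA' : measurable ((fun p : T1 * T2 => (psi p, p.2)) @^-1` A).
  by rewrite -[X in measurable X]setTI; exact: mphi.
apply: (etrans (E _ mA')); apply: etrans (esym (E _ mA)).
rewrite /= /product_measure2; apply: eq_integral => y _ /=.
have [_ /(_ _ (measurable_ysection y mA)) <-] := H y.
by congr (m1 _); apply/seteqP; split => x; rewrite /ysection /= !inE.
Qed.

End SkewProduct.

(** * Translations, shears and rotations *)

Section LebesgueInvariance.
Variable R : realType.
Local Notation L := (@lebesgue_measure R).

Lemma mpres_translation (c : R) : mpres L (fun x : measurableTypeR R => x + c).
Proof.
have mc : measurable_fun setT (fun x : measurableTypeR R => x + c : measurableTypeR R).
  exact: measurable_funD.
split=> // A mA.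
pose m' : {measure set (measurableTypeR R) -> \bar R} :=
  measure_function_pushforward__canonical__measure_function_Measure L mc.
apply/esym; apply: (@lebesgue_measure_unique _ m') => //= _ [[a b]] _ <-.
transitivity (L `](a - c), (b - c)]%classic); last first.
  congr (L _); apply/seteqP; split => x; rewrite /= !in_itv /=.
    by rewrite ltrBlDr lerBrDr.
  by rewrite ltrBlDr lerBrDr.
rewrite !lebesgue_measure_itv /= !lte_fin ltrD2r.
by case: ifP => // _; rewrite -!EFinB opprB addrA subrK.
Qed.

Local Notation T1 := (measurableTypeR R).

(* Lebesgue measure is visibly invariant under shears, hence under rotations. *)
Lemma rotation_shears (c s : R) : s != 0 -> c ^+ 2 + s ^+ 2 = 1 ->
  exists a, forall x y,
    x + a * y + a * (y + s * (x + a * y)) = c * x - s * y /\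
    y + s * (x + a * y) = s * x + c * y.
Proof.
(* The factorization of a rotation into three shears, [a] being minus the tangent of half the
   angle. *)
move=> s0 cs; exists ((c - 1) / s) => x y; set a := _ / s.
have as1 : s * a = c - 1 by rewrite /a mulrC mulrVK// unitfE.
have sa : s * a ^+ 2 = - s - 2 * a.
  apply: (mulfI s0); rewrite mulrA -expr2 -exprMn as1 mulrBr (mulrCA s) as1.
  by rewrite mulrN -expr2; clear - cs; lra.
have -> : c = s * a + 1 by rewrite as1; ring.
split; last by ring.
have -> : (s * a + 1) * x - s * y = (s * a + 1) * x + (s * a ^+ 2 + 2 * a) * y by rewrite sa; ring.
by ring.
Qed.

Lemma mpres_shear21 (a : R) : mpres (sfprod L L) (fun p : T1 * T1 => (p.1 + a * p.2 : T1, p.2)).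
Proof.
apply: (@mpres_skewl _ _ _ _ _ L L (fun p : T1 * T1 => p.1 + a * p.2 : T1)).
  by apply: measurable_funD => //; apply: measurable_funM.
by move=> y; exact: (mpres_translation (a * y)).
Qed.

Lemma mpres_shear22 (a : R) : mpres (sfprod L L) (fun p : T1 * T1 => (p.1, p.2 + a * p.1 : T1)).
Proof.
apply: (@mpres_skewr _ _ _ _ _ L L (fun p : T1 * T1 => p.2 + a * p.1 : T1)).
  by apply: measurable_funD => //; apply: measurable_funM.
by move=> y; exact: (mpres_translation (a * y)).
Qed.

Lemma mpres_id d (T : measurableType d) (m : {measure set T -> \bar R}) : mpres m id.
Proof. by split. Qed.

Lemma mpres_rotation2 (c s : R) : c ^+ 2 + s ^+ 2 = 1 ->
  mpres (sfprod L L) (fun p : T1 * T1 => (c * p.1 - s * p.2 : T1, s * p.1 + c * p.2 : T1)).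
Proof.
have R0 (c' s' : R) : s' != 0 -> c' ^+ 2 + s' ^+ 2 = 1 ->
    mpres (sfprod L L) (fun p : T1 * T1 => (c' * p.1 - s' * p.2 : T1, s' * p.1 + c' * p.2 : T1)).
  move=> s0 cs; have [a Ha] := rotation_shears s0 cs.
  have := mpres_comp (mpres_shear21 a) (mpres_comp (mpres_shear22 s') (mpres_shear21 a)).
  by congr mpres; apply/funext => -[x y] /=; have [<- <-] := Ha x y.
have [s0|s0] := eqVneq s 0; last exact: R0.
rewrite s0 expr0n addr0 => /eqP; rewrite sqrf_eq1 => /orP[] /eqP ->.
  have := mpres_id (sfprod L L).
  by congr mpres; apply/funext => -[x y] /=; rewrite !mul0r !mul1r subr0 add0r.
(* The half turn has s = 0, where the shear parameter is undefined; it is the square of a quarter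
   turn. *)
have h01 : (0 : R) ^+ 2 + 1 ^+ 2 = 1 by ring.
have := mpres_comp (@R0 0 1 (oner_neq0 _) h01) (@R0 0 1 (oner_neq0 _) h01).
by congr mpres; apply/funext => -[x y] /=; congr (_, _); ring.
Qed.

Lemma mpres_translation2 (a b : R) :
  mpres (sfprod L L) (fun p : T1 * T1 => (p.1 + a : T1, p.2 + b : T1)).
Proof.
have A : mpres (sfprod L L) (fun p : T1 * T1 => (p.1 + a : T1, p.2)).
  apply: (@mpres_skewl _ _ _ _ _ L L (fun p : T1 * T1 => p.1 + a : T1)).
    by apply: measurable_funD.
  by move=> y; exact: (mpres_translation a).
have B : mpres (sfprod L L) (fun p : T1 * T1 => (p.1, p.2 + b : T1)).
  apply: (@mpres_skewr _ _ _ _ _ L L (fun p : T1 * T1 => p.2 + b : T1)).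
    by apply: measurable_funD.
  by move=> y; exact: (mpres_translation b).
exact: (mpres_comp A B).
Qed.

Section PlaneShears.
Context d (T : measurableType d) (m : {sigma_finite_measure set T -> \bar R}).
Local Notation M := (sfprod (sfprod m L) L).

Lemma mpres_shear1 (a b : R) :
  mpres M (fun p : T * T1 * T1 => ((p.1.1, p.1.2 + (a * p.2 + b) : T1), p.2)).
Proof.
apply: (@mpres_skewl _ _ _ _ _ (sfprod m L) L (fun p : T * T1 * T1 => (p.1.1, p.1.2 + (a * p.2 + b) : T1))).
  apply: measurable_fun_pair => /=; first by apply: measurableT_comp.
  apply: measurable_funD; first by apply: measurableT_comp.
  by apply: measurable_funD => //; apply: measurable_funM.
move=> y; apply: (@mpres_skewr _ _ _ _ _ m L (fun p : T * T1 => p.2 + (a * y + b) : T1)).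
  by apply: measurable_funD.
by move=> x; exact: mpres_translation.
Qed.

Lemma mpres_shear2 (a b : R) :
  mpres M (fun p : T * T1 * T1 => (p.1, p.2 + (a * p.1.2 + b) : T1)).
Proof.
apply: (@mpres_skewr _ _ _ _ _ (sfprod m L) L (fun p : T * T1 * T1 => p.2 + (a * p.1.2 + b) : T1)).
  apply: measurable_funD => //; apply: measurable_funD => //.
  by apply: measurable_funM => //; exact: measurableT_comp.
by move=> x; exact: (mpres_translation (a * x.2 + b)).
Qed.

(** Coordinates are nested to the left, so the plane of z2 is not a factor of the product; its
    shears act over the base [T]. *)
Lemma mpres_rotation (c s : R) : c ^+ 2 + s ^+ 2 = 1 ->
  mpres M (fun p : T * T1 * T1 =>
    ((p.1.1, c * p.1.2 - s * p.2 : T1), s * p.1.2 + c * p.2 : T1)).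
Proof.
have R0 (c' s' : R) : s' != 0 -> c' ^+ 2 + s' ^+ 2 = 1 -> mpres M (fun p : T * T1 * T1 =>
    ((p.1.1, c' * p.1.2 - s' * p.2 : T1), s' * p.1.2 + c' * p.2 : T1)).
  move=> s0 cs; have [a Ha] := rotation_shears s0 cs.
  have := mpres_comp (mpres_shear1 a 0) (mpres_comp (mpres_shear2 s' 0) (mpres_shear1 a 0)).
  by congr mpres; apply/funext => -[[t x] y] /=; have [<- <-] := Ha x y; rewrite !addr0.
have [s0|s0] := eqVneq s 0; last exact: R0.
rewrite s0 expr0n addr0 => /eqP; rewrite sqrf_eq1 => /orP[] /eqP ->.
  have := mpres_id M.
  by congr mpres; apply/funext => -[[t x] y] /=; rewrite !mul0r !mul1r subr0 add0r.
have h01 : (0 : R) ^+ 2 + 1 ^+ 2 = 1 by ring.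
have := mpres_comp (@R0 0 1 (oner_neq0 _) h01) (@R0 0 1 (oner_neq0 _) h01).
by congr mpres; apply/funext => -[[t x] y] /=; congr (_, _, _); ring.
Qed.

Lemma mpres_translation22 (a b : R) :
  mpres M (fun p : T * T1 * T1 => ((p.1.1, p.1.2 + a : T1), p.2 + b : T1)).
Proof.
have := mpres_comp (mpres_shear1 0 a) (mpres_shear2 0 b).
by congr mpres; apply/funext => -[[t x] y] /=; rewrite !mul0r !add0r.
Qed.

End PlaneShears.

Lemma mpres_first (phi : T1 * T1 -> T1 * T1) : mpres (sfprod L L) phi ->
  mpres (sfprod (sfprod (sfprod L L) L) L)
    (fun p : T1 * T1 * T1 * T1 => ((phi p.1.1, p.1.2), p.2)).
Proof.
move=> h.
have h3 : mpres (sfprod (sfprod L L) L) (fun p : T1 * T1 * T1 => (phi p.1, p.2)).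
  apply: (@mpres_skewl _ _ _ _ _ (sfprod L L) L (fun p : T1 * T1 * T1 => phi p.1)).
    by apply: measurableT_comp => //; case: h.
  by move=> y; exact: h.
apply: (@mpres_skewl _ _ _ _ _ (sfprod (sfprod L L) L) L (fun p : T1 * T1 * T1 * T1 => (phi p.1.1, p.1.2))).
  by apply: (@measurableT_comp _ _ _ _ _ _ (fun p : T1 * T1 * T1 => (phi p.1, p.2)) _ fst) => //; case: h3.
by move=> y; exact: h3.
Qed.

Lemma sfprod3E A : sfprod (sfprod L L) L A = ((L \x L) \x L)%E A.
Proof.
rewrite [RHS]/product_measure1 -[LHS]/(integral (sfprod L L) setT (L \o xsection A)).
exact: eq_measure_integral.
Qed.

Lemma sfprod4E A : sfprod (sfprod (sfprod L L) L) L A = dV A.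
Proof.
rewrite -[RHS]/(integral (((L \x L) \x L)%E : measure _ _) setT (L \o xsection A)).
rewrite -[LHS]/(integral (sfprod (sfprod L L) L) setT (L \o xsection A)).
by apply: eq_measure_integral => B _ _; exact: sfprod3E.
Qed.

Lemma mpres_dV phi : mpres (sfprod (sfprod (sfprod L L) L) L) phi -> mpres (@dV R) phi.
Proof.
move=> [h1 h2]; split; first exact: h1.
by move=> A mA; apply: etrans (esym (sfprod4E _)) (etrans (h2 A mA) (sfprod4E _)).
Qed.

Definition torus_rot (u v : R[i]) (p : pt R) : pt R := pt_of (u * cz1 p) (v * cz2 p).
Definition ptD (w p : pt R) : pt R := pt_of (cz1 w + cz1 p) (cz2 w + cz2 p).

Lemma mpres_torus_rot u v : cabs u = 1 -> cabs v = 1 -> mpres (@dV R) (torus_rot u v).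
Proof.
move=> u1 v1.
have N (z : R[i]) : cabs z = 1 -> complex.Re z ^+ 2 + complex.Im z ^+ 2 = 1.
  by move=> z1; rewrite -cabs_sqr z1 expr1n.
have h := mpres_comp (mpres_first (mpres_rotation2 (N _ u1))) (mpres_rotation (sfprod L L) (N _ v1)).
apply: mpres_dV; move: h; rewrite (_ : (_ \o _) = torus_rot u v); first exact.
by apply/funext => -[[[x1 y1] x2] y2]; rewrite /torus_rot /pt_of !ReM !ImM /= (addrC (complex.Im u * _)) (addrC (complex.Im v * _)).
Qed.

Lemma mpres_ptD w : mpres (@dV R) (ptD w).
Proof.
have h := mpres_comp (mpres_first (mpres_translation2 (complex.Re (cz1 w)) (complex.Im (cz1 w))))
  (mpres_translation22 (sfprod L L) (complex.Re (cz2 w)) (complex.Im (cz2 w))).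
apply: mpres_dV; move: h; rewrite (_ : (_ \o _) = ptD w); first exact.
apply/funext => -[[[x1 y1] x2] y2]; rewrite /ptD /pt_of !ReD !ImD /=.
by rewrite (addrC x1) (addrC x2) (addrC y1) (addrC y2).
Qed.

End LebesgueInvariance.

(** * Square integrable functions and the domain *)

Section L2space.
Context d (T : measurableType d) (R : realType) (mu : {measure set T -> \bar R}).
Variables (D : set T) (mD : measurable D).
Implicit Types (a b : T -> R) (f g h : T -> R[i]).
Local Notation Re := (@complex.Re R).
Local Notation Im := (@complex.Im R).

Definition rsq a := measurable_fun D a /\ mu.-integrable D (EFin \o (fun x => a x ^+ 2)).

Lemma rsq_mul a b : rsq a -> rsq b -> mu.-integrable D (EFin \o (fun x => a x * b x)).
Proof.
move=> [ma ia] [mb ib].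
apply: (le_integrable mD _ _ (integrableD mD ia ib)) => /=.
  by apply/measurable_EFinP; exact: measurable_funM.
move=> x _; rewrite lee_fin normrM [leRHS]ger0_norm ?addr_ge0 ?sqr_ge0//.
rewrite -(real_normK (num_real (a x))) -(real_normK (num_real (b x))).
have := sqr_ge0 (`|a x| - `|b x|); rewrite sqrrB.
have := sqr_ge0 `|a x|; have := sqr_ge0 `|b x|; lra.
Qed.

Lemma rsqD a b : rsq a -> rsq b -> rsq (fun x => a x + b x).
Proof.
move=> ha hb; split; first by apply: measurable_funD; [case: ha | case: hb].
have -> : (EFin \o (fun x => (a x + b x) ^+ 2)) = ((EFin \o (fun x => a x * a x)%R) \+
   (fun x => 2%:E * (EFin \o (fun x => a x * b x)%R) x) \+ (EFin \o (fun x => b x * b x)%R))%E.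
  by apply/funext => x /=; rewrite -EFinM -!EFinD; congr EFin; ring.
apply: integrableD => //; last exact: rsq_mul.
by apply: integrableD => //; [exact: rsq_mul | apply: integrableZl => //; exact: rsq_mul].
Qed.

Lemma rsqZ (k : R) a : rsq a -> rsq (fun x => k * a x).
Proof.
move=> [ma ia]; split; first exact: measurable_funM.
have -> : (EFin \o (fun x => (k * a x) ^+ 2)) = (fun x => (k ^+ 2)%:E * (EFin \o (fun x => a x ^+ 2)%R) x)%E.
  by apply/funext => x /=; rewrite -EFinM exprMn.
exact: integrableZl.
Qed.

Definition sqint f := rsq (Re \o f) /\ rsq (Im \o f).

Lemma sqintD f g : sqint f -> sqint g -> sqint (fun x => f x + g x).
Proof.
move=> [f1 f2] [g1 g2]; split.
- rewrite (_ : _ \o _ = fun x => (Re \o f) x + (Re \o g) x); first exact: rsqD.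
  by apply/funext => x; rewrite /= ReD.
- rewrite (_ : _ \o _ = fun x => (Im \o f) x + (Im \o g) x); first exact: rsqD.
  by apply/funext => x; rewrite /= ImD.
Qed.

Lemma sqintZ (c : R[i]) f : sqint f -> sqint (fun x => c * f x).
Proof.
move=> [f1 f2]; split.
- rewrite (_ : _ \o _ = fun x => Re c * (Re \o f) x + - Im c * (Im \o f) x).
    by apply: rsqD; exact: rsqZ.
  by apply/funext => x; rewrite /= ReM mulNr.
- rewrite (_ : _ \o _ = fun x => Re c * (Im \o f) x + Im c * (Re \o f) x).
    by apply: rsqD; exact: rsqZ.
  by apply/funext => x; rewrite /= ImM.
Qed.

Lemma sqintB f g : sqint f -> sqint g -> sqint (fun x => f x - g x).
Proof.
move=> hf hg; rewrite (_ : (fun _ => _) = fun x => f x + (-1) * g x).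
  by apply: sqintD => //; exact: sqintZ.
by apply/funext => x; rewrite mulN1r.
Qed.

(** The real part of the Hermitian product. Its imaginary part is the same expression with the
    second argument multiplied by ['i], as [cint_ip] shows. *)
Definition ip f g := \int[mu]_(x in D) (Re (f x) * Re (g x) + Im (f x) * Im (g x)).

Lemma ip_integrable f g : sqint f -> sqint g ->
  mu.-integrable D (EFin \o (fun x => Re (f x) * Re (g x) + Im (f x) * Im (g x))).
Proof.
move=> [f1 f2] [g1 g2].
exact: (integrableD mD (rsq_mul f1 g1) (rsq_mul f2 g2)).
Qed.

Lemma eq_ip f f' g g' : (forall x, D x -> f x = f' x) -> (forall x, D x -> g x = g' x) ->
  ip f g = ip f' g'.
Proof. by move=> ff gg; apply: eq_Rintegral => x /[!inE] Dx; rewrite ff// gg. Qed.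

Lemma ipC f g : ip f g = ip g f.
Proof. by apply: eq_Rintegral => x _; ring. Qed.

Lemma ipDl f g h : sqint f -> sqint g -> sqint h -> ip (fun x => f x + g x) h = ip f h + ip g h.
Proof.
move=> hf hg hh; rewrite /ip -RintegralD//; try exact: ip_integrable.
by apply: eq_Rintegral => x _; rewrite ReD ImD; ring.
Qed.

Lemma ipZl (k : R) f h : sqint f -> sqint h -> ip (fun x => (k%:C)%C * f x) h = k * ip f h.
Proof.
move=> hf hh; rewrite /ip -RintegralZl//; last exact: ip_integrable.
by apply: eq_Rintegral => x _; rewrite ReM ImM /=; ring.
Qed.

Lemma ipBl f g h : sqint f -> sqint g -> sqint h -> ip (fun x => f x - g x) h = ip f h - ip g h.
Proof.
move=> hf hg hh; rewrite /ip -RintegralB//; try exact: ip_integrable.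
by apply: eq_Rintegral => x _; rewrite ReB ImB; ring.
Qed.

Lemma ipMl (c : R[i]) f h : ip (fun x => c * f x) h = ip f (fun x => cconj c * h x).
Proof. by apply: eq_Rintegral => x _; rewrite !ReM !ImM /=; ring. Qed.

Lemma ip_ge0 f : 0 <= ip f f.
Proof. by apply: Rintegral_ge0 => x _; rewrite addr_ge0// -expr2 sqr_ge0. Qed.

Lemma ip_sub f g : sqint f -> sqint g ->
  ip (fun x => f x - g x) (fun x => f x - g x) = ip f f - 2 * ip f g + ip g g.
Proof.
move=> hf hg; have hfg := sqintB hf hg.
rewrite ipBl// !(ipC _ (fun x => f x - g x)) !ipBl// (ipC g f); ring.
Qed.

Lemma ip_add f g : sqint f -> sqint g ->
  ip (fun x => f x + g x) (fun x => f x + g x) = ip f f + 2 * ip f g + ip g g.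
Proof.
move=> hf hg; have hfg := sqintD hf hg.
rewrite ipDl// !(ipC _ (fun x => f x + g x)) !ipDl// (ipC g f); ring.
Qed.

Lemma ip_cauchy_schwarz f g : sqint f -> sqint g -> ip f g ^+ 2 <= ip f f * ip g g.
Proof.
move=> hf hg.
have key (t : R) : 0 <= ip f f - 2 * (t * ip f g) + t ^+ 2 * ip g g.
  have hg' := sqintZ (t%:C)%C hg.
  have := ip_ge0 (fun x => f x - (t%:C)%C * g x); rewrite ip_sub// (ipC f) !ipZl//.
  by rewrite (ipC g (fun x => _ * _)) ipZl// (ipC g f) mulrA expr2.
have g0 := ip_ge0 g.
move: g0; rewrite le_eqVlt => /orP[/eqP g0|g0].
  rewrite -g0 mulr0.
  have [->|n0] := eqVneq (ip f g) 0; first by rewrite expr0n.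
  (* When g has norm 0 the quadratic is affine in t, and this t would give it the value - ip f f -
     2. *)
  have := key ((ip f f + 1) / ip f g); rewrite -g0 mulr0 addr0 mulrVK ?unitfE//.
  by have := ip_ge0 f; lra.
have := key (ip f g / ip g g).
have -> : ip f f - 2 * (ip f g / ip g g * ip f g) + (ip f g / ip g g) ^+ 2 * ip g g =
   (ip f f * ip g g - ip f g ^+ 2) / ip g g by field; rewrite gt_eqF.
by rewrite pmulr_lge0 ?invr_gt0// subr_ge0.
Qed.

Definition nrm f := Num.sqrt (ip f f).

Lemma nrm_ge0 f : 0 <= nrm f. Proof. exact: sqrtr_ge0. Qed.

Lemma nrm_sqr f : nrm f ^+ 2 = ip f f. Proof. by rewrite sqr_sqrtr// ip_ge0. Qed.

Lemma normr_ip_le f g : sqint f -> sqint g -> `|ip f g| <= nrm f * nrm g.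
Proof.
move=> hf hg; rewrite -sqrtr_sqr /nrm -sqrtrM ?ip_ge0// ler_wsqrtr//.
exact: ip_cauchy_schwarz.
Qed.

Lemma nrm_triangle f g : sqint f -> sqint g -> nrm (fun x => f x + g x) <= nrm f + nrm g.
Proof.
move=> hf hg; rewrite -(@ler_pXn2r _ 2) ?nnegrE ?nrm_ge0 ?addr_ge0 ?nrm_ge0//.
rewrite nrm_sqr ip_add// sqrrD !nrm_sqr.
have := le_trans (ler_norm _) (normr_ip_le hf hg); lra.
Qed.

Lemma ip_sq f : ip f f = fine (\int[mu]_(x in D) (cabs (f x) ^+ 2)%:E).
Proof. by congr fine; apply: eq_integral => x _; rewrite cabs_sqr !expr2. Qed.

Lemma sqintP f : sqint f <-> (measurable_fun D (Re \o f) /\ measurable_fun D (Im \o f)) /\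
  (\int[mu]_(x in D) (cabs (f x) ^+ 2)%:E < +oo)%E.
Proof.
split=> [hf|[[m1 m2] fi]].
  have := hf => -[[m1 _] [m2 _]]; split=> //.
  have /integrableP[_] := ip_integrable hf hf; apply: le_lt_trans.
  apply: ge0_le_integral => //.
  - by move=> x _; rewrite lee_fin sqr_ge0.
  - apply/measurable_EFinP; under eq_fun do rewrite cabs_sqr.
    by apply: measurable_funD; apply: measurable_funX.
  - apply: measurableT_comp => //; apply/measurable_EFinP.
    by apply: measurable_funD; apply: measurable_funM.
  - by move=> x _; rewrite cabs_sqr /= lee_fin -!expr2 ler_norm.
have key a : measurable_fun D a -> (forall x, a x ^+ 2 <= cabs (f x) ^+ 2) -> rsq a.
  move=> ma ha; split=> //; apply/integrableP; split.
    by apply/measurable_EFinP; exact: measurable_funX.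
  apply: le_lt_trans fi; apply: ge0_le_integral => //.
  - by apply: measurableT_comp => //; apply/measurable_EFinP; exact: measurable_funX.
  - apply/measurable_EFinP; under eq_fun do rewrite cabs_sqr.
    by apply: measurable_funD; apply: measurable_funX.
  - by move=> x _ /=; rewrite lee_fin ger0_norm ?sqr_ge0.
by split; apply: key => // x; rewrite cabs_sqr ?lerDl ?lerDr sqr_ge0.
Qed.

Lemma ipDr f g h : sqint f -> sqint g -> sqint h ->
  ip h (fun x => f x + g x) = ip h f + ip h g.
Proof. by move=> *; rewrite ipC ipDl// !(ipC _ h). Qed.

Lemma ipZr (k : R) f h : sqint f -> sqint h ->
  ip h (fun x => (k%:C)%C * f x) = k * ip h f.
Proof. by move=> *; rewrite ipC ipZl// (ipC _ h). Qed.

End L2space.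

(** * Measurability, finite volume and openness of the domain *)

Section Domain.
Variable R : realType.
Implicit Types (p q w z : pt R).
Local Notation L := (@lebesgue_measure R).
Local Notation dV := (@dV R).

Lemma measurable_x1 : measurable_fun [set: pt R] (fun p => p.1.1.1).
Proof. by apply: measurableT_comp => //; apply: measurableT_comp. Qed.
Lemma measurable_y1 : measurable_fun [set: pt R] (fun p => p.1.1.2).
Proof. by apply: measurableT_comp => //; apply: measurableT_comp. Qed.
Lemma measurable_x2 : measurable_fun [set: pt R] (fun p => p.1.2).
Proof. by apply: measurableT_comp. Qed.
Lemma measurable_y2 : measurable_fun [set: pt R] (fun p => p.2).
Proof. exact: measurable_snd. Qed.

Lemma measurable_cabs d (T : measurableType d) (D : set T) (f : T -> R[i]) :
  measurable_fun D (fun x => complex.Re (f x)) -> measurable_fun D (fun x => complex.Im (f x)) ->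
  measurable_fun D (fun x => cabs (f x)).
Proof.
move=> m1 m2.
have -> : (fun x => cabs (f x)) = (@powR R ^~ 2^-1) \o (fun x => complex.Re (f x) ^+ 2 + complex.Im (f x) ^+ 2).
  by apply/funext => x; rewrite /= powR12_sqrt// addr_ge0// sqr_ge0.
apply: (measurableT_comp (measurable_powR _)).
by apply: measurable_funD; apply: measurable_funX.
Qed.

Lemma measurable_cabs_z1 : measurable_fun [set: pt R] (fun p => cabs (cz1 p)).
Proof. by apply: measurable_cabs; [exact: measurable_x1 | exact: measurable_y1]. Qed.

Lemma measurable_cabs_z2 : measurable_fun [set: pt R] (fun p => cabs (cz2 p)).
Proof. by apply: measurable_cabs; [exact: measurable_x2 | exact: measurable_y2]. Qed.

Lemma measurable_set_lt d (T : measurableType d) (f g : T -> R) :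
  measurable_fun [set: T] f -> measurable_fun [set: T] g -> measurable [set x | f x < g x].
Proof.
move=> mf mg.
have := @measurable_lte _ T R setT measurableT (EFin \o f) (EFin \o g).
rewrite setTI; apply; exact/measurable_EFinP.
Qed.

Lemma measurable_Hgamma (gamma : R) : measurable (Hgamma gamma).
Proof.
have -> : Hgamma gamma = [set p : pt R | cabs (cz1 p) `^ gamma < cabs (cz2 p)] `&` [set p | cabs (cz2 p) < 1].
  by apply/seteqP; split => p /=; [move/andP => [] | move=> [h1 h2]; apply/andP].
apply: measurableI.
  apply: measurable_set_lt; last exact: measurable_cabs_z2.
  exact: (measurableT_comp (measurable_powR gamma) measurable_cabs_z1).
by apply: measurable_set_lt => //; exact: measurable_cabs_z2.
Qed.

Lemma dV_box (A B C E : set R) : measurable A -> measurable B -> measurable C -> measurable E ->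
  dV (((A `*` B) `*` C) `*` E) = (L A * L B * L C * L E)%E.
Proof.
move=> mA mB mC mE; rewrite /Defs.dV.
rewrite [LHS](product_measure1E _ L); [|by apply: measurableX => //; apply: measurableX|by []].
congr (_ * _)%E.
rewrite [LHS](product_measure1E _ L); [|by apply: measurableX|by []].
by congr (_ * _)%E; rewrite [LHS](product_measure1E _ L).
Qed.

Section Gamma.
Variable gamma : R.
Hypothesis gamma0 : 0 < gamma.
Local Notation H := (Hgamma gamma).

Lemma Hgamma_cz1_lt1 p : H p -> cabs (cz1 p) < 1.
Proof.
move=> /andP[h1 h2]; rewrite ltNge; apply/negP => h.
have := @ge0_ler_powR _ gamma (ltW gamma0) 1 (cabs (cz1 p)).
rewrite !nnegrE cabs_ge0 ler01 => /(_ isT isT h); rewrite powR1 => h3.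
by have := le_lt_trans h3 (lt_trans h1 h2); rewrite ltxx.
Qed.

Lemma Hgamma_cz2_lt1 p : H p -> cabs (cz2 p) < 1.
Proof. by move=> /andP[]. Qed.

Lemma Hgamma_cz2_gt0 p : H p -> 0 < cabs (cz2 p).
Proof. by move=> /andP[h _]; apply: le_lt_trans h; exact: powR_ge0. Qed.

Lemma Hgamma_bounded : H `<=` (((`[-1, 1] `*` `[-1, 1]) `*` `[-1, 1]) `*` `[-1, 1] : set (pt R)).
Proof.
move=> p Hp.
have K (z : R[i]) : cabs z < 1 -> `|complex.Re z| <= 1 /\ `|complex.Im z| <= 1.
  by move=> z1; split; apply: le_trans (ltW z1); [exact: ler_normr_cabs_Re | exact: ler_normr_cabs_Im].
have [] := K _ (Hgamma_cz1_lt1 Hp); have [] := K _ (Hgamma_cz2_lt1 Hp).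
by rewrite /= !ler_norml !in_itv /=.
Qed.

Lemma dV_Hgamma : (dV H < +oo)%E.
Proof.
have mH := measurable_Hgamma gamma.
apply: (@le_lt_trans _ _ (dV (((`[-1, 1] `*` `[-1, 1]) `*` `[-1, 1]) `*` `[-1, 1]))).
  apply: le_measure; rewrite ?inE//; last exact: Hgamma_bounded.
  by apply: measurableX => //; apply: measurableX => //; apply: measurableX.
rewrite dV_box//= lebesgue_measure_itv /= lte_fin -subr_gt0.
by case: ifP => _; rewrite ?mul0e -?EFinD -?EFinM ltry.
Qed.

Lemma Hgamma_open z : H z -> exists r, 0 < r /\
  forall h1 h2, cabs h1 < r -> cabs h2 < r -> H (pt_of (cz1 z + h1) (cz2 z + h2)).
Proof.
move=> Hz; have /andP[h1 h2] := Hz.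
set a := cabs (cz1 z) in h1; set b := cabs (cz2 z) in h1 h2.
have a0 : 0 <= a := cabs_ge0 _.
pose m := (a `^ gamma + b) / 2.
have m1 : a `^ gamma < m by rewrite /m; clear - h1; lra.
have m2 : m < b by rewrite /m; clear - h1; lra.
have m0 : 0 < m := le_lt_trans (powR_ge0 _ _) m1.
have g0 : gamma != 0 by rewrite gt_eqF.
have am : a < m `^ gamma^-1.
  rewrite ltNge; apply/negP => h.
  have := @ge0_ler_powR _ gamma (ltW gamma0) (m `^ gamma^-1) a.
  rewrite !nnegrE powR_ge0 a0 => /(_ isT isT h); by rewrite -powRrM mulVf// powRr1 ?(ltW m0)// leNgt m1.
exists (Num.min (m `^ gamma^-1 - a) (Num.min (b - m) (1 - b))); split.
  by rewrite !lt_min !subr_gt0 am m2 h2.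
move=> k1 k2; rewrite !lt_min => /andP[l1 _] /andP[_ /andP[l2 l3]].
rewrite /Hgamma /= cz1_pt_of cz2_pt_of; apply/andP; split; last first.
  by apply: le_lt_trans (cabsD _ _) _; rewrite -/b; clear - l3; lra.
have A : cabs (cz1 z + k1) `^ gamma < m.
  have := @gt0_ltr_powR _ gamma gamma0 (cabs (cz1 z + k1)) (m `^ gamma^-1).
  have mg : (m `^ gamma^-1) `^ gamma = m by rewrite -powRrM mulVf ?gt_eqF// powRr1 ?(ltW m0).
  rewrite mg !nnegrE powR_ge0 cabs_ge0 => X; apply: (X isT isT).
  by apply: le_lt_trans (cabsD _ _) _; rewrite -/a; clear - l1; lra.
apply: lt_trans A _; have := cabs_subD (cz2 z) (- k2); rewrite opprK cabsN -/b.
by clear - l2; lra.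
Qed.

Lemma Hgamma_torus u v p : cabs u = 1 -> cabs v = 1 -> H (torus_rot u v p) <-> H p.
Proof.
by move=> u1 v1; rewrite /Hgamma /= /torus_rot cz1_pt_of cz2_pt_of !cabsM u1 v1 !mul1r.
Qed.

End Gamma.
End Domain.

(** * The Cauchy estimate *)

Section Mollifier.
Variable R : realType.
Implicit Types (p q w z : pt R).
Local Notation L := (@lebesgue_measure R).
Local Notation dV := (@dV R).

Definition nsq p : R := cabs (cz1 p) ^+ 2 + cabs (cz2 p) ^+ 2.

(* C^1 with Lipschitz derivative, and torus invariant. *)
Definition bump (r : R) p : R := Num.max 0 (r ^+ 2 - nsq p) ^+ 2.

Lemma nsq_ge0 p : 0 <= nsq p. Proof. by rewrite addr_ge0// sqr_ge0. Qed.

Lemma bump_ge0 r p : 0 <= bump r p. Proof. exact: sqr_ge0. Qed.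

Lemma bump_le r p : bump r p <= r ^+ 4.
Proof.
rewrite /bump (_ : r ^+ 4 = (r ^+ 2) ^+ 2); last by rewrite -exprM.
rewrite ler_pXn2r ?nnegrE ?le_max ?lexx ?sqr_ge0//.
by rewrite ge_max sqr_ge0 /= lerBlDr lerDl nsq_ge0.
Qed.

Lemma bump_neq0 r p : 0 <= r -> bump r p != 0 -> cabs (cz1 p) < r /\ cabs (cz2 p) < r.
Proof.
move=> r0 h; have {}h : 0 < r ^+ 2 - nsq p.
  by rewrite ltNge; apply: contra h => h; rewrite /bump max_l// expr0n.
have A := sqr_ge0 (cabs (cz1 p)); have B := sqr_ge0 (cabs (cz2 p)).
by split; rewrite -(@ltr_pXn2r _ 2) ?nnegrE ?cabs_ge0//; rewrite /nsq in h; clear - h A B; lra.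
Qed.

Lemma measurable_nsq : measurable_fun [set: pt R] nsq.
Proof.
by apply: measurable_funD; apply: measurable_funX; [exact: measurable_cabs_z1 | exact: measurable_cabs_z2].
Qed.

Lemma measurable_bump r : measurable_fun [set: pt R] (bump r).
Proof.
apply: measurable_funX; apply: measurable_maxr => //.
by apply: measurable_funB => //; exact: measurable_nsq.
Qed.

Lemma bump_torus r u v p : cabs u = 1 -> cabs v = 1 -> bump r (torus_rot u v p) = bump r p.
Proof.
by move=> u1 v1; rewrite /bump /nsq /torus_rot cz1_pt_of cz2_pt_of !cabsM u1 v1 !mul1r.
Qed.

Lemma holomorphic_cont (f : pt R -> R[i]) z : holomorphic_at f z ->
  forall e : R, 0 < e -> exists t : R, 0 < t /\ forall h1 h2, cabs h1 < t -> cabs h2 < t ->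
    cabs (f (pt_of (cz1 z + h1) (cz2 z + h2)) - f z) <= e.
Proof.
move=> [a [b H]] e e0; have [t [t0 Ht]] := H 1 ltr01.
set M := cabs a + cabs b + 2.
have M0 : 0 < M by rewrite ltr_wpDl// addr_ge0 ?cabs_ge0.
pose t' := Num.min (t / 2) (e / M).
exists t'; split; first by rewrite lt_min !divr_gt0.
move=> h1 h2 l1 l2.
have n1 := sqrt_sqrD_le (cabs_ge0 h1) (cabs_ge0 h2).
have [[k1 k1'] [k2 k2']] : (cabs h1 < t / 2 /\ cabs h1 <= e / M) /\ (cabs h2 < t / 2 /\ cabs h2 <= e / M).
  by move: l1 l2; rewrite !lt_min => /andP[-> /ltW ->] /andP[-> /ltW ->].
have lt : Num.sqrt (cabs h1 ^+ 2 + cabs h2 ^+ 2) < t by clear - n1 k1 k2; lra.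
have := Ht _ _ lt; rewrite mul1r; set d := f _ - f z; set q := Num.sqrt _ in n1 * => le.
have -> : d = (d - (a * h1 + b * h2)) + (a * h1 + b * h2) by rewrite subrK.
apply: le_trans (cabsD _ _) _; apply: le_trans (lerD (le_trans le n1) (cabsD _ _)) _.
rewrite !cabsM.
have A : cabs a * cabs h1 <= cabs a * (e / M) by rewrite ler_wpM2l ?cabs_ge0.
have B : cabs b * cabs h2 <= cabs b * (e / M) by rewrite ler_wpM2l ?cabs_ge0.
have -> : e = cabs a * (e / M) + cabs b * (e / M) + (e / M + e / M) by rewrite /M in M0 *; field; rewrite gt_eqF.
by clear - A B k1' k2'; lra.
Qed.

(** The mean value property on the complex line through z in direction w, with coordinate u = exp s.
    The disc of radius 2 leaves the room eta = ln 2 beyond the unit circle, and Re s tending to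
    minus infinity approaches z. *)
Lemma torus_circle_mean (D : set (pt R)) (h : pt R -> R[i]) (z w : pt R) :
  D z -> holomorphic_on D h ->
  (forall u, cabs u <= 2 -> D (pt_of (cz1 z + u * cz1 w) (cz2 z + u * cz2 w))) ->
  let F t := h (ptD z (torus_rot (cexp (Complex 0 t)) (cexp (Complex 0 t)) w)) in
  (L.-integrable `[0, 2 * pi] (EFin \o (fun t => complex.Re (F t))) /\
   \int[L]_(t in `[0, 2 * pi]) complex.Re (F t) = 2 * pi * complex.Re (h z)) /\
  (L.-integrable `[0, 2 * pi] (EFin \o (fun t => complex.Im (F t))) /\
   \int[L]_(t in `[0, 2 * pi]) complex.Im (F t) = 2 * pi * complex.Im (h z)).
Proof.
move=> Dz hol Dw.
have FE t : h (ptD z (torus_rot (cexp (Complex 0 t)) (cexp (Complex 0 t)) w)) =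
    h (pt_of (cz1 z + cexp (Complex 0 t) * cz1 w) (cz2 z + cexp (Complex 0 t) * cz2 w)).
  by rewrite /ptD /torus_rot cz1_pt_of cz2_pt_of.
move=> F.
have -> : F = fun t => h (pt_of (cz1 z + cexp (Complex 0 t) * cz1 w) (cz2 z + cexp (Complex 0 t) * cz2 w)).
  by apply/funext => t; exact: FE.
apply: (@circle_mean _ (fun s => h (pt_of (cz1 z + cexp s * cz1 w) (cz2 z + cexp s * cz2 w))) (ln 2)).
- by rewrite ln_gt0// ltr1n.
- move=> s s2.
  have ex : cabs (cexp s) <= 2.
    by rewrite cabs_cexp -[leRHS](@lnK R) ?posrE// ler_expR ltW.
  have H0 := hol _ (Dw _ ex).
  have lin (c d : R[i]) : exists e, cdiff (fun s => c + cexp s * d) s e.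
    exists (cexp s * d + cexp s * 0) => e e0.
    have [t [t0 Ht]] := cdiffM (cdiff_cexp s) (cdiff_cst d s) e0.
    exists t; split=> // k kt; have := Ht k kt.
    by rewrite (_ : c + cexp (s + k) * d - (c + cexp s * d) = cexp (s + k) * d - cexp s * d)//; ring.
  have [d1 c1] := lin (cz1 z) (cz1 w); have [d2 c2] := lin (cz2 z) (cz2 w).
  exact: (@holomorphic_cdiff_comp R h (fun s => cz1 z + cexp s * cz1 w) (fun s => cz2 z + cexp s * cz2 w) s d1 d2 H0 c1 c2).
- by move=> s; rewrite cexp_2pi.
- move=> e e0; have [t [t0 Ht]] := holomorphic_cont (hol _ Dz) e0.
  set M := cabs (cz1 w) + cabs (cz2 w) + 1.
  have M0 : 0 < M by rewrite ltr_wpDl// addr_ge0 ?cabs_ge0.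
  exists (ln (t / M)) => s st.
  have ex : cabs (cexp s) < t / M.
    by rewrite cabs_cexp -[ltRHS](@lnK R) ?posrE ?divr_gt0// ltr_expR.
  have B (x : R[i]) : cabs x < M -> cabs (cexp s * x) < t.
    move=> xM; rewrite cabsM; apply: le_lt_trans (_ : cabs (cexp s) * M < _).
      by rewrite ler_wpM2l ?cabs_ge0// ltW.
    by rewrite -ltr_pdivlMr.
  have w1 := cabs_ge0 (cz1 w); have w2 := cabs_ge0 (cz2 w).
  by apply: Ht; apply: B; rewrite /M; clear - w1 w2; lra.
Qed.

Definition ptN p : pt R := pt_of (- cz1 p) (- cz2 p).

Lemma ptDK z w : ptD z (ptD (ptN z) w) = w.
Proof. by rewrite /ptD /ptN !cz1_pt_of !cz2_pt_of !addrA !subrr !add0r pt_of_cz. Qed.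

Local Notation T1 := (measurableTypeR R).
Local Notation M4 := (sfprod (sfprod (sfprod L L) L) L).
Local Notation rot t := (torus_rot (cexp (Complex 0 t)) (cexp (Complex 0 t))).

Lemma cabs_cexp_i (t : R) : cabs (cexp (Complex 0 t)) = 1.
Proof. by rewrite cabs_cexp expR0. Qed.

(** Joint measurability in the angle and the point, as Fubini requires in [rotation_average]. *)
Lemma measurable_ptD_rot z :
  measurable_fun [set: T1 * pt R] (fun q : T1 * pt R => ptD z (rot q.1 q.2) : pt R).
Proof.
have E (q : T1 * pt R) : ptD z (rot q.1 q.2) =
  (((z.1.1.1 + (cos q.1 * q.2.1.1.1 - sin q.1 * q.2.1.1.2),
     z.1.1.2 + (cos q.1 * q.2.1.1.2 + sin q.1 * q.2.1.1.1)),
     z.1.2 + (cos q.1 * q.2.1.2 - sin q.1 * q.2.2)),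
     z.2 + (cos q.1 * q.2.2 + sin q.1 * q.2.1.2)) :> pt R.
  by rewrite /ptD /torus_rot cz1_pt_of cz2_pt_of /pt_of !ReD !ImD !ReM !ImM /= expR0 !mul1r.
rewrite (funext E).
have mc : measurable_fun [set: T1 * pt R] (fun q : T1 * pt R => cos q.1).
  by apply: (@measurableT_comp _ _ _ _ _ _ (@cos R)) => //; exact: continuous_measurable_fun (@continuous_cos R).
have ms : measurable_fun [set: T1 * pt R] (fun q : T1 * pt R => sin q.1).
  by apply: (@measurableT_comp _ _ _ _ _ _ (@sin R)) => //; exact: continuous_measurable_fun (@continuous_sin R).
have m2 : measurable_fun [set: T1 * pt R] snd by exact: measurable_snd.
have x1 := measurableT_comp (@measurable_x1 R) m2.
have y1 := measurableT_comp (@measurable_y1 R) m2.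
have x2 := measurableT_comp (@measurable_x2 R) m2.
have y2 := measurableT_comp (@measurable_y2 R) m2.
have lin (c : R) (f g k l : T1 * pt R -> R) : measurable_fun setT f -> measurable_fun setT g ->
    measurable_fun setT k -> measurable_fun setT l ->
    measurable_fun [set: T1 * pt R] (fun q : T1 * pt R => c + (f q * g q + k q * l q)).
  by move=> *; apply: measurable_funD => //; apply: measurable_funD; apply: measurable_funM.
have linB (c : R) (f g k l : T1 * pt R -> R) : measurable_fun setT f -> measurable_fun setT g ->
    measurable_fun setT k -> measurable_fun setT l ->
    measurable_fun [set: T1 * pt R] (fun q : T1 * pt R => c + (f q * g q - k q * l q)).
  by move=> *; apply: measurable_funD => //; apply: measurable_funB; apply: measurable_funM.
apply: measurable_fun_pair; last exact: lin.
apply: measurable_fun_pair; last exact: linB.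
by apply: measurable_fun_pair; [exact: linB | exact: lin].
Qed.

Lemma bump_integrable_mul r (g : pt R -> R) : dV.-integrable setT (EFin \o g) ->
  dV.-integrable setT (EFin \o (fun w => g w * bump r w)).
Proof.
move=> gi; have /integrableP[mg _] := gi.
apply: (le_integrable measurableT _ _ (integrableZl measurableT (r ^+ 4) gi)) => /=.
  apply/measurable_EFinP; apply: measurable_funM; last exact: measurable_bump.
  exact/measurable_EFinP.
move=> w _; rewrite lee_fin (normrM (g w)) mulrC (normrM (r ^+ 4)) ler_wpM2r//.
by rewrite (ger0_norm (bump_ge0 r w)) (le_trans (bump_le _ _))// ler_norm.
Qed.

Lemma dV_cube_lty (a b : R) : (dV (((`[a, b] `*` `[a, b]) `*` `[a, b]) `*` `[a, b]) < +oo)%E.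
Proof.
rewrite dV_box// lebesgue_measure_itv /=.
by case: ifP => _; rewrite ?mul0e -?EFinD -?EFinM ltry.
Qed.

Lemma bump_integrable r : 0 <= r -> dV.-integrable setT (EFin \o bump r).
Proof.
move=> r0; pose B : set (pt R) := ((`[- r, r] `*` `[- r, r]) `*` `[- r, r]) `*` `[- r, r].
have mB : measurable B by apply: measurableX => //; apply: measurableX => //; apply: measurableX.
have iB : dV.-integrable setT (EFin \o (fun w => r ^+ 4 * (\1_B w : R))).
  have -> : EFin \o (fun w => r ^+ 4 * (\1_B w : R)) = (fun w => (r ^+ 4)%:E * (EFin \o (\1_B : pt R -> R)) w)%E.
    by apply/funext => w.
  apply: integrableZl => //; apply/integrableP; split; first exact/measurable_EFinP.
  under eq_integral do rewrite /= ger0_norm//.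
  by rewrite integral_indic// setIT; exact: dV_cube_lty.
apply: (le_integrable measurableT _ _ iB); first by apply/measurable_EFinP; exact: measurable_bump.
move=> w _; rewrite /= lee_fin ger0_norm ?bump_ge0//.
have [->|/(bump_neq0 r0)[h1 h2]] := eqVneq (bump r w) 0; first by [].
rewrite indicE mem_set ?mulr1.
  by rewrite (le_trans (bump_le _ _))// ler_norm.
have := ler_normr_cabs_Re (cz1 w); have := ler_normr_cabs_Im (cz1 w).
have := ler_normr_cabs_Re (cz2 w); have := ler_normr_cabs_Im (cz2 w).
move=> /le_trans/(_ (ltW h2)) + /le_trans/(_ (ltW h2)) + /le_trans/(_ (ltW h1)) + /le_trans/(_ (ltW h1)).
by rewrite !ler_norml /B /= !in_itv /=.
Qed.

(** Bump and measure are invariant under the diagonal circle action, so replacing g by its means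
    over circles about z does not change the integral, and on the support of the bump these means
    equal v. *)
Lemma rotation_average (g : pt R -> R) z r v : 0 <= r ->
  dV.-integrable setT (EFin \o g) ->
  (forall w, bump r w != 0 -> L.-integrable `[0, 2 * pi] (EFin \o (fun t => g (ptD z (rot t w)))) /\
     \int[L]_(t in `[0, 2 * pi]) g (ptD z (rot t w)) = 2 * pi * v) ->
  \int[dV]_u (g u * bump r (ptD (ptN z) u)) = v * \int[dV]_w bump r w.
Proof.
move=> r0 gi gmean.
pose G w := g (ptD z w) * bump r w.
have Gi : dV.-integrable setT (EFin \o G).
  by apply: bump_integrable_mul; exact: (mpres_integrable (mpres_ptD z) gi).
have -> : \int[dV]_u (g u * bump r (ptD (ptN z) u)) = \int[dV]_w G w.
  rewrite -(mpres_Rintegral (mpres_ptD (ptN z)) Gi); apply: eq_Rintegral => u _.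
  by rewrite /G ptDK.
have pi0 : 0 < 2 * pi :> R by rewrite mulr_gt0// pi_gt0.
pose I : set T1 := `[0, 2 * pi]%classic.
have mI : measurable I by exact: measurable_itv.
(* Integrated in both orders: w first gives 2 pi times the integral of [G], since every rotation
   preserves it; t first gives the circle means. *)
pose Phi (q : T1 * pt R) : \bar R := (\1_I q.1 * (g (ptD z (rot q.1 q.2)) * bump r q.2))%:E.
have mg : measurable_fun setT g by have /integrableP[/measurable_EFinP] := gi.
have mPhi : measurable_fun [set: T1 * pt R] Phi.
  apply/measurable_EFinP; apply: measurable_funM.
    by apply: (@measurableT_comp _ _ _ _ _ _ (\1_I : T1 -> R)) => //; exact: measurable_indic.
  apply: measurable_funM; first by apply: (measurableT_comp mg); exact: measurable_ptD_rot.
  by apply: (measurableT_comp (@measurable_bump r)); exact: measurable_snd.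
have PhiE t w : Phi (t, w) = (\1_I t * G (rot t w))%:E.
  by rewrite /Phi /G /= bump_torus ?cabs_cexp_i.
have mrot t := mpres_torus_rot (cabs_cexp_i t) (cabs_cexp_i t).
have LI : L I = (2 * pi)%:E.
  by rewrite /I lebesgue_measure_itv /= lte_fin pi0 -EFinD subr0.
have EI : (\int[L]_t (\1_I t)%:E)%E = (2 * pi)%:E.
  by rewrite integral_indic// setIT; exact: LI.
have int_I (c : R) : (\int[L]_t ((\1_I t : R) * c)%:E = (2 * pi * c)%:E)%E.
  under eq_integral do rewrite EFinM muleC.
  rewrite integralZl//; last first.
    apply/integrableP; split; first exact/measurable_EFinP.
    under eq_integral do rewrite /= ger0_norm//.
    by rewrite [X in (X < _)%E]EI ltry.
  by rewrite [X in (_ * X)%E]EI -EFinM mulrC.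
have int_w t : (\int[M4]_w Phi (t, w))%E = ((\1_I t : R) * \int[dV]_w G w)%:E.
  under eq_integral do rewrite PhiE.
  have [tI|tI] := boolP (t \in I).
    rewrite indicE tI mul1r; under eq_integral do rewrite mul1r.
    have Gti := mpres_integrable (mrot t) Gi.
    rewrite -(mpres_Rintegral (mrot t) Gi) /Rintegral fineK//.
    exact: (integrable_fin_num _ Gti).
  rewrite indicE (negbTE tI) mul0r; under eq_integral do rewrite mul0r.
  exact: integral0.
have iPhi : (L \x M4)%E.-integrable [set: T1 * pt R] Phi.
  apply/(integrable12ltyP L M4 mPhi).
  have [C HC] : exists C : R, forall t, (\int[M4]_w `|Phi (t, w)| = ((\1_I t : R) * C)%:E)%E.
    exists (\int[dV]_w `|G w|) => t.
    under eq_integral do rewrite PhiE.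
    have [tI|tI] := boolP (t \in I).
      rewrite indicE tI mul1r; under eq_integral do rewrite mul1r.
      have Gai := integrable_norm Gi.
      have Gti := mpres_integrable (mrot t) Gai.
      rewrite -(mpres_Rintegral (mrot t) Gai) /Rintegral fineK//.
      exact: (integrable_fin_num _ Gti).
    rewrite indicE (negbTE tI) mul0r; under eq_integral do rewrite mul0r abse0.
    by rewrite integral0.
  by under eq_integral do rewrite HC; rewrite int_I ltry.
have := Fubini iPhi.
under eq_integral do rewrite int_w.
rewrite int_I.
have int_t w : (\int[L]_t Phi (t, w))%E = (2 * pi * v * bump r w)%:E.
  have [b0|b0] := eqVneq (bump r w) 0.
    by rewrite b0 mulr0; apply: integral0_eq => t _; rewrite /Phi /= b0 !mulr0.
  have [ki kE] := gmean w b0.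
  have -> : (\int[L]_t Phi (t, w) = \int[L]_(t in I) (g (ptD z (rot t w)) * bump r w)%:E)%E.
    rewrite [RHS]integral_mkcond; apply: eq_integral => t _.
    by rewrite /Phi /= patchE indicE; case: ifP => _; rewrite ?mul1r ?mul0r.
  have -> : (\int[L]_(t in I) (g (ptD z (rot t w)) * bump r w)%:E)%E =
      (\int[L]_(t in I) (g (ptD z (rot t w)) * bump r w))%:E.
    rewrite /Rintegral fineK//; apply: integrable_fin_num => //.
    by under eq_fun do rewrite EFinM; exact: integrableZr.
  by rewrite RintegralZr// kE.
under [in X in _ = X -> _]eq_integral do rewrite int_t.
have Z : fine (\int[M4]_w (2 * pi * v * bump r w)%:E) = 2 * pi * v * \int[dV]_w bump r w.
  rewrite (eq_measure_integral dV); last by move=> A _ _; exact: sfprod4E.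
  by apply: RintegralZl => //; exact: bump_integrable.
move=> /(congr1 fine) /= E0.
have {E0} := etrans E0 Z.
by move=> E; apply: (mulfI (lt0r_neq0 pi0)); rewrite [RHS]mulrA; exact: E.
Qed.

Section Gamma.
Variable gamma : R.
Hypothesis gamma0 : 0 < gamma.
Local Notation H := (Hgamma gamma).

(** The domain has finite volume and |a| <= 1 + a^2. Extension by zero lets translations of the
    whole space act. *)
Lemma restrict_integrable (a : pt R -> R) : rsq dV H a ->
  dV.-integrable setT (EFin \o (a \_ H)).
Proof.
have mH := measurable_Hgamma gamma.
move=> [ma ia].
have ai : dV.-integrable H (EFin \o a).
  have i1 : dV.-integrable H (EFin \o cst (1 : R)).
    apply/integrableP; split; first by apply/measurable_EFinP.
    under eq_integral do rewrite /= normr1.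
    by rewrite integral_cst// mul1e; exact: dV_Hgamma.
  apply: (le_integrable mH _ _ (integrableD mH i1 ia)); first exact/measurable_EFinP.
  move=> x _ /=; rewrite lee_fin [leRHS]ger0_norm ?addr_ge0 ?sqr_ge0//.
  rewrite -(real_normK (num_real (a x))); have := sqr_ge0 (`|a x| - 1).
  by have := normr_ge0 (a x); rewrite sqrrB expr1n; lra.
by rewrite -restrict_EFin; exact/(integrable_mkcond _ mH).1.
Qed.

(** The bump lives on radius r, while [torus_circle_mean] uses multipliers of modulus up to 2; hence
    the neighbourhood of radius 2 r. *)
Lemma Hgamma_mollify (h : pt R -> R[i]) z r : 0 < r -> H z ->
  (forall a b, cabs a < 2 * r -> cabs b < 2 * r -> H (pt_of (cz1 z + a) (cz2 z + b))) ->
  holomorphic_on H h -> sqint dV H h ->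
  \int[dV]_(u in H) (complex.Re (h u) * bump r (ptD (ptN z) u)) = complex.Re (h z) * \int[dV]_w bump r w /\
  \int[dV]_(u in H) (complex.Im (h u) * bump r (ptD (ptN z) u)) = complex.Im (h z) * \int[dV]_w bump r w.
Proof.
move=> r0 Hz near hol [h1 h2].
have mean w : bump r w != 0 -> (forall u, cabs u <= 2 -> H (pt_of (cz1 z + u * cz1 w) (cz2 z + u * cz2 w))).
  move=> /(bump_neq0 (ltW r0))[w1 w2] u u2; apply: near; rewrite cabsM.
    by apply: le_lt_trans (_ : 2 * cabs (cz1 w) < _); rewrite ?ltr_pM2l// ler_wpM2r ?cabs_ge0.
  by apply: le_lt_trans (_ : 2 * cabs (cz2 w) < _); rewrite ?ltr_pM2l// ler_wpM2r ?cabs_ge0.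
have inH w : bump r w != 0 -> forall t, H (ptD z (rot t w)).
  move=> b0 t; rewrite /ptD /torus_rot cz1_pt_of cz2_pt_of; apply: mean b0 _ _.
  by rewrite cabs_cexp_i ler1n.
have key (j : R[i] -> R) : rsq dV H (j \o h) ->
    (forall w, bump r w != 0 -> L.-integrable `[0, 2 * pi] (EFin \o (fun t => j (h (ptD z (rot t w))))) /\
     \int[L]_(t in `[0, 2 * pi]) j (h (ptD z (rot t w))) = 2 * pi * j (h z)) ->
    \int[dV]_(u in H) (j (h u) * bump r (ptD (ptN z) u)) = j (h z) * \int[dV]_w bump r w.
  move=> jh jm; rewrite -(@rotation_average ((j \o h) \_ H) z)//; last 3 first.
  - exact: ltW.
  - exact: restrict_integrable.
  - move=> w b0; have [ji je] := jm w b0.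
    have E t : ((j \o h) \_ H) (ptD z (rot t w)) = j (h (ptD z (rot t w))).
      by rewrite patchE mem_set//; exact: inH.
    by rewrite (funext E).
  rewrite Rintegral_mkcond; apply: eq_Rintegral => u _.
  by rewrite !patchE; case: ifP => _; rewrite ?mul0r.
split; apply: key => // w b0.
  by have [] := @torus_circle_mean H h z w Hz hol (mean w b0).
by have [] := @torus_circle_mean H h z w Hz hol (mean w b0).
Qed.

End Gamma.
End Mollifier.

(** * Second-order expansion with a remainder controlled by the L^2 norm *)

Section Taylor.
Variable R : realType.
Implicit Types (p q w z : pt R).

Definition dot p q : R :=
  complex.Re (cz1 p) * complex.Re (cz1 q) + complex.Im (cz1 p) * complex.Im (cz1 q) +
  (complex.Re (cz2 p) * complex.Re (cz2 q) + complex.Im (cz2 p) * complex.Im (cz2 q)).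

(** The square of the positive part has derivative 2 max(0, s), which is Lipschitz with constant
    2. *)
Lemma posq_taylor (s t : R) :
  `|Num.max 0 (s + t) ^+ 2 - Num.max 0 s ^+ 2 - 2 * Num.max 0 s * t| <= t ^+ 2.
Proof.
have st := sqr_ge0 (s + t); have t2 := sqr_ge0 t.
have [s0|s0] := leP 0 s; have [h|h] := leP 0 (s + t).
- have -> : (s + t) ^+ 2 - s ^+ 2 - 2 * s * t = t ^+ 2 by ring.
  by rewrite ger0_norm.
- have : 0 <= s * (- s - 2 * t) by rewrite mulr_ge0//; clear - s0 h; lra.
  rewrite ler_norml => k; apply/andP; split; rewrite expr0n /=; move: st k; rewrite !expr2; clear - t2; lra.
- have : 0 <= (s + t) * (- s) by rewrite mulr_ge0//; clear - s0; lra.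
  have : 0 <= (- s) * t by rewrite mulr_ge0//; clear - s0 h; lra.
  rewrite ler_norml => k1 k2; apply/andP; split; rewrite expr0n /= mulr0 mul0r !subr0; move: k1 k2 st t2; rewrite !expr2; clear; lra.
- by rewrite expr0n /= mulr0 mul0r !subr0 normr0.
Qed.

Lemma nsq_ptB v eta : nsq (ptD (ptN eta) v) = nsq v - 2 * dot v eta + nsq eta.
Proof.
rewrite /nsq /ptD /ptN !cz1_pt_of !cz2_pt_of /dot !cabs_sqr !ReD !ImD !ReN !ImN; ring.
Qed.

Lemma dot_sqr_le v w : dot v w ^+ 2 <= nsq v * nsq w.
Proof.
rewrite /nsq /dot !cabs_sqr.
move: (complex.Re (cz1 v)) (complex.Im (cz1 v)) (complex.Re (cz2 v)) (complex.Im (cz2 v)) => a b c d.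
move: (complex.Re (cz1 w)) (complex.Im (cz1 w)) (complex.Re (cz2 w)) (complex.Im (cz2 w)) => x y s t.
have -> : (a ^+ 2 + b ^+ 2 + (c ^+ 2 + d ^+ 2)) * (x ^+ 2 + y ^+ 2 + (s ^+ 2 + t ^+ 2)) =
  (a * x + b * y + (c * s + d * t)) ^+ 2 + ((a * y - b * x) ^+ 2 + (a * s - c * x) ^+ 2 + (a * t - d * x) ^+ 2
  + (b * s - c * y) ^+ 2 + (b * t - d * y) ^+ 2 + (c * t - d * s) ^+ 2) by ring.
by rewrite lerDl !addr_ge0// sqr_ge0.
Qed.

(* The differential at [eta = 0] of [bump r (v - eta)]. *)
Definition dbump (r : R) v eta : R := 4 * Num.max 0 (r ^+ 2 - nsq v) * dot v eta.

(** With N = [nsq eta] and D = [dot v eta], one has D^2 <= 8 N, so (2 D - N)^2 <= 8 D^2 + 2 N^2 <=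
    66 N; the part of the linear term that belongs to N adds 2 N. The bound 8 is that of
    [nsq_diff_le] for differences of points of the domain. *)
Lemma bump_taylor r v eta : 0 <= r <= 1 -> nsq v <= 8 -> nsq eta <= 1 ->
  `|bump r (ptD (ptN eta) v) - bump r v - dbump r v eta| <= 68 * nsq eta.
Proof.
move=> /andP[r0 r1] v8 e1; rewrite /bump nsq_ptB /dbump.
set s := r ^+ 2 - nsq v; set N := nsq eta in e1 *; set D := dot v eta.
have -> : r ^+ 2 - (nsq v - 2 * D + N) = s + (2 * D - N) by rewrite /s; ring.
have N0 : 0 <= N := nsq_ge0 _.
have D2 : D ^+ 2 <= 8 * N by apply: le_trans (dot_sqr_le _ _) _; rewrite ler_wpM2r.
have m0 : 0 <= Num.max 0 s by rewrite le_max lexx.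
have m1 : Num.max 0 s <= 1.
  rewrite ge_max ler01 /s lerBlDr (le_trans (exprn_ile1 2 r0 r1))// lerDl nsq_ge0//.
have -> : Num.max 0 (s + (2 * D - N)) ^+ 2 - Num.max 0 s ^+ 2 - 4 * Num.max 0 s * D =
  (Num.max 0 (s + (2 * D - N)) ^+ 2 - Num.max 0 s ^+ 2 - 2 * Num.max 0 s * (2 * D - N)) - 2 * Num.max 0 s * N by ring.
apply: le_trans (ler_normB _ _) _.
apply: le_trans (lerD (posq_taylor _ _) (lexx _)) _.
rewrite ger0_norm; last by rewrite mulr_ge0// mulr_ge0.
have : Num.max 0 s * N <= 1 * N by rewrite ler_wpM2r.
have : N * N <= 1 * N by rewrite ler_wpM2r.
have := sqr_ge0 (2 * D + N).
have -> : (2 * D - N) ^+ 2 = 8 * D ^+ 2 + 2 * (N * N) - (2 * D + N) ^+ 2 by ring.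
by move: D2; clear; lra.
Qed.

Lemma dotZr p q (t : R) : dot p (pt_of ((t%:C)%C * cz1 q) ((t%:C)%C * cz2 q)) = t * dot p q.
Proof. by rewrite /dot !cz1_pt_of !cz2_pt_of !ReM !ImM /=; ring. Qed.

Lemma measurable_dot r z eta :
  measurable_fun [set: pt R] (fun u => dbump r (ptD (ptN z) u) eta).
Proof.
have mD : measurable_fun [set: pt R] (ptD (ptN z)) by case: (mpres_ptD (ptN z)).
apply: (measurableT_comp _ mD (f := fun u => dbump r u eta)).
apply: measurable_funM.
  by apply: measurable_funM => //; apply: measurable_maxr => //; apply: measurable_funB => //; exact: measurable_nsq.
have x1 := @measurable_x1 R; have y1 := @measurable_y1 R; have x2 := @measurable_x2 R; have y2 := @measurable_y2 R.
by apply: measurable_funD; apply: measurable_funD; apply: measurable_funM.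
Qed.

Lemma bump_integral_gt0 (r : R) : 0 < r -> 0 < \int[@dV R]_w bump r w.
Proof.
(* On the cube with this side the squared norm is at most r^2 / 4, so the bump stays above (r^2 /
   2)^2. *)
move=> r0; pose I : set R := `[0, r / 4]%classic.
pose B : set (pt R) := ((I `*` I) `*` I) `*` I.
have mI : measurable I by exact: measurable_itv.
have mB : measurable B by apply: measurableX => //; apply: measurableX => //; apply: measurableX.
have r4 : 0 < r / 4 by rewrite divr_gt0.
have VB : @dV R B = ((r / 4) ^+ 4)%:E.
  rewrite dV_box//; have -> : @lebesgue_measure R I = (r / 4)%:E.
    by rewrite lebesgue_measure_itv /= lte_fin r4 -EFinD subr0.
  by rewrite -!EFinM; congr EFin; ring.
have k0 : 0 < (r ^+ 2 / 2) ^+ 2 by rewrite exprn_gt0// divr_gt0// exprn_gt0.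
apply: (@lt_le_trans _ _ ((r ^+ 2 / 2) ^+ 2 * (r / 4) ^+ 4)); first by rewrite mulr_gt0// exprn_gt0.
have bi := bump_integrable (ltW r0).
rewrite -lee_fin EFinM -VB -integral_cst// /Rintegral fineK; last exact: integrable_fin_num.
apply: (@le_trans _ _ (\int[@dV R]_(x in B) (bump r x)%:E)%E); last first.
  apply: ge0_subset_integral => //; first by apply/measurable_EFinP; exact: measurable_bump.
  by move=> x _; rewrite lee_fin bump_ge0.
apply: ge0_le_integral => //.
- by move=> x _; rewrite lee_fin ltW.
- by apply/measurable_EFinP; exact: measurable_funTS (measurable_bump r).
move=> w [[[]]] /=; rewrite /I /= !in_itv /= => /andP[a1 a2] /andP[b1 b2] /andP[c1 c2] /andP[d1 d2].
have sq (x : R) : 0 <= x -> x <= r / 4 -> x ^+ 2 <= r ^+ 2 / 16.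
  move=> x0 xr; have -> : r ^+ 2 / 16 = (r / 4) ^+ 2 by field.
  by rewrite ler_pXn2r ?nnegrE// ltW.
have := sq _ a1 a2; have := sq _ b1 b2; have := sq _ c1 c2; have := sq _ d1 d2.
rewrite lee_fin /bump ler_pXn2r ?nnegrE ?le_max ?lexx//; last by rewrite divr_ge0// sqr_ge0.
move=> k1 k2 k3 k4; apply/orP; right; rewrite /nsq !cabs_sqr /=.
have := sqr_ge0 r; move: k1 k2 k3 k4; clear; lra.
Qed.

Section Gamma.
Variable gamma : R.
Hypothesis gamma0 : 0 < gamma.
Local Notation H := (Hgamma gamma).
Local Notation dV := (@dV R).

Lemma sqint1 : sqint dV H (fun=> 1).
Proof.
have mH := measurable_Hgamma gamma.
apply/(sqintP _ mH); split; first by split; exact: measurable_cst.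
under eq_integral do rewrite cabs1 expr1n.
by rewrite (integral_cst _ mH) mul1e; exact: dV_Hgamma.
Qed.

Lemma rsq_integrable (a : pt R -> R) : rsq dV H a -> dV.-integrable H (EFin \o a).
Proof. have mH := measurable_Hgamma gamma; by move=> /(restrict_integrable gamma0); rewrite -restrict_EFin => /(integrable_mkcond _ mH). Qed.

Lemma integrable_bounded_mul (a k : pt R -> R) (C : R) : dV.-integrable H (EFin \o a) ->
  measurable_fun H k -> (forall x, H x -> `|k x| <= C) ->
  dV.-integrable H (EFin \o (fun x => a x * k x)).
Proof.
have mH := measurable_Hgamma gamma.
move=> ai mk kC; have /integrableP[ma _] := ai.
apply: (le_integrable mH _ _ (integrableZl mH C ai)) => /=.
  by apply/measurable_EFinP; apply: measurable_funM => //; exact/measurable_EFinP.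
move=> x Hx; rewrite lee_fin (normrM (a x)) mulrC (normrM C) ler_wpM2r//.
exact: le_trans (kC x Hx) (ler_norm _).
Qed.

(** Cauchy-Schwarz against the constant 1, which is square integrable by finite volume. *)
Lemma Rintegral_abs_le (h : pt R -> R[i]) (j : R[i] -> R) : sqint dV H h ->
  rsq dV H (j \o h) -> (forall x, `|j x| <= cabs x) ->
  \int[dV]_(u in H) `|j (h u)| <= nrm dV H (fun=> 1) * nrm dV H h.
Proof.
have mH := measurable_Hgamma gamma.
move=> hh jh jle.
pose f u : R[i] := (`|j (h u)|%:C)%C.
have hf : sqint dV H f.
  split.
    have [m i] := jh; split.
      by rewrite (_ : _ \o _ = fun u => `|(j \o h) u|)//; apply: measurableT_comp.
    by rewrite (_ : EFin \o _ = EFin \o (fun u => (j \o h) u ^+ 2))//; apply/funext => u /=; rewrite real_normK// num_real.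
  split; first by rewrite (_ : _ \o _ = cst 0).
  by rewrite (_ : EFin \o _ = cst 0%E); [exact: integrable0 | apply/funext => u /=; rewrite expr0n].
have -> : \int[dV]_(u in H) `|j (h u)| = ip dV H (fun=> 1) f.
  by apply: eq_Rintegral => u _; rewrite /f /= mul1r mulr0 addr0.
apply: le_trans (ler_norm _) _.
have X := normr_ip_le mH sqint1 hf; apply: le_trans X _.
apply: ler_wpM2l; first exact: nrm_ge0.
apply: ler_wsqrtr; apply: le_Rintegral => //; try exact: ip_integrable.
move=> u _; rewrite /f /= mulr0 addr0 -expr2 -[leRHS]/(_ * _ + _) -!expr2 -cabs_sqr.
by rewrite ler_pXn2r ?nnegrE ?cabs_ge0.
Qed.

Lemma dbumpZr r u q (t : R) : dbump r u (pt_of ((t%:C)%C * cz1 q) ((t%:C)%C * cz2 q)) = t * dbump r u q.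
Proof. by rewrite /dbump dotZr; ring. Qed.

Lemma dbump_le r v eta : 0 <= r <= 1 -> nsq v <= 8 -> `|dbump r v eta| <= 4 * (8 + nsq eta).
Proof.
have mH := measurable_Hgamma gamma.
move=> /andP[r0 r1] v8; rewrite /dbump -mulrA normrM ger0_norm// ler_pM2l//.
have m0 : 0 <= Num.max 0 (r ^+ 2 - nsq v) by rewrite le_max lexx.
have m1 : Num.max 0 (r ^+ 2 - nsq v) <= 1.
  by rewrite ge_max ler01 lerBlDr (le_trans (exprn_ile1 2 r0 r1))// lerDl nsq_ge0.
rewrite normrM (ger0_norm m0); apply: le_trans (ler_piMl (normr_ge0 _) m1) _.
have N0 := nsq_ge0 v; have E0 := nsq_ge0 eta.
have A0 : 0 <= 8 + nsq eta by rewrite addr_ge0.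
suff : `|dot v eta| ^+ 2 <= (8 + nsq eta) ^+ 2 by rewrite ler_pXn2r// nnegrE.
rewrite real_normK ?num_real//; apply: le_trans (dot_sqr_le _ _) _.
apply: le_trans (_ : 8 * nsq eta <= _); first by rewrite ler_wpM2r.
have -> : (8 + nsq eta) ^+ 2 = 64 + 16 * nsq eta + nsq eta ^+ 2 by ring.
by have := sqr_ge0 (nsq eta); move: E0; clear - gamma0; lra.
Qed.

Lemma nsq_diff_le z u : H z -> H u -> nsq (ptD (ptN z) u) <= 8.
Proof.
have mH := measurable_Hgamma gamma.
move=> Hz Hu; rewrite /nsq /ptD /ptN !cz1_pt_of !cz2_pt_of.
have K (a b : R[i]) : cabs a < 1 -> cabs b < 1 -> cabs (- a + b) ^+ 2 <= 4.
  move=> a1 b1; have -> : 4 = 2 ^+ 2 :> R by ring.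
  rewrite ler_pXn2r ?nnegrE ?cabs_ge0//; apply: le_trans (cabsD _ _) _; rewrite cabsN; lra.
have := K _ _ (Hgamma_cz1_lt1 gamma0 Hz) (Hgamma_cz1_lt1 gamma0 Hu).
by have := K _ _ (Hgamma_cz2_lt1 Hz) (Hgamma_cz2_lt1 Hu); clear - gamma0; lra.
Qed.

(* [h] being its own average against [bump], the expansion of [h] at [z] follows from that of
   [bump]; [M] depends on [z] only. *)
Lemma Hgamma_quadratic_taylor z : H z -> exists r M, 0 < r /\ 0 <= M /\
  forall h, holomorphic_on H h -> sqint dV H h -> exists a b, forall h1 h2,
    cabs h1 < r -> cabs h2 < r ->
    cabs (h (pt_of (cz1 z + h1) (cz2 z + h2)) - h z - (a * h1 + b * h2))
      <= M * nrm dV H h * (cabs h1 ^+ 2 + cabs h2 ^+ 2).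
Proof.
have mH := measurable_Hgamma gamma.
move=> Hz; have [r0 [r00 near0]] := Hgamma_open gamma0 Hz.
(* A displacement by r followed by a 2 r neighbourhood stays within [r0]; the bound 1 / 2 keeps the
   squared displacement below 1 for [bump_taylor]. *)
pose r := Num.min (r0 / 3) (1 / 2).
have r_gt0 : 0 < r by rewrite lt_min !divr_gt0.
have r_r0 : r <= r0 / 3 by rewrite ge_min lexx.
have r_1 : r <= 1 / 2 by rewrite ge_min lexx orbT.
have r01 : 0 <= r <= 1 by apply/andP; split; clear - gamma0 r_gt0 r_1; lra.
pose c := \int[dV]_w bump r w; have c0 : 0 < c := bump_integral_gt0 r_gt0.
pose S := nrm dV H (fun=> 1); have S0 : 0 <= S := nrm_ge0 _ _ _.
exists r, (2 * (68 * S / c)); split=> //; split.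
  by rewrite mulr_ge0// divr_ge0 ?mulr_ge0// ltW.
move=> h hol hsq; have [a [b Hab]] := hol z Hz; exists a, b.
have near h1 h2 : cabs h1 < r -> cabs h2 < r -> let z' := pt_of (cz1 z + h1) (cz2 z + h2) in
    H z' /\ forall x y, cabs x < 2 * r -> cabs y < 2 * r -> H (pt_of (cz1 z' + x) (cz2 z' + y)).
  move=> l1 l2 z'; split.
    by apply: near0; clear - gamma0 l1 l2 r_r0 r_gt0; lra.
  move=> x y lx ly; rewrite /z' cz1_pt_of cz2_pt_of -!addrA; apply: near0.
    by apply: le_lt_trans (cabsD _ _) _; clear - gamma0 l1 l2 lx ly r_r0; lra.
  by apply: le_lt_trans (cabsD _ _) _; clear - gamma0 l1 l2 lx ly r_r0; lra.
(* [j] is the real or the imaginary part. The averaging identity at z and at the displaced point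
   moves the increment of [h] onto the bump, whose differential produces [Lj]. *)
have key (j : R[i] -> R) : (forall x y, j (x + y) = j x + j y) -> (forall x, j (- x) = - j x) ->
    (forall (t : R) x, j ((t%:C)%C * x) = t * j x) -> (forall x, `|j x| <= cabs x) ->
    rsq dV H (j \o h) ->
    (forall z' , H z' -> (forall x y, cabs x < 2 * r -> cabs y < 2 * r -> H (pt_of (cz1 z' + x) (cz2 z' + y))) ->
      \int[dV]_(u in H) (j (h u) * bump r (ptD (ptN z') u)) = j (h z') * c) ->
    forall h1 h2, cabs h1 < r -> cabs h2 < r ->
    `|j (h (pt_of (cz1 z + h1) (cz2 z + h2)) - h z - (a * h1 + b * h2))|
      <= (68 * S / c) * nrm dV H h * (cabs h1 ^+ 2 + cabs h2 ^+ 2).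
  move=> jD jN jZ jle jh mol.
  have ji := rsq_integrable jh.
  pose Lj q := \int[dV]_(u in H) (j (h u) * dbump r (ptD (ptN z) u) q).
  have Li q : dV.-integrable H (EFin \o (fun u => j (h u) * dbump r (ptD (ptN z) u) q)).
    apply: (integrable_bounded_mul (C := 4 * (8 + nsq q)) ji).
      by apply: measurable_funTS; exact: measurable_dot.
    by move=> u Hu; apply: dbump_le => //; exact: nsq_diff_le.
  have bi z' : dV.-integrable H (EFin \o (fun u => j (h u) * bump r (ptD (ptN z') u))).
    apply: (integrable_bounded_mul (C := r ^+ 4) ji).
      apply: measurable_funTS; apply: (measurableT_comp (@measurable_bump R r)).
      by case: (mpres_ptD (ptN z')).
    by move=> u Hu; rewrite ger0_norm ?bump_ge0// bump_le.
  have est h1 h2 : cabs h1 < r -> cabs h2 < r ->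
      `|c * j (h (pt_of (cz1 z + h1) (cz2 z + h2)) - h z) - Lj (pt_of h1 h2)| <=
      68 * S * nrm dV H h * (cabs h1 ^+ 2 + cabs h2 ^+ 2).
    move=> l1 l2; have [Hz' near'] := near h1 h2 l1 l2.
    set z' := pt_of (cz1 z + h1) (cz2 z + h2) in Hz' near' *.
    have [_ nearz] : H (pt_of (cz1 z + 0) (cz2 z + 0)) /\ forall x y, cabs x < 2 * r -> cabs y < 2 * r -> H (pt_of (cz1 z + x) (cz2 z + y)).
      by have := near 0 0; rewrite cabs0 => /(_ r_gt0 r_gt0); rewrite !addr0 pt_of_cz.
    rewrite jD jN mulrDr mulrN ![c * _]mulrC -(mol z')// -(mol z)// /Lj.
    rewrite -RintegralB// -RintegralB//; last first.
      exact: (integrableB mH (bi z') (bi z)).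
    set N := cabs h1 ^+ 2 + cabs h2 ^+ 2.
    have Ne : nsq (pt_of h1 h2) = N by rewrite /nsq cz1_pt_of cz2_pt_of.
    have N1 : N <= 1.
      have sq (x : R) : 0 <= x -> x < r -> x ^+ 2 <= 1 / 4.
        move=> x0 xr; have -> : 1 / 4 = (1 / 2) ^+ 2 :> R by field.
        by rewrite ler_pXn2r ?nnegrE//; apply: le_trans (ltW xr) r_1.
      by have := sq _ (cabs_ge0 h1) l1; have := sq _ (cabs_ge0 h2) l2; rewrite /N; clear - gamma0; lra.
    have E u : j (h u) * bump r (ptD (ptN z') u) - j (h u) * bump r (ptD (ptN z) u) - j (h u) * dbump r (ptD (ptN z) u) (pt_of h1 h2) =
       j (h u) * (bump r (ptD (ptN (pt_of h1 h2)) (ptD (ptN z) u)) - bump r (ptD (ptN z) u) - dbump r (ptD (ptN z) u) (pt_of h1 h2)).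
      have -> : ptD (ptN z') u = ptD (ptN (pt_of h1 h2)) (ptD (ptN z) u).
        rewrite /ptD /ptN /z' !cz1_pt_of !cz2_pt_of; congr pt_of; ring.
      by rewrite !mulrBr.
    under eq_Rintegral do rewrite E.
    have Ei : dV.-integrable H (EFin \o (fun u => j (h u) * (bump r (ptD (ptN (pt_of h1 h2)) (ptD (ptN z) u)) - bump r (ptD (ptN z) u) - dbump r (ptD (ptN z) u) (pt_of h1 h2)))).
      rewrite (_ : EFin \o _ = ((EFin \o (fun u => (j (h u) * bump r (ptD (ptN z') u))%R)) \- (EFin \o (fun u => (j (h u) * bump r (ptD (ptN z) u))%R))
        \- (EFin \o (fun u => (j (h u) * dbump r (ptD (ptN z) u) (pt_of h1 h2))%R)))%E).
        by apply: integrableB => //; apply: integrableB.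
      by apply/funext => u /=; rewrite -E.
    apply: le_trans (le_normr_Rintegral mH Ei) _.
    apply: (@le_trans _ _ (\int[dV]_(u in H) (68 * N * `|j (h u)|))).
      apply: le_Rintegral => //.
      - exact: integrable_norm.
      - exact: (integrableZl mH (68 * N) (integrable_norm ji)).
      - move=> u Hu; rewrite normrM mulrC ler_wpM2r// -Ne; apply: bump_taylor => //; exact: nsq_diff_le.
    rewrite RintegralZl//; last exact: (integrable_norm ji).
    apply: le_trans (ler_wpM2l _ (Rintegral_abs_le hsq jh jle)) _.
      by rewrite mulr_ge0// addr_ge0// sqr_ge0.
    by rewrite le_eqVlt; apply/orP; left; apply/eqP; rewrite -/S; ring.
  have LZ (t : R) h1 h2 : Lj (pt_of ((t%:C)%C * h1) ((t%:C)%C * h2)) = t * Lj (pt_of h1 h2).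
    rewrite /Lj -RintegralZl//; apply: eq_Rintegral => u _.
    have := dbumpZr r (ptD (ptN z) u) (pt_of h1 h2) t; rewrite cz1_pt_of cz2_pt_of => ->; ring.
  (* [Lj] and the complex differential both approximate the same increment to first order and are
     homogeneous under real scaling; shrinking the displacement by a factor t forces them to
     agree. *)
  have lin h1 h2 : Lj (pt_of h1 h2) = c * j (a * h1 + b * h2).
    apply/eqP; rewrite -subr_eq0 -normr_eq0 eq_le normr_ge0 andbT.
    apply/ler_addgt0Pr => e e0; rewrite add0r.
    set q := Num.sqrt (cabs h1 ^+ 2 + cabs h2 ^+ 2).
    have q0 : 0 <= q := sqrtr_ge0 _.
    have N0 : 0 <= cabs h1 ^+ 2 + cabs h2 ^+ 2 by rewrite addr_ge0// sqr_ge0.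
    have q2 : q ^+ 2 = cabs h1 ^+ 2 + cabs h2 ^+ 2 by rewrite sqr_sqrtr.
    pose P := 68 * S * nrm dV H h * q ^+ 2.
    have P0 : 0 <= P by rewrite /P !mulr_ge0// ?nrm_ge0// sqr_ge0.
    pose e1 := e / 2 / (c * (q + 1)).
    have cq0 : 0 < c * (q + 1) by rewrite mulr_gt0// ltr_wpDl.
    have e10 : 0 < e1 by rewrite !divr_gt0.
    have [t1 [t10 Ht1]] := Hab e1 e10.
    (* In turn: the range of complex differentiability, the range of [est], and a quadratic error
       below e t / 2. *)
    pose t := Num.min (t1 / 2 / (q + 1)) (Num.min (r / 2 / (q + 1)) (e / 2 / (P + 1))).
    have q1 : 0 < q + 1 by rewrite ltr_wpDl.
    have P1 : 0 < P + 1 by rewrite ltr_wpDl.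
    have t0 : 0 < t by rewrite !lt_min !divr_gt0.
    have tle x : 0 < x -> t <= x / 2 / (q + 1) -> t * q < x.
      move=> x0 tx; apply: (@le_lt_trans _ _ (x / 2)); last by rewrite ltr_pdivrMr// ltr_pMr// ltr1n.
      apply: (@le_trans _ _ (t * (q + 1))); first by rewrite ler_pM2l// lerDl.
      by rewrite -ler_pdivlMr.
    have [T1 [T2 T3]] : t <= t1 / 2 / (q + 1) /\ t <= r / 2 / (q + 1) /\ t <= e / 2 / (P + 1).
      by split; [|split]; rewrite /t !ge_min lexx ?orbT.
    have nt : Num.sqrt (cabs ((t%:C)%C * h1) ^+ 2 + cabs ((t%:C)%C * h2) ^+ 2) = t * q.
      rewrite !cabsM cabs_real (gtr0_norm t0) !exprMn -mulrDr sqrtrM ?sqr_ge0//.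
      by rewrite sqrtr_sqr gtr0_norm.
    have [n1 n2] := cabs_le_norm2 ((t%:C)%C * h1) ((t%:C)%C * h2).
    rewrite nt in n1 n2.
    have tr := tle r r_gt0 T2.
    have E1 := est _ _ (le_lt_trans n1 tr) (le_lt_trans n2 tr).
    have E2 := Ht1 ((t%:C)%C * h1) ((t%:C)%C * h2); rewrite nt in E2.
    have {}E2 := E2 (tle t1 t10 T1).
    rewrite LZ in E1.
    have NN : cabs ((t%:C)%C * h1) ^+ 2 + cabs ((t%:C)%C * h2) ^+ 2 = t ^+ 2 * q ^+ 2.
      by rewrite !cabsM cabs_real (gtr0_norm t0) !exprMn -mulrDr q2.
    rewrite NN in E1.
    set d := h (pt_of _ _) - h z in E1 E2.
    have E3 := le_trans (jle _) E2.
    have jl : j (d - (a * ((t%:C)%C * h1) + b * ((t%:C)%C * h2))) = j d - t * j (a * h1 + b * h2).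
      rewrite jD jN -jZ; congr (_ - j _); ring.
    rewrite jl in E3.
    have F : t * `|Lj (pt_of h1 h2) - c * j (a * h1 + b * h2)| <= t ^+ 2 * P + c * (e1 * (t * q)).
      rewrite -{1}(gtr0_norm t0) -normrM.
      have -> : t * (Lj (pt_of h1 h2) - c * j (a * h1 + b * h2)) =
        c * (j d - t * j (a * h1 + b * h2)) - (c * j d - t * Lj (pt_of h1 h2)) by ring.
      apply: le_trans (ler_normB _ _) _; rewrite addrC; apply: lerD.
        by apply: le_trans E1 _; rewrite le_eqVlt; apply/orP; left; apply/eqP; rewrite /P; ring.
      by rewrite normrM (gtr0_norm c0) ler_pM2l.
    rewrite -(ler_pM2l t0); apply: le_trans F _.
    have F1 : t * P <= e / 2.
      apply: (@le_trans _ _ (t * (P + 1))); first by rewrite ler_pM2l// lerDl.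
      by rewrite -ler_pdivlMr.
    have F2 : c * (e1 * q) <= e / 2.
      apply: (@le_trans _ _ (e1 * (c * (q + 1)))).
        by rewrite mulrCA ler_pM2l// ler_pM2l// lerDl.
      by rewrite /e1 divfK// gt_eqF.
    have -> : t ^+ 2 * P + c * (e1 * (t * q)) = t * (t * P + c * (e1 * q)) by ring.
    by rewrite ler_pM2l//; move: F1 F2; clear - gamma0; lra.
  move=> h1 h2 l1 l2; have := est h1 h2 l1 l2; rewrite lin -mulrBr -jN -jD normrM (gtr0_norm c0).
  rewrite -ler_pdivlMl// => le; apply: le_trans le _.
  by rewrite le_eqVlt; apply/orP; left; apply/eqP; field; rewrite gt_eqF.
move=> h1 h2 l1 l2.
have [hR hI] := hsq.
have mol z' : H z' -> _ := fun Hz' near' => Hgamma_mollify gamma0 r_gt0 Hz' near' hol hsq.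
have kR := key (@complex.Re R) (@ReD R) (@ReN R) (fun t x => ltac:(by rewrite ReM /= mul0r subr0)) (@ler_normr_cabs_Re R) hR (fun z' Hz' n' => (mol z' Hz' n').1) h1 h2 l1 l2.
have kI := key (@complex.Im R) (@ImD R) (@ImN R) (fun t x => ltac:(by rewrite ImM /= mul0r addr0)) (@ler_normr_cabs_Im R) hI (fun z' Hz' n' => (mol z' Hz' n').2) h1 h2 l1 l2.
apply: le_trans (cabs_le_ReIm _) _; apply: le_trans (lerD kR kI) _.
by rewrite le_eqVlt; apply/orP; left; apply/eqP; ring.
Qed.

End Gamma.
End Taylor.

(** * Limits of sequences and Fatou's lemma *)

Section Sequences.
Variable R : realType.

Lemma cvg_epsP (u : nat -> R) (l : R) :
  u n @[n --> \oo] --> l <-> (forall e : R, 0 < e -> exists N, forall n, (N <= n)%N -> `|u n - l| <= e).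
Proof.
split=> [/cvgrPdist_le H e e0|H].
  have [N _ HN] := H e e0; exists N => n Nn; rewrite distrC; exact: HN.
apply/cvgrPdist_le => e e0; have [N HN] := H e e0; exists N => // n /= Nn.
rewrite distrC; exact: HN.
Qed.

Lemma real_cauchy_limit (u : nat -> R) :
  (forall e : R, 0 < e -> exists N, forall n m, (N <= n)%N -> (N <= m)%N -> `|u n - u m| <= e) ->
  exists l, forall e : R, 0 < e -> exists N, forall n, (N <= n)%N -> `|u n - l| <= e.
Proof.
move=> H; suff : cvgn u.
  by move=> /cvg_ex[l ul]; exists l; apply/cvg_epsP.
apply/cauchy_cvgP/cauchy_ballP => e e0.
have [N HN] := H (e / 2) (divr_gt0 e0 (ltr0n _ 2)).
pose V := [set x | exists2 n, (N <= n)%N & x = u n].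
exists (V, V); first by split; exists N => // n /= Nn; exists n.
move=> [x y] [/= [n Nn ->] [m Nm ->]]; rewrite /ball /=.
by apply: le_lt_trans (HN _ _ Nn Nm) _; rewrite ltr_pdivrMr// ltr_pMr// ltr1n.
Qed.

Definition ctends (u : nat -> R[i]) (l : R[i]) :=
  forall e : R, 0 < e -> exists N, forall n, (N <= n)%N -> cabs (u n - l) <= e.

Lemma ctends_Re u l : ctends u l -> (complex.Re (u n)) @[n --> \oo] --> complex.Re l.
Proof.
move=> H; apply/cvg_epsP => e /H[N HN]; exists N => n /HN; apply: le_trans.
by rewrite -ReB ler_normr_cabs_Re.
Qed.

Lemma ctends_Im u l : ctends u l -> (complex.Im (u n)) @[n --> \oo] --> complex.Im l.
Proof.
move=> H; apply/cvg_epsP => e /H[N HN]; exists N => n /HN; apply: le_trans.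
by rewrite -ImB ler_normr_cabs_Im.
Qed.

Lemma complex_cauchy_limit (u : nat -> R[i]) :
  (forall e : R, 0 < e -> exists N, forall n m, (N <= n)%N -> (N <= m)%N -> cabs (u n - u m) <= e) ->
  exists l, ctends u l.
Proof.
move=> H.
have [x Hx] : exists l, forall e : R, 0 < e -> exists N, forall n, (N <= n)%N -> `|complex.Re (u n) - l| <= e.
  apply: real_cauchy_limit => e /H[N HN]; exists N => n m Nn Nm.
  by rewrite -ReB; exact: le_trans (ler_normr_cabs_Re _) (HN _ _ Nn Nm).
have [y Hy] : exists l, forall e : R, 0 < e -> exists N, forall n, (N <= n)%N -> `|complex.Im (u n) - l| <= e.
  apply: real_cauchy_limit => e /H[N HN]; exists N => n m Nn Nm.
  by rewrite -ImB; exact: le_trans (ler_normr_cabs_Im _) (HN _ _ Nn Nm).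
exists (Complex x y) => e e0.
have [N1 H1] := Hx _ (divr_gt0 e0 (ltr0n _ 2)); have [N2 H2] := Hy _ (divr_gt0 e0 (ltr0n _ 2)).
exists (maxn N1 N2) => n; rewrite geq_max => /andP[/H1 h1 /H2 h2].
apply: le_trans (cabs_le_ReIm _) _; rewrite ReB ImB /=.
by rewrite (splitr e) lerD.
Qed.

Lemma limn_einf_le (u : nat -> \bar R) (B : \bar R) : (forall n, u n <= B)%E -> (limn_einf u <= B)%E.
Proof.
move=> uB; rewrite limn_einf_lim; apply: lime_le; first exact: is_cvg_einfs.
by apply: nearW => n; apply: le_trans (uB n); apply: ereal_inf_lbound; exists n => /=.
Qed.

Context d (T : measurableType d) (mu : {measure set T -> \bar R}) (D : set T).
Hypothesis mD : measurable D.

(** Fatou's lemma for the squared moduli. It turns pointwise limits into norm estimates, both for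
    minimizing sequences and for the cut-off monomials. *)
Lemma sqint_fatou (u : nat -> T -> R[i]) (h : T -> R[i]) (B : R) :
  (forall n, sqint mu D (u n)) -> (forall n, ip mu D (u n) (u n) <= B) ->
  (forall x, D x -> ctends (u ^~ x) (h x)) ->
  sqint mu D h /\ ip mu D h h <= B.
Proof.
move=> us uB uh.
have mu' n := ((sqintP mu mD (u n)).1 (us n)).1.
have uf n := ((sqintP mu mD (u n)).1 (us n)).2.
have m1 : measurable_fun D (@complex.Re R \o h).
  apply: (@measurable_fun_cvg _ _ _ _ (fun n => @complex.Re R \o u n)) => [n|x Dx].
    by case: (mu' n).
  exact: ctends_Re (uh x Dx).
have m2 : measurable_fun D (@complex.Im R \o h).
  apply: (@measurable_fun_cvg _ _ _ _ (fun n => @complex.Im R \o u n)) => [n|x Dx].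
    by case: (mu' n).
  exact: ctends_Im (uh x Dx).
have F : (\int[mu]_(x in D) (cabs (h x) ^+ 2)%:E <= B%:E)%E.
  have := @fatou _ T R mu D mD (fun n x => (cabs (u n x) ^+ 2)%:E).
  have -> : (\int[mu]_(x in D) limn_einf (fun n => (cabs (u n x) ^+ 2)%:E) =
     \int[mu]_(x in D) (cabs (h x) ^+ 2)%:E)%E.
    apply: eq_integral => x /[!inE] Dx.
    suff : (cabs (u n x) ^+ 2)%:E @[n --> \oo] --> (cabs (h x) ^+ 2)%:E.
      by move=> /cvg_limn_einf_sup[].
    apply: cvg_EFin; first by apply: nearW.
    rewrite (_ : fine \o _ = fun n => complex.Re (u n x) ^+ 2 + complex.Im (u n x) ^+ 2); last first.
      by apply/funext => n; rewrite /= cabs_sqr.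
    rewrite cabs_sqr; apply: cvgD; rewrite !expr2; apply: cvgM.
    - exact: ctends_Re (uh x Dx).
    - exact: ctends_Re (uh x Dx).
    - exact: ctends_Im (uh x Dx).
    - exact: ctends_Im (uh x Dx).
  move=> H; apply: le_trans (H _ _) _.
  - move=> n; apply/measurable_EFinP; under eq_fun do rewrite cabs_sqr.
    by have [k1 k2] := mu' n; apply: measurable_funD; apply: measurable_funX.
  - by move=> n x _; rewrite lee_fin sqr_ge0.
  - apply: limn_einf_le => n; have := uB n; rewrite ip_sq -lee_fin fineK//.
    rewrite ge0_fin_numE; first exact: uf.
    by apply: integral_ge0 => x _; rewrite lee_fin sqr_ge0.
have Ff := le_lt_trans F (ltry B).
split; first by apply/(sqintP mu mD).
rewrite ip_sq -lee_fin fineK// ge0_fin_numE//.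
by apply: integral_ge0 => x _; rewrite lee_fin sqr_ge0.
Qed.

End Sequences.

Section HolomorphicLinear.
Variable R : realType.
Implicit Types (f g : pt R -> R[i]) (D : set (pt R)).

Lemma holomorphicD f g z : holomorphic_at f z -> holomorphic_at g z ->
  holomorphic_at (fun x => f x + g x) z.
Proof.
move=> [a [b H1]] [c [d H2]]; exists (a + c), (b + d) => e e0.
have [t1 [t10 Ht1]] := H1 _ (divr_gt0 e0 (ltr0n _ 2)).
have [t2 [t20 Ht2]] := H2 _ (divr_gt0 e0 (ltr0n _ 2)).
exists (Num.min t1 t2); split; first by rewrite lt_min t10.
move=> h1 h2; rewrite lt_min => /andP[/Ht1 k1 /Ht2 k2].
set q := pt_of _ _ in k1 k2 *.
have -> : f q + g q - (f z + g z) - ((a + c) * h1 + (b + d) * h2) =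
  (f q - f z - (a * h1 + b * h2)) + (g q - g z - (c * h1 + d * h2)) by ring.
by apply: le_trans (cabsD _ _) _; move: k1 k2; clear; lra.
Qed.

Lemma holomorphicZ (k : R[i]) f z : holomorphic_at f z -> holomorphic_at (fun x => k * f x) z.
Proof.
move=> [a [b H1]]; exists (k * a), (k * b) => e e0.
have k0 : 0 < cabs k + 1 by rewrite ltr_wpDl ?cabs_ge0.
have [t1 [t10 Ht1]] := H1 _ (divr_gt0 e0 k0).
exists t1; split=> // h1 h2 /Ht1 k1; set q := pt_of _ _ in k1 *; set s := Num.sqrt _ in k1 *.
have -> : k * f q - k * f z - (k * a * h1 + k * b * h2) = k * (f q - f z - (a * h1 + b * h2)) by ring.
rewrite cabsM; apply: (@le_trans _ _ ((cabs k + 1) * (e / (cabs k + 1) * s))).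
  by apply: ler_pM; rewrite ?cabs_ge0// lerDl.
by rewrite mulrA mulrCA divff ?mulr1// gt_eqF.
Qed.

Lemma holomorphic_quadratic f z (a b : R[i]) (r M : R) : 0 < r -> 0 <= M ->
  (forall h1 h2, cabs h1 < r -> cabs h2 < r ->
    cabs (f (pt_of (cz1 z + h1) (cz2 z + h2)) - f z - (a * h1 + b * h2)) <= M * (cabs h1 ^+ 2 + cabs h2 ^+ 2)) ->
  holomorphic_at f z.
Proof.
move=> r0 M0 H; exists a, b => e e0.
have M1 : 0 < M + 1 by rewrite ltr_wpDl.
exists (Num.min r (e / (M + 1))); split; first by rewrite lt_min r0 divr_gt0.
move=> h1 h2; rewrite lt_min => /andP[l1 l2]; have [n1 n2] := cabs_le_norm2 h1 h2.
apply: le_trans (H _ _ (le_lt_trans n1 l1) (le_lt_trans n2 l1)) _.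
set q := Num.sqrt _ in l1 l2 n1 n2 *.
have q0 : 0 <= q := sqrtr_ge0 _.
have -> : cabs h1 ^+ 2 + cabs h2 ^+ 2 = q * q by rewrite -expr2 /q sqr_sqrtr ?addr_ge0 ?sqr_ge0.
rewrite mulrA ler_wpM2r//; apply: (@le_trans _ _ ((M + 1) * q)); first by rewrite ler_wpM2r// lerDl.
by rewrite mulrC -ler_pdivlMr// ltW.
Qed.

End HolomorphicLinear.

(** * The orthogonal projection *)

Section Projection.
Variables (R : realType) (gamma : R) (gamma0 : 0 < gamma) (K : pt R -> pt R -> R[i]).
Local Notation H := (Hgamma gamma).
Local Notation dV := (@dV R).
Local Notation ip := (ip dV H).
Local Notation nrm := (nrm dV H).
Local Notation sqint := (sqint dV H).
Hypothesis HK : is_bergman_kernel H K.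

Definition A2 (f : pt R -> R[i]) := holomorphic_on H f /\ sqint f.

Lemma powR2 (x : R) : 0 <= x -> x `^ 2 = x ^+ 2.
Proof. by move=> x0; rewrite (powR_mulrn 2). Qed.

Lemma Lp2E f : Lp 2 H f <-> sqint f.
Proof.
have mH := measurable_Hgamma gamma.
rewrite /Lp /cmeasurable (sqintP _ mH).
have -> : (\int[dV]_(x in H) (cabs (f x) `^ 2)%:E = \int[dV]_(x in H) (cabs (f x) ^+ 2)%:E)%E.
  by apply: eq_integral => x _; rewrite powR2 ?cabs_ge0.
by [].
Qed.

Lemma Ap2E f : Ap 2 H f <-> A2 f.
Proof. by split=> -[h /Lp2E]. Qed.

Lemma A2D f g : A2 f -> A2 g -> A2 (fun x => f x + g x).
Proof.
have mH := measurable_Hgamma gamma.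
move=> [f1 f2] [g1 g2]; split; last exact: sqintD.
by move=> z Hz; apply: holomorphicD; [exact: f1 | exact: g1].
Qed.

Lemma A2Z (c : R[i]) f : A2 f -> A2 (fun x => c * f x).
Proof.
have mH := measurable_Hgamma gamma.
move=> [f1 f2]; split; last exact: sqintZ.
by move=> z Hz; apply: holomorphicZ; exact: f1.
Qed.

Lemma A2B f g : A2 f -> A2 g -> A2 (fun x => f x - g x).
Proof.
move=> hf /(A2Z (-1)) hg; have := A2D hf hg.
by congr A2; apply/funext => x; rewrite mulN1r.
Qed.

Lemma A2_kernel w : H w -> A2 (K ^~ w).
Proof. by move=> Hw; apply/Ap2E; case: HK => + _; exact. Qed.

Lemma cint_ip f g : cint H (fun z => f z * cconj (g z)) =
  Complex (ip f g) (ip f (fun x => 'i%C * g x)).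
Proof.
rewrite /cint; congr Complex; apply: eq_Rintegral => x _.
  by rewrite ReM /=; ring.
by rewrite !ImM !ReM /=; ring.
Qed.

Lemma reproducing h w : A2 h -> H w ->
  h w = Complex (ip h (K ^~ w)) (ip h (fun x => 'i%C * K x w)).
Proof. by move=> /Ap2E hA Hw; rewrite -cint_ip; case: HK => _; exact. Qed.

Lemma ip_i f g : sqint f -> sqint g ->
  ip (fun x => 'i%C * f x) g = - ip f (fun x => 'i%C * g x).
Proof.
have mH := measurable_Hgamma gamma.
move=> hf hg; rewrite ipMl (ipC _ _ f) (ipC _ _ f) -mulN1r -ipZl//; last exact: sqintZ.
by apply: eq_ip => x _ //; apply: complex_eqP; rewrite ?ReM ?ImM ?ReM ?ImM /=; ring.
Qed.

Lemma nrm_i f : nrm (fun x => 'i%C * f x) = nrm f.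
Proof.
congr Num.sqrt; apply: eq_Rintegral => x _; rewrite ReM ImM /=; ring.
Qed.

(** Reproducing each kernel function at the other point writes both sides as products of the same
    two functions. The symmetry is needed because the operator integrates over the second variable,
    while the kernel is square integrable by hypothesis in the first. *)
Lemma kernel_conj z w : H z -> H w -> K z w = cconj (K w z).
Proof.
move=> Hz Hw; have Az := A2_kernel Hz; have Aw := A2_kernel Hw.
rewrite (reproducing Aw Hz) (reproducing Az Hw) /cconj /=; congr Complex; first exact: ipC.
have [_ sz] := Az; have [_ sw] := Aw.
by rewrite (ipC _ _ (K ^~ z)) (ip_i sw sz) opprK.
Qed.

Lemma bergman_op_ip f z : H z ->
  bergman_op H K f z = Complex (ip f (K ^~ z)) (ip f (fun x => 'i%C * K x z)).
Proof.
move=> Hz; rewrite -cint_ip /bergman_op /cint; congr Complex; apply: eq_Rintegral => w /[!inE] Hw.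
  by rewrite (kernel_conj Hz Hw) mulrC.
by rewrite (kernel_conj Hz Hw) mulrC.
Qed.

(** Evaluation is a pairing with the kernel; the factor 2 comes from treating real and imaginary
    part separately. *)
Lemma A2_pointwise h w : A2 h -> H w -> cabs (h w) <= 2 * nrm (K ^~ w) * nrm h.
Proof.
have mH := measurable_Hgamma gamma.
move=> hA Hw; have [_ hh] := hA; have [_ hK] := A2_kernel Hw.
rewrite (reproducing hA Hw); apply: le_trans (cabs_le_ReIm _) _ => /=.
have h1 := normr_ip_le mH hh hK.
have h2 := normr_ip_le mH hh (sqintZ mH 'i%C hK); rewrite nrm_i in h2.
by rewrite -mulrA mulr_natl mulr2n (mulrC (nrm (K ^~ w))); exact: lerD.
Qed.

(** The closest-point argument: a minimizing sequence is Cauchy in norm, and its pointwise limit is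
    shown to stay in A^2 and to be a norm limit as well. *)
Lemma projection f : sqint f -> exists g, A2 g /\ forall h, A2 h -> ip (fun x => f x - g x) h = 0.
Proof.
have mH := measurable_Hgamma gamma.
move=> hf.
pose V := [set ip (fun x => f x - g x) (fun x => f x - g x) | g in A2].
have A20 : A2 (fun=> 0).
  split; first by move=> z Hz; exists 0, 0 => e e0; exists 1; split=> // h1 h2 _;
    rewrite !mul0r addr0 !subrr cabs0 mulr_ge0 ?sqrtr_ge0 ?ltW.
  have := sqintZ mH 0 (sqint1 gamma0); congr sqint; by apply/funext => x; rewrite mul0r.
have V0 : V !=set0 by exists (ip (fun x => f x - 0) (fun x => f x - 0)); exists (fun=> 0).
have Vinf : has_inf V by split=> //; exists 0 => _ [g _ <-]; exact: ip_ge0.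
pose d := inf V.
have dle g : A2 g -> d <= ip (fun x => f x - g x) (fun x => f x - g x).
  by move=> hg; apply: ge_inf; [case: Vinf | exists g].
pose eps (n : nat) : R := n.+1%:R^-1.
have eps0 n : 0 < eps n by rewrite invr_gt0.
have [gs gsP] : {gs : nat -> pt R -> R[i] & forall n, A2 (gs n) /\
    ip (fun x => f x - gs n x) (fun x => f x - gs n x) <= d + eps n}.
  apply: (@choice _ _ (fun n (g : pt R -> R[i]) => A2 g /\ ip (fun x => f x - g x) (fun x => f x - g x) <= d + eps n)) => n.
  have [_ [g gA <-] lt] := inf_adherent (eps0 n) Vinf.
  by exists g; split=> //; exact: ltW.
have gA n : A2 (gs n) := (gsP n).1.
have gS n : sqint (gs n) := (gA n).2.
have gle n := (gsP n).2.
pose D n m := ip (fun x => gs n x - gs m x) (fun x => gs n x - gs m x).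
have Dle n m : D n m <= 2 * eps n + 2 * eps m.
  (* Parallelogram law: the midpoint also has squared distance at least d from f, so two
     near-minimizers must be close. *)
  have hm : A2 (fun x => ((1 / 2 : R)%:C)%C * (gs n x + gs m x)) by apply: A2Z; exact: A2D.
  have := dle _ hm; rewrite /D !ip_sub//; last by case: hm.
  have gnm := sqintD mH (gS n) (gS m).
  have gnm' := sqintZ mH ((1 / 2 : R)%:C)%C gnm.
  rewrite ipZr// ipZr// ipZl// ip_add// ipDr//.
  have := gle n; have := gle m; rewrite !ip_sub//.
  by clear; lra.
have eps_mono n m : (n <= m)%N -> eps m <= eps n.
  by move=> nm; rewrite lef_pV2 ?posrE// ler_nat.
have eps_small e : 0 < e -> exists N, forall n, (N <= n)%N -> eps n <= e.
  move=> e0; exists (Num.truncn e^-1) => n Nn; apply: le_trans (eps_mono _ _ Nn) _.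
  rewrite -[leRHS]invrK lef_pV2 ?posrE ?invr_gt0//.
  by apply/ltW/truncnS_gt; rewrite invr_ge0 ltW.
have nrmD e : 0 < e -> exists N, forall n m, (N <= n)%N -> (N <= m)%N -> nrm (fun x => gs n x - gs m x) <= e.
  move=> e0; have [N HN] := eps_small (e ^+ 2 / 4) (divr_gt0 (exprn_gt0 2 e0) (ltr0n _ 4)).
  exists N => n m /HN h1 /HN h2; rewrite -(@ler_pXn2r _ 2) ?nnegrE ?nrm_ge0 ?(ltW e0)// nrm_sqr.
  apply: le_trans (Dle n m) _; move: h1 h2; clear; lra.
have lim_ex w : exists l, H w -> ctends (gs ^~ w) l.
  have [Hw|nHw] := pselect (H w); last by exists 0.
  have [l hl] : exists l, ctends (gs ^~ w) l; last by exists l.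
  apply: complex_cauchy_limit => e e0.
  have C0 : 0 < 2 * nrm (K ^~ w) + 1 by rewrite ltr_wpDl// mulr_ge0// nrm_ge0.
  have [N HN] := nrmD _ (divr_gt0 e0 C0); exists N => n m Nn Nm.
  apply: le_trans (A2_pointwise (A2B (gA n) (gA m)) Hw) _.
  apply: (@le_trans _ _ ((2 * nrm (K ^~ w) + 1) * (e / (2 * nrm (K ^~ w) + 1)))).
    by apply: ler_pM; rewrite ?nrm_ge0 ?mulr_ge0 ?nrm_ge0// ?lerDl//; exact: HN.
  by rewrite mulrCA divff ?mulr1// gt_eqF.
have [g gl] : {g : pt R -> R[i] & forall w, H w -> ctends (gs ^~ w) (g w)}.
  exact: (@choice _ _ (fun w l => H w -> ctends (gs ^~ w) l)).
(* Fatou in the second index. Shifting that index to n + m makes [4 * eps n] a bound uniform in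
   m. *)
have fat n : sqint (fun x => gs n x - g x) /\ ip (fun x => gs n x - g x) (fun x => gs n x - g x) <= 4 * eps n.
  apply: (@sqint_fatou _ _ _ dV H mH (fun m x => gs n x - gs (n + m)%N x)).
  - by move=> m; exact: sqintB.
  - move=> m; apply: le_trans (Dle n _) _; have := eps_mono _ _ (leq_addr m n); clear; lra.
  - move=> x Hx e /(gl x Hx)[N HN]; exists N => m Nm.
    rewrite (_ : _ - _ = - (gs (n + m)%N x - g x)); last by ring.
    by rewrite cabsN; apply: HN; exact: leq_trans Nm (leq_addl _ _).
have gsq : sqint g.
  have := sqintB mH (gS 0%N) (fat 0%N).1; congr sqint; apply/funext => x; ring.
have nrm_bd : exists B, 0 <= B /\ forall n, nrm (gs n) <= B.
  exists (nrm f + Num.sqrt (d + 1)); split; first by rewrite addr_ge0 ?nrm_ge0 ?sqrtr_ge0.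
  move=> n; have fg := sqintB mH hf (gS n).
  have -> : gs n = fun x => f x + (-1) * (f x - gs n x) by apply/funext => x; ring.
  apply: le_trans (nrm_triangle mH hf (sqintZ mH (-1) fg)) _; rewrite lerD2l.
  have -> : nrm (fun x => -1 * (f x - gs n x)) = nrm (fun x => f x - gs n x).
    by congr Num.sqrt; apply: eq_Rintegral => x _; rewrite mulN1r ReN ImN; ring.
  apply: ler_wsqrtr; apply: le_trans (gle n) _; rewrite lerD2l.
  by rewrite invf_le1// ler1n.
have [B [B0 HB]] := nrm_bd.
have ghol : holomorphic_on H g.
  move=> z Hz.
  have [r1 [r10 near]] := Hgamma_open gamma0 Hz.
  have [r2 [M [r20 [M0 HM]]]] := Hgamma_quadratic_taylor gamma0 Hz.
  pose r := Num.min r1 r2.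
  have r0 : 0 < r by rewrite lt_min r10.
  have MB0 : 0 <= M * B by rewrite mulr_ge0.
  have [ab abP] : {ab : nat -> R[i] * R[i] & forall n h1 h2, cabs h1 < r -> cabs h2 < r ->
     cabs (gs n (pt_of (cz1 z + h1) (cz2 z + h2)) - gs n z - ((ab n).1 * h1 + (ab n).2 * h2)) <= M * B * (cabs h1 ^+ 2 + cabs h2 ^+ 2)}.
    apply: (@choice _ _ (fun n (ab : R[i] * R[i]) => forall h1 h2, cabs h1 < r -> cabs h2 < r ->
     cabs (gs n (pt_of (cz1 z + h1) (cz2 z + h2)) - gs n z - (ab.1 * h1 + ab.2 * h2)) <= M * B * (cabs h1 ^+ 2 + cabs h2 ^+ 2))) => n.
    have [a [b Hab]] := HM _ (gA n).1 (gA n).2; exists (a, b) => h1 h2; rewrite !lt_min => /andP[_ l1] /andP[_ l2].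
    apply: le_trans (Hab _ _ l1 l2) _; rewrite ler_wpM2r ?addr_ge0 ?sqr_ge0//.
    by rewrite ler_wpM2l.
  have inH h1 h2 : cabs h1 < r -> cabs h2 < r -> H (pt_of (cz1 z + h1) (cz2 z + h2)).
    by rewrite !lt_min => /andP[l1 _] /andP[l2 _]; exact: near.
  (* Up to an error M B t, uniform in n, the coefficient is the difference quotient over a fixed
     step t. Pointwise convergence at its two end points then makes the coefficients a Cauchy
     sequence. *)
  have slope (c : nat -> R[i]) (u : R[i] -> R[i] * R[i]) :
      (forall n (t : R), 0 < t -> t < r -> cabs (u (t%:C)%C).1 < r /\ cabs (u (t%:C)%C).2 < r /\
        cabs (gs n (pt_of (cz1 z + (u (t%:C)%C).1) (cz2 z + (u (t%:C)%C).2)) - gs n z - c n * (t%:C)%C) <= M * B * t ^+ 2) ->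
      exists l, ctends c l.
    move=> Hc; apply: complex_cauchy_limit => e e0.
    have MB1 : 0 < 4 * (M * B + 1) by rewrite mulr_gt0// ltr_wpDl.
    pose t := Num.min (r / 2) (e / (4 * (M * B + 1))).
    have t0 : 0 < t by rewrite lt_min !divr_gt0.
    have tr : t < r by rewrite gt_min ltr_pdivrMr// ltr_pMr// ltr1n.
    have te : t * (4 * (M * B + 1)) <= e by rewrite -ler_pdivlMr// ge_min lexx orbT.
    have [k1 [k2 _]] := Hc 0%N t t0 tr.
    set q := pt_of (cz1 z + (u (t%:C)%C).1) (cz2 z + (u (t%:C)%C).2).
    have et : 0 < e * t / 8 by rewrite divr_gt0// mulr_gt0.
    have [N1 HN1] := gl _ (inH _ _ k1 k2) _ et; have [N2 HN2] := gl _ Hz _ et.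
    exists (maxn N1 N2) => n m; rewrite !geq_max => /andP[n1 n2] /andP[m1 m2].
    have [_ [_ kn]] := Hc n t t0 tr; have [_ [_ km]] := Hc m t t0 tr.
    have qn := HN1 _ n1; have zn := HN2 _ n2; have qm := HN1 _ m1; have zm := HN2 _ m2.
    rewrite -/q in kn km qn qm.
    rewrite -(ler_pM2r t0).
    have -> : cabs (c n - c m) * t = cabs ((c n - c m) * (t%:C)%C).
      by rewrite cabsM cabs_real gtr0_norm.
    have -> : (c n - c m) * (t%:C)%C = (gs m q - gs m z - c m * (t%:C)%C) - (gs n q - gs n z - c n * (t%:C)%C)
       + ((gs n q - g q) - (gs m q - g q)) - ((gs n z - g z) - (gs m z - g z)) by ring.
    have T1 := cabsB (gs m q - gs m z - c m * (t%:C)%C - (gs n q - gs n z - c n * (t%:C)%C) + ((gs n q - g q) - (gs m q - g q))) ((gs n z - g z) - (gs m z - g z)).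
    have T2 := cabsD (gs m q - gs m z - c m * (t%:C)%C - (gs n q - gs n z - c n * (t%:C)%C)) ((gs n q - g q) - (gs m q - g q)).
    have T3 := cabsB (gs m q - gs m z - c m * (t%:C)%C) (gs n q - gs n z - c n * (t%:C)%C).
    have T4 := cabsB (gs n q - g q) (gs m q - g q).
    have T5 := cabsB (gs n z - g z) (gs m z - g z).
    have Q : M * B * t ^+ 2 <= e * t / 4.
      have : t * (t * (4 * (M * B + 1))) <= t * e by rewrite ler_pM2l.
      have := sqr_ge0 t; move: (M * B) (t) (e) => x y v; rewrite !expr2; clear; lra.
    move: T1 T2 T3 T4 T5 Q kn km qn zn qm zm; clear; lra.
  have [a Ha] : exists l, ctends (fun n => (ab n).1) l.
    apply: (slope _ (fun t => (t, 0))) => n t t0 tr /=.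
    have ct : cabs (t%:C)%C = t by rewrite cabs_real gtr0_norm.
    rewrite ct cabs0; split=> //; split=> //.
    by have := abP n (t%:C)%C 0; rewrite ct cabs0 mulr0 expr0n !addr0 => X; exact: (X tr r0).
  have [b Hb] : exists l, ctends (fun n => (ab n).2) l.
    apply: (slope _ (fun t => (0, t))) => n t t0 tr /=.
    have ct : cabs (t%:C)%C = t by rewrite cabs_real gtr0_norm.
    rewrite ct cabs0; split=> //; split=> //.
    by have := abP n 0 (t%:C)%C; rewrite ct cabs0 mulr0 expr0n !addr0 !add0r => X; exact: (X r0 tr).
  apply: (@holomorphic_quadratic R g z a b r (M * B) r0 MB0) => h1 h2 l1 l2.
  apply/ler_addgt0Pr => e e0.
  have S0 : 0 < cabs h1 + cabs h2 + 2 by rewrite ltr_wpDl// addr_ge0 ?cabs_ge0.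
  have e1 := divr_gt0 e0 S0; set e' := e / _ in e1.
  set q := pt_of _ _.
  have [N1 HN1] := gl _ (inH _ _ l1 l2) _ e1; have [N2 HN2] := gl _ Hz _ e1.
  have [N3 HN3] := Ha _ e1; have [N4 HN4] := Hb _ e1.
  pose n := maxn (maxn N1 N2) (maxn N3 N4).
  have k1 := HN1 n (leq_trans (leq_maxl _ _) (leq_maxl _ _)).
  have k2 := HN2 n (leq_trans (leq_maxr _ _) (leq_maxl _ _)).
  have k3 := HN3 n (leq_trans (leq_maxl _ _) (leq_maxr _ _)).
  have k4 := HN4 n (leq_trans (leq_maxr _ _) (leq_maxr _ _)).
  have k5 := abP n h1 h2 l1 l2; rewrite -/q in k1 k5.
  have -> : g q - g z - (a * h1 + b * h2) = (gs n q - gs n z - ((ab n).1 * h1 + (ab n).2 * h2))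
    + (((gs n z - g z) - (gs n q - g q)) + (((ab n).1 - a) * h1 + ((ab n).2 - b) * h2)) by ring.
  apply: le_trans (cabsD _ _) _; apply: lerD => //.
  apply: le_trans (cabsD _ _) _; apply: le_trans (lerD (cabsB _ _) (cabsD _ _)) _; rewrite !cabsM.
  have -> : e = (e' + e') + (e' * cabs h1 + e' * cabs h2) by rewrite /e'; field; rewrite gt_eqF.
  by apply: lerD; apply: lerD => //; rewrite ler_wpM2r ?cabs_ge0.
exists g; split=> // h hA; have [_ hh] := hA.
set x := ip _ h; set P := ip h h.
have P0 : 0 <= P := ip_ge0 _ _ _.
have P1 : 0 < P + 1 by rewrite ltr_wpDl.
have bound n : x ^+ 2 <= (2 * (P + 1) + 8 * P) * eps n.
  pose xn := ip (fun x => f x - gs n x) h.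
  have fg := sqintB mH hf (gS n).
  (* Moving [gs n] along h cannot bring the squared distance below d, and it was at most d + eps n.
     The step is close to the optimal xn / P; the added 1 keeps the denominator positive. *)
  have X1 : xn ^+ 2 <= (P + 1) * eps n.
    pose t := xn / (P + 1).
    have th := sqintZ mH (t%:C)%C hh.
    have := dle _ (A2D (gA n) (A2Z (t%:C)%C hA)).
    have -> : (fun x => f x - (gs n x + (t%:C)%C * h x)) = (fun x => (f x - gs n x) - (t%:C)%C * h x).
      by apply/funext => y; ring.
    rewrite ip_sub// ipZr// ipZr// ipZl// -/xn -/P => le.
    have le2 : 2 * (t * xn) - t * (t * P) <= eps n by move: (gle n) le; clear; lra.
    have E1 : t * xn = xn ^+ 2 / (P + 1) by rewrite /t expr2 mulrAC.
    have E2 : t * (t * P) <= xn ^+ 2 / (P + 1).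
      have -> : t * (t * P) = xn ^+ 2 / (P + 1) * (P / (P + 1)) by rewrite /t; field; rewrite gt_eqF.
      by rewrite ler_piMr ?divr_ge0 ?sqr_ge0 ?ltW// ltr_pdivrMr// mul1r ltrDl.
    by rewrite mulrC -ler_pdivrMr// -E1; move: le2 E2; rewrite -E1; clear; lra.
  have [gnS gn4] := fat n.
  have X2 : x = xn + ip (fun x => gs n x - g x) h.
    by rewrite /x /xn -ipDl//; apply: eq_ip => y _ //; ring.
  have X3 : ip (fun x => gs n x - g x) h ^+ 2 <= 4 * eps n * P.
    by apply: le_trans (ip_cauchy_schwarz mH gnS hh) _; rewrite ler_wpM2r.
  rewrite X2; move: X1 X3; set y := ip _ h => X1 X3.
  by have := sqr_ge0 (xn - y); rewrite sqrrB sqrrD; move: X1 X3; clear; lra.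
apply/eqP; rewrite -sqrf_eq0 eq_le sqr_ge0 andbT; apply/ler_addgt0Pr => e e0; rewrite add0r.
have C0 : 0 < 2 * (P + 1) + 8 * P by rewrite ltr_wpDr ?mulr_ge0// mulr_gt0.
have [N HN] := eps_small _ (divr_gt0 e0 C0).
apply: le_trans (bound N) _; rewrite mulrC -ler_pdivlMr//; exact: HN.
Qed.

End Projection.

(** * The Bergman operator on L^2 *)

Section BergmanL2.
Variables (R : realType) (gamma : R) (gamma0 : 0 < gamma) (K : pt R -> pt R -> R[i]).
Local Notation H := (Hgamma gamma).
Local Notation dV := (@dV R).
Local Notation ip := (ip dV H).
Local Notation nrm := (nrm dV H).
Local Notation sqint := (sqint dV H).
Local Notation A2 := (A2 gamma).
Hypothesis HK : is_bergman_kernel H K.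

Definition is_proj (f g : pt R -> R[i]) := A2 g /\ forall h, A2 h -> ip (fun x => f x - g x) h = 0.

Lemma eq_sqint f g : (forall z, H z -> f z = g z) -> sqint f -> sqint g.
Proof.
have mH := measurable_Hgamma gamma.
move=> fg /(sqintP _ mH)[[m1 m2] fi]; apply/(sqintP _ mH); split; first split.
- by apply: eq_measurable_fun m1 => x /[!inE] Hx /=; rewrite fg.
- by apply: eq_measurable_fun m2 => x /[!inE] Hx /=; rewrite fg.
- by apply: le_lt_trans fi; rewrite le_eqVlt; apply/orP; left; apply/eqP;
    apply: eq_integral => x /[!inE] Hx; rewrite fg.
Qed.

Lemma eq_holomorphic_on f g : (forall z, H z -> f z = g z) -> holomorphic_on H f -> holomorphic_on H g.
Proof.
move=> fg hf z Hz; have [a [b Hab]] := hf z Hz; exists a, b => e e0.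
have [t [t0 Ht]] := Hab e e0; have [r [r0 Hr]] := Hgamma_open gamma0 Hz.
exists (Num.min t r); split; first by rewrite lt_min t0.
move=> h1 h2; rewrite lt_min => /andP[lt1 lt2]; have [n1 n2] := cabs_le_norm2 h1 h2.
rewrite -!fg//; first exact: Ht.
by apply: Hr; [exact: le_lt_trans n1 lt2 | exact: le_lt_trans n2 lt2].
Qed.

Lemma eq_A2 f g : (forall z, H z -> f z = g z) -> A2 f -> A2 g.
Proof. by move=> fg [h s]; split; [exact: eq_holomorphic_on h | exact: eq_sqint s]. Qed.

(** By Hermitian symmetry the operator pairs f with kernel functions. These belong to A^2, so f may
    be replaced by g, which the kernel reproduces. *)
Lemma bergman_op_proj f g z : sqint f -> is_proj f g -> H z -> bergman_op H K f z = g z.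
Proof.
move=> sf [gA orth] Hz; rewrite (bergman_op_ip HK)// (reproducing HK gA Hz).
have KA := A2_kernel HK Hz; have sg := gA.2.
have E h : A2 h -> ip f h = ip g h.
  by move=> hA; apply/eqP; rewrite -subr_eq0 -ipBl ?orth//; [exact: measurable_Hgamma | exact: hA.2].
by rewrite !E//; exact: A2Z.
Qed.

Lemma bergman_op_is_proj f : sqint f -> is_proj f (bergman_op H K f).
Proof.
move=> sf; have [g gP] := projection gamma0 HK sf.
have E z : H z -> g z = bergman_op H K f z by move=> Hz; rewrite (bergman_op_proj sf gP Hz).
have [gA orth] := gP.
split; first exact: eq_A2 gA.
by move=> h /orth <-; apply: eq_ip => // x Hx; rewrite E.
Qed.

Lemma is_proj_unique f g g' z : sqint f -> is_proj f g -> is_proj f g' -> H z -> g z = g' z.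
Proof. by move=> sf h h' Hz; rewrite -(bergman_op_proj sf h Hz) (bergman_op_proj sf h' Hz). Qed.

Lemma cintegrable_kernel f z : sqint f -> H z -> cintegrable H (fun w => K z w * f w).
Proof.
have mH := measurable_Hgamma gamma.
move=> sf Hz; have sK := (A2_kernel HK Hz).2; split.
- apply: (@eq_integrable _ _ _ _ _ mH _ _ _ (ip_integrable mH sf sK)) => w /[!inE] Hw /=.
  by rewrite (kernel_conj HK Hz Hw) ReM /=; congr EFin; ring.
- apply: (@eq_integrable _ _ _ _ _ mH _ _ _ (ip_integrable mH sf (sqintZ mH 'i%C sK))) => w /[!inE] Hw /=.
  by rewrite (kernel_conj HK Hz Hw) !ImM !ReM /=; congr EFin; ring.
Qed.

Lemma Lpnorm2E f : Lpnorm 2 H f = nrm f.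
Proof.
rewrite /Lpnorm powR12_sqrt; last by apply: fine_ge0; apply: integral_ge0 => x _; rewrite lee_fin powR_ge0.
congr Num.sqrt; rewrite ip_sq; congr fine; apply: eq_integral => x _.
by rewrite powR2 ?cabs_ge0.
Qed.

Lemma bergman_bounded_L2 : bergman_bounded_Lp 2 H K.
Proof.
have mH := measurable_Hgamma gamma.
exists 1 => f /Lp2E sf; split; first by move=> z; exact: cintegrable_kernel.
have [gA orth] := bergman_op_is_proj sf; split; first exact/Ap2E.
rewrite !Lpnorm2E mul1r ler_wsqrtr//; set g := bergman_op H K f in gA orth *.
(* Testing the orthogonality against g itself gives Pythagoras, hence the contraction. *)
have sg := gA.2; have := orth _ gA; rewrite ipBl// => fg.
by have := ip_ge0 dV H (fun x => f x - g x); rewrite ip_sub//; move: fg; clear; lra.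
Qed.

End BergmanL2.

(** * Commutation with the torus action *)

Section TorusAction.
Variables (R : realType) (gamma : R) (gamma0 : 0 < gamma) (K : pt R -> pt R -> R[i]).
Local Notation H := (Hgamma gamma).
Local Notation dV := (@dV R).
Local Notation ip := (ip dV H).
Local Notation sqint := (sqint dV H).
Local Notation A2 := (A2 gamma).

Section Rotation.
Variables (u v : R[i]) (u1 : cabs u = 1) (v1 : cabs v = 1).
Local Notation T := (torus_rot u v).

Lemma restrict_torus (V : Type) (F : pt R -> V) (c : V) : patch (fun=> c) H F \o T = patch (fun=> c) H (F \o T).
Proof.
apply/funext => x; rewrite /= /patch; case: (pselect (H x)) => Hx.
  by rewrite !mem_set//; exact: (Hgamma_torus gamma x u1 v1).2.
by rewrite !memNset// => /(Hgamma_torus gamma x u1 v1).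
Qed.

Lemma torus_Rintegral (F : pt R -> R) : dV.-integrable H (EFin \o F) ->
  \int[dV]_(x in H) F (T x) = \int[dV]_(x in H) F x.
Proof.
have mH := measurable_Hgamma gamma.
move=> /(integrable_mkcond _ mH); rewrite restrict_EFin => Fi.
rewrite [LHS]Rintegral_mkcond [RHS]Rintegral_mkcond -(mpres_Rintegral (mpres_torus_rot u1 v1) Fi).
by apply: eq_Rintegral => x _; exact: (esym (congr1 (fun G => G x) (restrict_torus F 0))).
Qed.

Lemma torus_integrable (F : pt R -> \bar R) : dV.-integrable H F -> dV.-integrable H (F \o T).
Proof.
have mH := measurable_Hgamma gamma.
move=> /(integrable_mkcond _ mH) Fi; apply/(integrable_mkcond _ mH).
have := mpres_integrable (mpres_torus_rot u1 v1) Fi.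
by rewrite (restrict_torus F 0%E).
Qed.

Lemma torus_measurable (F : pt R -> R) : measurable_fun H F -> measurable_fun H (F \o T).
Proof.
have mH := measurable_Hgamma gamma.
move=> /(measurable_restrictT _ mH) mF; apply/(measurable_restrictT _ mH).
rewrite -(restrict_torus F 0); apply: measurableT_comp => //.
by case: (mpres_torus_rot u1 v1).
Qed.

Lemma torus_sqint f : sqint f -> sqint (f \o T).
Proof.
move=> [[m1 i1] [m2 i2]]; split; split.
- exact: torus_measurable m1.
- exact: torus_integrable i1.
- exact: torus_measurable m2.
- exact: torus_integrable i2.
Qed.

Lemma torus_ip f g : sqint f -> sqint g -> ip (f \o T) (g \o T) = ip f g.
Proof.
move=> sf sg; apply: (@torus_Rintegral (fun x => complex.Re (f x) * complex.Re (g x) + complex.Im (f x) * complex.Im (g x))).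
exact: (ip_integrable (measurable_Hgamma gamma) sf sg).
Qed.

Lemma torus_A2 f : A2 f -> A2 (f \o T).
Proof.
move=> [hf sf]; split; last exact: torus_sqint.
move=> z Hz; have [|a [b Hab]] := hf (T z); first exact: (Hgamma_torus gamma z u1 v1).2.
exists (a * u), (b * v) => e /Hab[t [t0 Ht]]; exists t; split=> // h1 h2.
have := Ht (u * h1) (v * h2); rewrite !cabsM u1 v1 !mul1r /= => X /X.
by rewrite /torus_rot !cz1_pt_of !cz2_pt_of !mulrDr !mulrA.
Qed.

End Rotation.

Lemma torus_rotK u v : cabs u = 1 -> cabs v = 1 -> cancel (@torus_rot R u v) (torus_rot u^-1 v^-1).
Proof.
move=> u1 v1 p; rewrite /torus_rot cz1_pt_of cz2_pt_of !mulKf ?pt_of_cz// -cabs_gt0 ?u1 ?v1//.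
Qed.

Hypothesis HK : is_bergman_kernel H K.

(** The rotated projection and c times the projection are both projections of c f, because rotations
    preserve A^2 and the inner product; uniqueness identifies them. *)
Lemma bergman_op_weight f u v c z : cabs u = 1 -> cabs v = 1 -> sqint f ->
  (forall w, H w -> f (torus_rot u v w) = c * f w) -> H z ->
  bergman_op H K f (torus_rot u v z) = c * bergman_op H K f z.
Proof.
have mH := measurable_Hgamma gamma.
move=> u1 v1 sf fc Hz; have [gA orth] := bergman_op_is_proj gamma0 HK sf.
set g := bergman_op H K f in gA orth *.
have ui1 : cabs u^-1 = 1 by rewrite cabsV u1 invr1.
have vi1 : cabs v^-1 = 1 by rewrite cabsV v1 invr1.
have sg := gA.2; have scf := sqintZ mH c sf.
have P1 : is_proj gamma (fun x => c * f x) (g \o torus_rot u v).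
  split; first exact: (@torus_A2 u v u1 v1 g).
  move=> h hA; have hA' := torus_A2 ui1 vi1 hA.
  rewrite -(orth _ hA') -(@torus_ip u v u1 v1 _ _ (sqintB mH sf sg) hA'.2).
  by apply: eq_ip => x Hx; [rewrite /= fc | rewrite /= torus_rotK].
have P2 : is_proj gamma (fun x => c * f x) (fun x => c * g x).
  split; first exact: A2Z.
  move=> h hA; rewrite -(orth _ (A2Z (cconj c) hA)) -ipMl.
  by apply: eq_ip => x Hx //; rewrite mulrBr.
exact: (@is_proj_unique R gamma K HK (fun x => c * f x) (g \o torus_rot u v) (fun x => c * g x) z scf P1 P2 Hz).
Qed.

End TorusAction.

(** * Monomials and their integrals *)

Section WeightVectors.
Variables (R : realType) (gamma : R) (gamma0 : 0 < gamma).
Local Notation H := (Hgamma gamma).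

Definition mono (a m : nat) (z : pt R) : R[i] := cz1 z ^+ a * (cz2 z)^-1 ^+ m.

Lemma cdiff_affine (x al s : R[i]) : cdiff (fun s => x + al * s) s al.
Proof.
move=> e e0; exists 1; split=> // h _.
have -> : x + al * (s + h) - (x + al * s) - al * h = 0 by ring.
by rewrite cabs0 mulr_ge0 ?cabs_ge0// ltW.
Qed.

(** A complex derivative can be computed along imaginary increments, and there the function does not
    change. *)
Lemma cdiff_imag_invariant (F : R[i] -> R[i]) s d : cdiff F s d ->
  (forall t : R, F (s + Complex 0 t) = F s) -> d = 0.
Proof.
move=> Fd Finv; apply/eqP; rewrite -[_ == _]negbK -cabs_gt0; apply/negP => d0.
have [t [t0 Ht]] := Fd _ (divr_gt0 d0 (ltr0n _ 2)).
have t2 : 0 < t / 2 by rewrite divr_gt0.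
have ct : cabs (Complex 0 (t / 2) : R[i]) = t / 2.
  by rewrite /cabs /= expr0n add0r sqrtr_sqr gtr0_norm.
have := Ht (Complex 0 (t / 2)); rewrite ct Finv subrr sub0r cabsN cabsM ct.
rewrite ltr_pdivrMr// ltr_pMr// ltr1n => /(_ isT); rewrite ler_pM2r// => le.
by move: le d0; clear; lra.
Qed.

Lemma cdiff0_const (F : R[i] -> R[i]) : (forall t : R, 0 <= t <= 1 -> cdiff F (t%:C)%C 0) -> F 1 = F 0.
Proof.
move=> F0.
have key (j : R[i] -> R) : (forall x y, j (x - y) = j x - j y) -> (forall x, `|j x| <= cabs x) -> j (F 1) = j (F 0).
  move=> jB jle.
  have [|c _] := @MVT_cc R (fun t => j (F (t%:C)%C)) (fun=> 0) 0 1 ler01.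
    move=> x /F0 Fx; apply/is_derive_epsP => e /Fx[t [t0 Ht]]; exists t; split=> // h ht.
    have := Ht (h%:C)%C; rewrite cabs_real => /(_ ht).
    by rewrite !mul0r !subr0 -jB -rmorphD; apply: le_trans; exact: jle.
  by rewrite mul0r => /eqP; rewrite subr_eq0 => /eqP.
apply: complex_eqP; apply: key; [exact: ReB | exact: ler_normr_cabs_Re | exact: ImB | exact: ler_normr_cabs_Im].
Qed.

(** In logarithmic coordinates the domain is given by linear inequalities on the real parts. It is
    therefore convex, which keeps the segments of [weight_segment] inside. *)
Lemma Hgamma_exp (z1 z2 : R[i]) : gamma * complex.Re z1 < complex.Re z2 -> complex.Re z2 < 0 ->
  H (pt_of (cexp z1) (cexp z2)).
Proof.
move=> h1 h2; rewrite /Hgamma /= cz1_pt_of cz2_pt_of !cabs_cexp -expR0 !ltr_expR h2 andbT.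
by rewrite -expRM ltr_expR mulrC.
Qed.

Lemma weight_rearrange (A : comNzRingType) (G ci c k ki u v : A) :
  u * v * G * (ci * c) * (k * ki) = G * (ci * k) * (u * c * (v * ki)).
Proof. ring. Qed.

(** The quotient of [g] by the monomial of the same weight is torus invariant; this is its
    invariance under imaginary translations of the logarithms. *)
Lemma weight_twist g (a m : nat) (u v c1 c2 : R[i]) :
  (forall u v z, cabs u = 1 -> cabs v = 1 -> H z -> g (torus_rot u v z) = u ^+ a * v^-1 ^+ m * g z) ->
  cabs u = 1 -> cabs v = 1 -> c1 != 0 -> c2 != 0 -> H (pt_of c1 c2) ->
  g (pt_of (c1 * u) (c2 * v)) * ((c1 * u)^-1 ^+ a * (c2 * v) ^+ m) =
  g (pt_of c1 c2) * (c1^-1 ^+ a * c2 ^+ m).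
Proof.
move=> ginv u1 v1 c10 c20 Hc.
have := ginv u v _ u1 v1 Hc; rewrite /torus_rot cz1_pt_of cz2_pt_of (mulrC u) (mulrC v) => ->.
have u0 : u != 0 by rewrite -cabs_gt0 u1.
have v0 : v != 0 by rewrite -cabs_gt0 v1.
have U : u ^+ a * u^-1 ^+ a = 1 by rewrite -exprMn divff// expr1n.
have V : v ^+ m * v^-1 ^+ m = 1 by rewrite -exprMn divff// expr1n.
rewrite invfM !exprMn; move: (g _) => G.
transitivity (G * (c1^-1 ^+ a * c2 ^+ m) * (u ^+ a * u^-1 ^+ a) * (v ^+ m * v^-1 ^+ m)); last by rewrite U V !mulr1.
move: (c1^-1 ^+ a) (u ^+ a) (u^-1 ^+ a) (v ^+ m) (v^-1 ^+ m) (c2 ^+ m); clear; move=> *; ring.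
Qed.

(* In logarithmic coordinates the quotient of [g] by the monomial is holomorphic and invariant
   under imaginary translations, so its complex derivative along a real segment vanishes. *)
Lemma weight_segment g (a m : nat) (x y x' y' : R) : holomorphic_on H g ->
  (forall u v z, cabs u = 1 -> cabs v = 1 -> H z -> g (torus_rot u v z) = u ^+ a * v^-1 ^+ m * g z) ->
  gamma * x < y -> y < 0 -> gamma * x' < y' -> y' < 0 ->
  g (pt_of (cexp (x%:C)%C) (cexp (y%:C)%C)) * ((cexp (x%:C)%C)^-1 ^+ a * cexp (y%:C)%C ^+ m) =
  g (pt_of (cexp (x'%:C)%C) (cexp (y'%:C)%C)) * ((cexp (x'%:C)%C)^-1 ^+ a * cexp (y'%:C)%C ^+ m).
Proof.
move=> ghol ginv h1 h2 h1' h2'.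
pose al := ((x' - x)%:C)%C; pose be := ((y' - y)%:C)%C.
pose A s := (x%:C)%C + al * s; pose B s := (y%:C)%C + be * s.
pose F s := g (pt_of (cexp (A s)) (cexp (B s))) * ((cexp (A s))^-1 ^+ a * cexp (B s) ^+ m).
have F0 : F 0 = g (pt_of (cexp (x%:C)%C) (cexp (y%:C)%C)) * ((cexp (x%:C)%C)^-1 ^+ a * cexp (y%:C)%C ^+ m).
  by rewrite /F /A /B !mulr0 !addr0.
have F1 : F 1 = g (pt_of (cexp (x'%:C)%C) (cexp (y'%:C)%C)) * ((cexp (x'%:C)%C)^-1 ^+ a * cexp (y'%:C)%C ^+ m).
  have Ex : (x%:C)%C + al = (x'%:C)%C by rewrite /al -rmorphD addrC subrK.
  have Ey : (y%:C)%C + be = (y'%:C)%C by rewrite /be -rmorphD addrC subrK.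
  have A1 : A 1 = (x'%:C)%C by rewrite /A mulr1.
  have B1 : B 1 = (y'%:C)%C by rewrite /B mulr1.
  rewrite /F A1 B1; reflexivity.
suff F10 : F 1 = F 0.
  rewrite F0 F1 in F10; exact (esym F10).
apply: cdiff0_const => t t01; set s := (t%:C)%C.
have HAB : H (pt_of (cexp (A s)) (cexp (B s))).
  have cvx (p q : R) : p < 0 -> q < 0 -> p + (q - p) * t < 0.
    move: t01 => /andP[t0 t1] p0 q0; have [->|tn] := eqVneq t 0; first by rewrite mulr0 addr0.
    have {t0 tn} t0 : 0 < t by rewrite lt_neqAle eq_sym tn.
    have : t * q < 0 by rewrite pmulr_rlt0.
    have : (1 - t) * p <= 0 by rewrite mulr_ge0_le0 ?subr_ge0 ?(ltW p0).
    by clear; lra.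
  apply: Hgamma_exp; rewrite /A /B ?ReD ?ReM /= ?mul0r ?subr0; last exact: cvx.
  have := cvx (gamma * x - y) (gamma * x' - y'); rewrite !subr_lt0 => /(_ h1 h1') C.
  by rewrite -subr_lt0; move: C; congr (_ < _); ring.
have [d Fd] : exists d, cdiff F s d.
  have dA : cdiff A s al := cdiff_affine _ _ _.
  have dB : cdiff B s be := cdiff_affine _ _ _.
  have eA := cdiff_comp dA (cdiff_cexp (A s)).
  have eB := cdiff_comp dB (cdiff_cexp (B s)).
  have eNA := cdiff_comp eA (cdiffV (cexp_neq0 (A s))).
  have [d1 D1] := @holomorphic_cdiff_comp R g (@cexp R \o A) (@cexp R \o B) s _ _ (ghol _ HAB) eA eB.
  have [d2 D2] := cdiffX a (cexp (A s))^-1; have D2' := cdiff_comp eNA D2.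
  have [d3 D3] := cdiffX m (cexp (B s)); have D3' := cdiff_comp eB D3.
  by eexists; exact: (cdiffM D1 (cdiffM D2' D3')).
have d0 : d = 0.
  apply: (cdiff_imag_invariant Fd) => r.
  have E (al' : R) : cabs (cexp (al'%:C%C * Complex 0 r)) = 1.
    by rewrite cabs_cexp ReM /= mulr0 mul0r subr0 expR0.
  have EA : A (s + Complex 0 r) = A s + al * Complex 0 r by rewrite /A; ring.
  have EB : B (s + Complex 0 r) = B s + be * Complex 0 r by rewrite /B; ring.
  rewrite /F EA EB (cexpD (A s)) (cexpD (B s)).
  exact: weight_twist ginv (E _) (E _) (cexp_neq0 _) (cexp_neq0 _) HAB.
by rewrite -d0.
Qed.

(** Where z1 is nonzero, the torus rotates z to positive coordinates and [weight_segment] joins it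
    to a fixed base point. Where z1 = 0, the weight forces [g] to vanish, and so does the monomial
    as a > 0. *)
Lemma weight_mono g (a m : nat) : (0 < a)%N -> holomorphic_on H g ->
  (forall u v z, cabs u = 1 -> cabs v = 1 -> H z -> g (torus_rot u v z) = u ^+ a * v^-1 ^+ m * g z) ->
  exists C, forall z, H z -> g z = C * mono a m z.
Proof.
move=> a0 ghol ginv.
(* A base point in logarithmic coordinates: gamma x0 = -2 < y0 < 0. *)
pose x0 := - 2 / gamma; pose y0 := -1 : R.
exists (g (pt_of (cexp (x0%:C)%C) (cexp (y0%:C)%C)) * ((cexp (x0%:C)%C)^-1 ^+ a * cexp (y0%:C)%C ^+ m)) => z Hz.
have z20 := Hgamma_cz2_gt0 Hz.
have [z10|] := eqVneq (cz1 z) 0.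
  rewrite /mono z10 expr0n eqn0Ngt a0 mul0r mulr0.
  (* A root of u^a = -1. Rotating z1 = 0 by u fixes z, so g z = - g z. *)
  pose u := cexp (Complex 0 (pi / a%:R)) : R[i].
  have u1 : cabs u = 1 by rewrite cabs_cexp expR0.
  have ua : u ^+ a = -1.
    rewrite -cexpMn (_ : _ *+ a = Complex 0 pi).
      by rewrite /cexp /= expR0 cospi sinpi mulr0 mul1r; apply: complex_eqP => //=; rewrite oppr0.
    have an : (a%:R : R) != 0 by rewrite pnatr_eq0 -lt0n.
    have E n (p : R) : Complex 0 p *+ n = Complex 0 (p *+ n).
      by elim: n => [|n IH]; rewrite ?mulr0n// !mulrS IH; apply: complex_eqP; rewrite ?ReD ?ImD /= ?addr0.
    by rewrite E -(mulr_natr (pi / _)) divfK.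
  have := ginv u 1 z u1 (cabs1 _) Hz.
  rewrite /torus_rot z10 mulr0 mul1r invr1 expr1n mulr1 ua -z10 pt_of_cz mulN1r => /eqP.
  by rewrite z10 -addr_eq0 -mulr2n mulrn_eq0 /= => /eqP.
rewrite -cabs_gt0 => z10.
pose x := ln (cabs (cz1 z)); pose y := ln (cabs (cz2 z)).
have ex : cexp (x%:C)%C = ((cabs (cz1 z))%:C)%C by rewrite /cexp /= cos0 sin0 mulr0 mulr1 lnK.
have ey : cexp (y%:C)%C = ((cabs (cz2 z))%:C)%C by rewrite /cexp /= cos0 sin0 mulr0 mulr1 lnK.
have [h1 h2] := andP Hz.
have hy : y < 0 by rewrite ln_lt0// z20.
have hx : gamma * x < y by rewrite -ln_powR ltr_ln// posrE powR_gt0.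
rewrite (@weight_segment g a m x0 y0 x y)//; last 2 first.
- by rewrite /x0 /y0 mulrC divfK ?gt_eqF// ltrN2 ltr1n.
- by rewrite /y0 oppr_lt0.
set c1 := cexp (x%:C)%C in ex *; set c2 := cexp (y%:C)%C in ey *.
have c10 : c1 != 0 := cexp_neq0 _. have c20 : c2 != 0 := cexp_neq0 _.
have quot (w c : R[i]) : c != 0 -> cabs w = cabs c -> exists2 u, cabs u = 1 & w = u * c.
  move=> c0 wc; exists (w / c); last by rewrite divfK.
  by rewrite cabsM cabsV wc divff// gt_eqF// cabs_gt0.
have [u u1 uE] : exists2 u, cabs u = 1 & cz1 z = u * c1.
  by apply: quot => //; rewrite ex cabs_real gtr0_norm.
have [v v1 vE] : exists2 v, cabs v = 1 & cz2 z = v * c2.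
  by apply: quot => //; rewrite ey cabs_real gtr0_norm.
have HP : H (pt_of c1 c2) by apply: Hgamma_exp.
have Ez : z = torus_rot u v (pt_of c1 c2) by rewrite -[LHS]pt_of_cz uE vE /torus_rot cz1_pt_of cz2_pt_of.
rewrite {1}Ez ginv// /mono uE vE.
rewrite invfM !exprMn.
have C1 : c1^-1 ^+ a * c1 ^+ a = 1 by rewrite -exprMn (mulVf c10) expr1n.
have C2 : c2 ^+ m * c2^-1 ^+ m = 1 by rewrite -exprMn (divff c20) expr1n.
set G := g _.
transitivity (u ^+ a * v^-1 ^+ m * G * (c1^-1 ^+ a * c1 ^+ a) * (c2 ^+ m * c2^-1 ^+ m)); first by rewrite C1 C2 !mulr1.
exact: weight_rearrange.
Qed.

Lemma mono_torus a m u v z : mono a m (torus_rot u v z) = u ^+ a * v^-1 ^+ m * mono a m z.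
Proof. rewrite /mono /torus_rot cz1_pt_of cz2_pt_of invfM !exprMn; ring. Qed.

Lemma mono_holomorphic a m : holomorphic_on H (mono a m).
Proof.
move=> z Hz; have z0 : cz2 z != 0 by rewrite -cabs_gt0 (Hgamma_cz2_gt0 Hz).
have [d1 D1] := cdiffX a (cz1 z); have [d2 D2] := cdiffX m (cz2 z)^-1.
exact: (@holomorphic_prod R (fun x => x ^+ a) (fun x => x^-1 ^+ m) z d1 _ D1 (cdiff_comp (cdiffV z0) D2)).
Qed.

Lemma cabs_mono a m z : cabs (mono a m z) = cabs (cz1 z) ^+ a / cabs (cz2 z) ^+ m.
Proof. by rewrite /mono cabsM !cabsX cabsV exprVn. Qed.

End WeightVectors.

(** * Density of the numbers a - gamma m *)

Section IrrationalDensity.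
Variables (R : realType) (gamma : R).
Hypotheses (gamma0 : 0 < gamma) (girr : ~ (exists q : rat, gamma = ratr q)).

(** Dirichlet's pigeonhole: among N + 1 fractional parts of multiples of gamma, two share a bin of
    width 1 / N. Irrationality keeps their difference from being 0. *)
Lemma irrational_small (e : R) : 0 < e -> exists a m : nat, 0 < `|a%:R - gamma * m%:R| < e.
Proof.
move=> e0; pose N := (Num.truncn e^-1).+1.
have N0 : 0 < N%:R :> R by rewrite ltr0n.
have Ne : N%:R^-1 < e by rewrite invf_plt// ?posrE//; apply: truncnS_gt.
pose fl (k : nat) := Num.truncn (gamma * k%:R).
pose fr (k : nat) := gamma * k%:R - (fl k)%:R.
have flP k : (fl k)%:R <= gamma * k%:R < (fl k).+1%:R by apply: truncn_itv; rewrite mulr_ge0// ltW.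
have fr0 k : 0 <= fr k by have := flP k; rewrite /fr subr_ge0 => /andP[].
have fr1 k : fr k < 1 by have := flP k; rewrite /fr -natr1 ltrBlDl addrC => /andP[].
pose bin (k : nat) := Num.truncn (N%:R * fr k).
have binP k : (bin k)%:R <= N%:R * fr k < (bin k).+1%:R by apply: truncn_itv; rewrite mulr_ge0// ltW.
have binN k : (bin k < N)%N.
  rewrite -(@ltr_nat R); have /andP[h _] := binP k; apply: le_lt_trans h _.
  by rewrite gtr_pMr.
have [k [l kl bkl]] : exists k, exists2 l, (k < l)%N & bin k = bin l.
  pose f (k : 'I_N.+1) : 'I_N := Ordinal (binN k).
  have : ~~ injectiveb f.
    by apply/injectiveP => /leq_card; rewrite !card_ord ltnn.
  move=> /injectivePn[k [l kl /(congr1 val)/= bkl]].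
  have [lt|gt|eq] := ltngtP k l; first by exists k, l.
    by exists l, k.
  by move/eqP: kl; case; apply: val_inj.
have flm : (fl k <= fl l)%N by apply: le_truncn; rewrite ler_pM2l// ler_nat ltnW.
exists (fl l - fl k)%N, (l - k)%N.
have E : (fl l - fl k)%:R - gamma * (l - k)%:R = fr k - fr l :> R.
  by rewrite /fr !natrB// 1?ltnW//; ring.
rewrite normr_gt0; apply/andP; split.
  apply/eqP => X; apply: girr; exists ((fl l - fl k)%:R / (l - k)%:R).
  have lk : (l - k)%:R != 0 :> R by rewrite pnatr_eq0 subn_eq0 -ltnNge.
  apply: (mulIf lk); rewrite fmorph_div/= !rmorph_nat divfK//.
  by move/eqP: X; rewrite subr_eq0 => /eqP ->.
rewrite E; apply: le_lt_trans Ne; rewrite -[leRHS]mul1r ler_pdivlMr// mulrC -(@gtr0_norm _ N%:R)// -normrM.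
have := binP k; have := binP l; rewrite bkl -natr1 => /andP[a1 a2] /andP[b1 b2].
by rewrite ler_norml; apply/andP; split; move: (fr k) (fr l) a1 a2 b1 b2; clear; move=> *; lra.
Qed.

(** Steps of size |d| < hi - lo cannot jump over the interval, so one starts far away on the side
    from which d leads towards it. Starting with a = 1 or with m = 1 keeps both exponents
    positive. *)
Lemma irrational_dense (lo hi : R) : lo < hi ->
  exists a m : nat, [/\ (0 < a)%N, (0 < m)%N & lo < a%:R - gamma * m%:R < hi].
Proof.
move=> lh; have e0 : 0 < hi - lo by rewrite subr_gt0.
have [a [m /andP[d0 de]]] := irrational_small e0.
set d := a%:R - _ in d0 de.
have step (b x : R) : 0 < b -> b < hi - lo -> x < lo -> exists k : nat, lo < x + k%:R * b < hi.
  move=> b0 be xlo; pose y := (lo - x) / b; have y0 : 0 <= y by rewrite divr_ge0 ?ltW// subr_gt0.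
  exists (Num.truncn y).+1; have /andP[h1 h2] := truncn_itv y0.
  move: h1 h2; rewrite -natr1 /y ler_pdivlMr// ltr_pdivrMr// => h1 h2.
  by apply/andP; split; move: h1 h2 be; clear; lra.
have [dp|dn|dz] := ltgtP 0 d; last by move: d0; rewrite -dz normr0 ltxx.
- rewrite gtr0_norm// in de.
  pose m0 := (Num.truncn (`|1 - lo| / gamma)).+1.
  have x0 : 1 - gamma * m0%:R < lo.
    have : `|1 - lo| / gamma < m0%:R by apply: truncnS_gt.
    rewrite ltr_pdivrMr// => h; have := ler_norm (1 - lo); move: h; rewrite mulrC; clear; lra.
  have [k kP] := step d _ dp de x0.
  exists (1 + k * a)%N, (m0 + k * m)%N; split=> //.
  have -> : (1 + k * a)%:R - gamma * (m0 + k * m)%:R = 1 - gamma * m0%:R + k%:R * d.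
    by rewrite !natrD !natrM /d; ring.
  exact: kP.
(* A negative step starts above [hi]; the reflection x -> hi + lo - x turns it into the upward walk
   of [step]. *)
- rewrite ltr0_norm// in de.
  pose a0 := (Num.truncn (`|gamma + hi|)).+1.
  have x0 : - hi + - lo - (a0%:R - gamma) < - hi + - lo - hi.
    have : `|gamma + hi| < a0%:R by apply: truncnS_gt.
    by have := ler_norm (gamma + hi); clear; lra.
  have x1 : hi + lo - (a0%:R - gamma) < lo by move: x0; clear; lra.
  have nd0 : 0 < - d by rewrite oppr_gt0.
  have [k kP] := step (- d) _ nd0 de x1.
  exists (a0 + k * a)%N, (1 + k * m)%N; split=> //.
  have -> : (a0 + k * a)%:R - gamma * (1 + k * m)%:R = hi + lo - (hi + lo - (a0%:R - gamma) + k%:R * - d).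
    by rewrite !natrD !natrM /d; ring.
  by move: kP => /andP[p1 p2]; apply/andP; split; move: p1 p2; clear; lra.
Qed.

End IrrationalDensity.

(** * Integrals of monomials over dyadic shells *)

Section Shells.
Variables (R : realType) (gamma : R) (gamma0 : 0 < gamma).
Local Notation H := (Hgamma gamma).
Local Notation dV := (@dV R).
Local Notation L := (@lebesgue_measure R).

Definition dyadic (k : nat) : R := 2^-1 ^+ k.
Definition shell k : set (pt R) := [set z | H z /\ dyadic k.+1 <= cabs (cz2 z) < dyadic k].
Definition trunc_dom n : set (pt R) := [set z | H z /\ dyadic n <= cabs (cz2 z)].

Lemma one_powR (x : R) : 1 `^ x = 1 :> R. Proof. by rewrite powR1. Qed.
Lemma dyadic_gt0 k : 0 < dyadic k. Proof. by rewrite exprn_gt0// invr_gt0. Qed.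
Lemma dyadic_le1 k : dyadic k <= 1.
Proof. by rewrite exprn_ile1// ?invr_ge0// invf_le1// ler1n. Qed.
Lemma dyadicS k : dyadic k.+1 = dyadic k / 2. Proof. by rewrite /dyadic exprS mulrC. Qed.

Lemma dyadic_powR k (x : R) : dyadic k `^ x = (2^-1 `^ x) ^+ k.
Proof.
elim: k => [|k IH]; first by rewrite /dyadic !expr0 powR1.
by rewrite /dyadic exprS powRM ?exprn_ge0 ?invr_ge0// -/(dyadic k) IH exprS.
Qed.

Lemma measurable_trunc_dom n : measurable (trunc_dom n).
Proof.
have -> : trunc_dom n = H `&` ~` [set z | cabs (cz2 z) < dyadic n].
  apply/seteqP; split => z [Hz h]; split=> //; first by apply/negP; rewrite -leNgt.
  by rewrite leNgt; exact/negP.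
apply: measurableI; first exact: measurable_Hgamma.
apply: measurableC; apply: measurable_set_lt; [exact: measurable_cabs_z2 | exact: measurable_cst].
Qed.

Lemma measurable_shell k : measurable (shell k).
Proof.
have -> : shell k = trunc_dom k.+1 `&` [set z | cabs (cz2 z) < dyadic k].
  apply/seteqP; split => z /=; first by move=> [Hz /andP[h1 h2]].
  by move=> [[Hz h1] h2]; split=> //; apply/andP.
apply: measurableI; first exact: measurable_trunc_dom.
apply: measurable_set_lt; [exact: measurable_cabs_z2 | exact: measurable_cst].
Qed.

Lemma measurable_cabs_mono (D : set (pt R)) a m q : measurable_fun D (fun z => (cabs (mono a m z) `^ q)%:E).
Proof.
apply/measurable_EFinP; apply: (@measurableT_comp _ _ _ _ _ _ (fun x : R => x `^ q)).
  exact: measurable_powR.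
apply: (@measurable_funS _ _ _ _ setT) => //.
rewrite (_ : (fun z => _) = fun z => cabs (cz1 z) ^+ a * (cabs (cz2 z) `^ (-1)) ^+ m); last first.
  by apply/funext => z; rewrite cabs_mono powR_inv1 ?cabs_ge0// exprVn.
apply: measurable_funM; apply: measurable_funX; first exact: measurable_cabs_z1.
apply: (@measurableT_comp _ _ _ _ _ _ (fun x : R => x `^ (-1))); first exact: measurable_powR.
exact: measurable_cabs_z2.
Qed.

Lemma dV_cube (a b c d e f g h : R) : a < b -> c < d -> e < f -> g < h ->
  dV (((`[a, b] `*` `[c, d]) `*` `[e, f]) `*` `[g, h]) = ((b - a) * (d - c) * (f - e) * (h - g))%:E.
Proof.
move=> ab cd ef gh; rewrite dV_box//= !lebesgue_measure_itv /= !lte_fin ab cd ef gh.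
by rewrite -!EFinB -!EFinM.
Qed.

Variables (a m : nat).
(** At |z2| = t and |z1| = t^(1/gamma) the monomial has modulus t^nu. A shell of this size has
    volume of order t^(2/gamma + 2), so t to the power [kappa q] measures the integral of the q-th
    power over it. *)
Local Notation nu := (a%:R / gamma - m%:R).
Local Notation kappa q := (q * nu + 2 / gamma + 2).

Lemma powR_nu (t : R) : 0 < t -> (t `^ gamma^-1) ^+ a / t ^+ m = t `^ nu.
Proof.
move=> t0; have t1 : t != 0 by rewrite gt_eqF.
rewrite powRD ?t1 ?implybT// powRN (powR_mulrn m (ltW t0)).
by rewrite (mulrC a%:R) powRrM powR_mulrn ?powR_ge0.
Qed.

Lemma powR_kappa (t q : R) : 0 < t ->
  (t `^ nu) `^ q * (t `^ gamma^-1 * t `^ gamma^-1 * t * t) = t `^ (kappa q).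
Proof.
move=> t0; have t1 : t != 0 by rewrite gt_eqF.
have D x y : t `^ (x + y) = t `^ x * t `^ y by rewrite powRD ?t1 ?implybT.
rewrite -powRrM (mulrC nu) (D (q * nu + 2 / gamma)) (D (q * nu)) -!mulrA; congr (_ * _).
rewrite (_ : 2 / gamma = gamma^-1 + gamma^-1); last by rewrite mulr_natl mulr2n.
by rewrite D (powR_mulrn 2 (ltW t0)) expr2 !mulrA.
Qed.

(** With r = t^(1/gamma), the shell lies in a box of volume 16 r^2 t^2. The factor 2^m stems from
    |z2| >= t / 2 in the denominator of the monomial. *)
Lemma shell_integral_le (q : R) k : 0 <= q ->
  (\int[dV]_(z in shell k) (cabs (mono a m z) `^ q)%:E <= (16 * (2 ^+ m) `^ q * dyadic k `^ kappa q)%:E)%E.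
Proof.
move=> q0; set t := dyadic k; have t0 : 0 < t := dyadic_gt0 k.
pose r := t `^ gamma^-1; have r0 : 0 < r by rewrite powR_gt0.
pose M := (2 ^+ m * t `^ nu) `^ q.
have z1r z : shell k z -> cabs (cz1 z) <= r.
  move=> [/andP[h1 _] /andP[_ h2]].
  rewrite -[leLHS](@powRr1 _ (cabs (cz1 z))) ?cabs_ge0// -(divff (negbT (gt_eqF gamma0))) powRrM.
  by apply: ge0_ler_powR; rewrite ?nnegrE ?invr_ge0 ?powR_ge0 ?ltW//; exact: lt_trans h1 h2.
have bound z : shell k z -> cabs (mono a m z) `^ q <= M.
  move=> Sz; apply: ge0_ler_powR => //; rewrite ?nnegrE ?cabs_ge0 ?mulr_ge0 ?exprn_ge0 ?powR_ge0//.
  have [Hz /andP[h1 h2]] := Sz; have z20 := Hgamma_cz2_gt0 Hz.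
  rewrite cabs_mono -powR_nu// mulrCA; apply: ler_pM.
  - by rewrite exprn_ge0 ?cabs_ge0.
  - by rewrite invr_ge0 exprn_ge0 ?cabs_ge0.
  - by apply: lerXn2r; rewrite ?nnegrE ?cabs_ge0 ?(ltW r0)//; exact: z1r.
  - rewrite -exprVn -exprVn -exprMn; apply: lerXn2r; rewrite ?nnegrE ?mulr_ge0 ?invr_ge0 ?cabs_ge0 ?(ltW t0)//.
    by rewrite -(invrK 2) -invfM lef_pV2 ?posrE ?mulr_gt0 ?invr_gt0// mulrC -dyadicS.
apply: (@le_trans _ _ (\int[dV]_(z in shell k) (cst M%:E z))%E).
  apply: ge0_le_integral => //.
  - exact: measurable_shell.
  - by move=> z _; rewrite lee_fin powR_ge0.
  - exact: measurable_cabs_mono.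
rewrite (integral_cst _ (measurable_shell k)).
have box : shell k `<=` (((`[-r, r] `*` `[-r, r]) `*` `[-t, t]) `*` `[-t, t] : set (pt R)).
  move=> z Sz; have h1 := z1r z Sz; have [_ /andP[_ /ltW h2]] := Sz.
  have K (x : R) (s : R) : `|x| <= s -> x \in `[-s, s] by rewrite in_itv /= ler_norml.
  have R1 := le_trans (ler_normr_cabs_Re (cz1 z)) h1; have I1 := le_trans (ler_normr_cabs_Im (cz1 z)) h1.
  have R2 := le_trans (ler_normr_cabs_Re (cz2 z)) h2; have I2 := le_trans (ler_normr_cabs_Im (cz2 z)) h2.
  by split; first split; first split; apply: K.
have mbox : measurable (((`[-r, r] `*` `[-r, r]) `*` `[-t, t]) `*` `[-t, t] : set (pt R)).
  by apply: measurableX => //; apply: measurableX => //; apply: measurableX.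
have lt1 (s : R) : 0 < s -> - s < s by move=> s0; rewrite (lt_trans _ s0)// oppr_lt0.
have le1 : (dV (shell k) <= dV (((`[(- r)%R, r] `*` `[(- r)%R, r]) `*` `[(- t)%R, t]) `*` `[(- t)%R, t] : set (pt R)))%E.
  by apply: le_measure; rewrite ?inE//; exact: measurable_shell.
rewrite dV_cube ?lt1// in le1.
apply: (le_trans (lee_wpmul2l _ le1)); first by rewrite lee_fin powR_ge0.
rewrite -EFinM lee_fin -powR_kappa// -/r.
rewrite /M powRM ?exprn_ge0 ?powR_ge0// le_eqVlt; apply/orP; left; apply/eqP.
by move: (_ `^ q) ((t `^ nu) `^ q) => *; ring.
Qed.

(** Each shell contains a box of comparable size, with constants independent of k. A nonpositive
    exponent makes the scaling factor at least 1, so a single [J] serves all shells. *)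
Lemma shell_integral_ge (q : R) : 0 <= q -> kappa q <= 0 ->
  exists2 J : R, 0 < J & forall k,
  (J%:E <= \int[dV]_(z in shell k) (cabs (mono a m z) `^ q)%:E)%E.
Proof.
(* Chosen so that 3 c r = (t / 2)^(1/gamma); then |z1| <= 3 c r gives |z1|^gamma <= t / 2, which is
   below 6 t / 10. *)
move=> q0 kq; pose c := 2^-1 `^ gamma^-1 / 3; have c0 : 0 < c by rewrite divr_gt0// powR_gt0// invr_gt0.
exists ((c ^+ a) `^ q * (c * c / 100)); first by rewrite mulr_gt0 ?powR_gt0 ?exprn_gt0 ?divr_gt0 ?mulr_gt0.
move=> k; set t := dyadic k; have t0 : 0 < t := dyadic_gt0 k.
pose r := t `^ gamma^-1; have r0 : 0 < r by rewrite powR_gt0.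
pose M := (c ^+ a * t `^ nu) `^ q.
(* On this box |z1| lies between c r and 3 c r, as the square root of 8 is below 3, and |z2| lies
   between 6 t / 10 and 9 t / 10. Its volume c^2 r^2 t^2 / 100 accounts for the last factor of
   [J]. *)
pose B := (((`[c * r, 2 * (c * r)] `*` `[c * r, 2 * (c * r)]) `*` `[6 / 10 * t, 7 / 10 * t]) `*` `[0, t / 10] : set (pt R)).
have cr0 : 0 < c * r by rewrite mulr_gt0.
have mB : measurable B by apply: measurableX => //; apply: measurableX => //; apply: measurableX.
have sq (x y : R) : 0 <= y -> x ^+ 2 <= y ^+ 2 -> x <= y.
  by move=> y0 h; apply: le_trans (ler_norm x) _; rewrite -(ger0_norm y0) -!sqrtr_sqr ler_wsqrtr.
have Bz z : B z -> [/\ c * r <= cabs (cz1 z), cabs (cz1 z) <= 3 * (c * r), 6 / 10 * t <= cabs (cz2 z) & cabs (cz2 z) <= 9 / 10 * t].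
  move=> [[[/= + +] +] +]; rewrite /= !in_itv /= => /andP[x1 x1'] /andP[y1 y1'] /andP[x2 x2'] /andP[y2 y2'].
  move: (c * r) cr0 x1 x1' y1 y1' => s s0 x1 x1' y1 y1'.
  split; apply: sq; rewrite ?mulr_ge0 ?cabs_ge0 ?(ltW s0) ?(ltW t0)// cabs_sqr /=.
  - by move: x1 y1 s0; clear; move=> *; nra.
  - by move: x1 x1' y1 y1' s0; clear; move=> *; nra.
  - by move: x2 y2 t0; clear; move=> *; nra.
  - by move: x2 x2' y2 y2' t0; clear; move=> *; nra.
have BS : B `<=` shell k.
  move=> z /Bz[h1 h2 h3 h4].
  have h5 : cabs (cz1 z) `^ gamma <= t / 2.
    have -> : t / 2 = (3 * (c * r)) `^ gamma.
      rewrite (_ : 3 * (c * r) = 2^-1 `^ gamma^-1 * r); last by rewrite /c; field.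
      rewrite powRM ?powR_ge0// -!powRrM mulVf ?gt_eqF// !powRr1 ?invr_ge0 ?(ltW t0)//.
      by rewrite mulrC.
    by apply: ge0_ler_powR; rewrite ?nnegrE ?cabs_ge0 ?mulr_ge0 ?(ltW gamma0) ?(ltW cr0) ?(ltW c0) ?(ltW r0).
  have t1 := dyadic_le1 k; rewrite -/t in t1.
  split; first by apply/andP; split; move: h3 h4 h5 t0 t1; clear; lra.
  by rewrite dyadicS -/t; apply/andP; split; move: h3 h4 h5 t0 t1; clear; lra.
apply: (@le_trans _ _ (\int[dV]_(z in B) (cabs (mono a m z) `^ q)%:E)%E); last first.
  apply: ge0_subset_integral => //; [exact: measurable_shell | exact: measurable_cabs_mono |].
  by move=> z _; rewrite lee_fin powR_ge0.
apply: (@le_trans _ _ (\int[dV]_(z in B) (cst M%:E z))%E); last first.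
  apply: ge0_le_integral => //.
  - by move=> z _; rewrite lee_fin powR_ge0.
  - exact: measurable_cabs_mono.
  - move=> z BBz; rewrite lee_fin; apply: ge0_ler_powR => //; rewrite ?nnegrE ?cabs_ge0 ?mulr_ge0 ?exprn_ge0 ?powR_ge0 ?(ltW c0)//.
    have [h1 _ _ h4] := Bz z BBz; have [Hz /andP[_ /ltW h2]] := BS z BBz; have z20 := Hgamma_cz2_gt0 Hz.
    rewrite cabs_mono -powR_nu// mulrA -exprMn; apply: ler_pM.
    + by rewrite exprn_ge0 ?(ltW cr0).
    + by rewrite invr_ge0 exprn_ge0 ?(ltW t0).
    + by apply: lerXn2r; rewrite ?nnegrE ?cabs_ge0 ?(ltW cr0).
    + by rewrite lef_pV2 ?posrE ?exprn_gt0//; apply: lerXn2r; rewrite ?nnegrE ?cabs_ge0 ?(ltW t0).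
have -> : (\int[dV]_(z in B) (cst M%:E z) = M%:E * ((2 * (c * r) - c * r) * (2 * (c * r) - c * r) * (7 / 10 * t - 6 / 10 * t) * (t / 10 - 0))%:E)%E.
  apply: (etrans (integral_cst _ mB _)); congr (_ * _)%E; apply: dV_cube.
  - by rewrite mulr_natl mulr2n ltrDl.
  - by rewrite mulr_natl mulr2n ltrDl.
  - by rewrite ltr_pM2r// ltr_pM2r ?invr_gt0// ltr_nat.
  - by rewrite divr_gt0.
rewrite -EFinM lee_fin /M powRM ?exprn_ge0 ?powR_ge0 ?(ltW c0)//.
have tk : 1 <= t `^ (kappa q).
  rewrite -(opprK (kappa q)) powRN -[leLHS]invr1 lef_pV2 ?posrE ?powR_gt0//.
  rewrite -[leRHS](one_powR (- kappa q)); apply: ge0_ler_powR; rewrite ?nnegrE ?oppr_ge0 ?(ltW t0)//.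
  exact: dyadic_le1.
rewrite -powR_kappa// -/r in tk.
apply: (@le_trans _ _ ((c ^+ a) `^ q * (c * c / 100) * ((t `^ nu) `^ q * (r * r * t * t)))).
  by rewrite ler_peMr// mulr_ge0 ?powR_ge0 ?divr_ge0 ?mulr_ge0 ?(ltW c0).
rewrite le_eqVlt; apply/orP; left; apply/eqP.
by move: ((c ^+ a) `^ q) ((t `^ nu) `^ q) => *; field.
Qed.

Lemma trunc_dom0 : trunc_dom 0 = set0.
Proof.
apply/seteqP; split => // z [Hz]; rewrite /dyadic expr0 => h.
by have := Hgamma_cz2_lt1 Hz; rewrite ltNge h.
Qed.

Lemma trunc_integralS q n :
  (\int[dV]_(z in trunc_dom n.+1) (cabs (mono a m z) `^ q)%:E =
   \int[dV]_(z in trunc_dom n) (cabs (mono a m z) `^ q)%:E + \int[dV]_(z in shell n) (cabs (mono a m z) `^ q)%:E)%E.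
Proof.
have -> : trunc_dom n.+1 = trunc_dom n `|` shell n.
  apply/seteqP; split => z.
    move=> [Hz h]; have [lt|ge] := ltP (cabs (cz2 z)) (dyadic n); [right|left]; split=> //.
    by rewrite h lt.
  move=> [[Hz h]|[Hz /andP[h _]]]; split=> //; apply: le_trans h.
  by rewrite dyadicS ler_pdivrMr// ler_peMr ?ler1n// ltW// dyadic_gt0.
apply: ge0_integral_setU.
- exact: measurable_trunc_dom.
- exact: measurable_shell.
- exact: measurable_cabs_mono.
- by move=> z _; rewrite lee_fin powR_ge0.
- by apply/disj_setPS => z [[_ h] [_ /andP[_ h2]]]; move: h; rewrite leNgt h2.
Qed.

(** The shell bounds form a geometric series of ratio [rho] < 1; the induction carries its exact
    partial sums. *)
Lemma trunc_integral_le (q : R) : 0 <= q -> 0 < kappa q -> exists B : R, forall n,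
  (\int[dV]_(z in trunc_dom n) (cabs (mono a m z) `^ q)%:E <= B%:E)%E.
Proof.
move=> q0 kq; pose rho := 2^-1 `^ (kappa q) : R; pose c := 16 * (2 ^+ m) `^ q : R.
have rho1 : rho < 1.
  rewrite /rho -[ltRHS](one_powR (kappa q)); apply: gt0_ltr_powR; rewrite ?nnegrE ?invr_ge0//.
  by rewrite invf_lt1// ltr1n.
have r0 : 0 <= rho := powR_ge0 _ _.
have s0 : 0 < 1 - rho by rewrite subr_gt0.
have c0 : 0 <= c by rewrite mulr_ge0 ?powR_ge0.
have H1 n : (\int[dV]_(z in trunc_dom n) (cabs (mono a m z) `^ q)%:E <= (c * (1 - rho ^+ n) / (1 - rho))%:E)%E.
  elim: n => [|n IH].
    by rewrite trunc_dom0 integral_set0 expr0 subrr mulr0 mul0r.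
  rewrite trunc_integralS; apply: le_trans (leeD IH (shell_integral_le n q0)) _.
  rewrite -EFinD lee_fin dyadic_powR -/rho -/c le_eqVlt; apply/orP; left; apply/eqP.
  by rewrite exprS; field; rewrite gt_eqF.
exists (c / (1 - rho)) => n; apply: le_trans (H1 n) _; rewrite lee_fin ler_pM2r ?invr_gt0//.
by rewrite ler_piMr// lerBlDr lerDl exprn_ge0.
Qed.

Lemma trunc_integral_ge (q : R) : 0 <= q -> kappa q <= 0 -> exists2 J : R, 0 < J & forall n,
  ((n%:R * J)%:E <= \int[dV]_(z in trunc_dom n) (cabs (mono a m z) `^ q)%:E)%E.
Proof.
move=> q0 kq; have [J J0 HJ] := shell_integral_ge q0 kq; exists J => //.
elim=> [|n IH]; first by rewrite mul0r trunc_dom0 integral_set0.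
rewrite trunc_integralS -natr1 mulrDl mul1r EFinD; exact: leeD.
Qed.

End Shells.

Section ComplexMeasurable.
Variables (R : realType) (D : set (pt R)).

Lemma cmeasurableM (f g : pt R -> R[i]) : cmeasurable D f -> cmeasurable D g -> cmeasurable D (fun z => f z * g z).
Proof.
move=> [f1 f2] [g1 g2]; split.
- by rewrite (funext (fun z => ReM (f z) (g z))); apply: measurable_funB; apply: measurable_funM.
- by rewrite (funext (fun z => ImM (f z) (g z))); apply: measurable_funD; apply: measurable_funM.
Qed.

Lemma cmeasurableX (f : pt R -> R[i]) n : cmeasurable D f -> cmeasurable D (fun z => f z ^+ n).
Proof.
move=> mf; elim: n => [|n IH]; first by split; exact: measurable_cst.
by rewrite (funext (fun z => exprS (f z) n)); exact: cmeasurableM.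
Qed.

Lemma ReIm_inv (w : R[i]) : complex.Re w^-1 = complex.Re w * cabs w `^ (-1) * cabs w `^ (-1) /\
  complex.Im w^-1 = - complex.Im w * cabs w `^ (-1) * cabs w `^ (-1).
Proof.
rewrite powR_inv1 ?cabs_ge0// -!mulrA -invfM -expr2 cabs_sqr.
by case: w => x y; split; rewrite ?mulNr.
Qed.

Lemma cmeasurableV (f : pt R -> R[i]) : cmeasurable D f -> cmeasurable D (fun z => (f z)^-1).
Proof.
move=> [f1 f2].
have mc : measurable_fun D (fun z => cabs (f z) `^ (-1)).
  apply: (@measurableT_comp _ _ _ _ _ _ (fun x : R => x `^ (-1))); first exact: measurable_powR.
  exact: measurable_cabs.
split.
- rewrite (funext (fun z => (ReIm_inv (f z)).1)); apply: measurable_funM => //; exact: measurable_funM.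
- rewrite (funext (fun z => (ReIm_inv (f z)).2)); apply: measurable_funM => //; apply: measurable_funM => //.
  exact: measurableT_comp.
Qed.

Lemma cmeasurable_mono a m : cmeasurable D (mono a m).
Proof.
apply: cmeasurableM; apply: cmeasurableX.
  by split; apply: (@measurable_funS _ _ _ _ setT) => //; [exact: measurable_x1 | exact: measurable_y1].
apply: cmeasurableV.
by split; apply: (@measurable_funS _ _ _ _ setT) => //; [exact: measurable_x2 | exact: measurable_y2].
Qed.

End ComplexMeasurable.

(** * Cut-off monomials as test functions *)

Section TruncatedMonomials.
Variables (R : realType) (gamma : R) (gamma0 : 0 < gamma) (a m : nat).
Local Notation H := (Hgamma gamma).
Local Notation dV := (@dV R).
Local Notation ip := (ip dV H).
Local Notation sqint := (sqint dV H).
Local Notation A2 := (A2 gamma).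
Local Notation e := (@mono R a m).
Local Notation T := (trunc_dom gamma).
Local Notation kappa q := (q * (a%:R / gamma - m%:R) + 2 / gamma + 2).

Lemma bounded_Lp (f : pt R -> R[i]) (M p : R) : 0 <= p -> cmeasurable H f ->
  (forall z, H z -> cabs (f z) <= M) -> Lp p H f.
Proof.
have mH := measurable_Hgamma gamma.
move=> p0 mf fM; split=> //.
apply: (@le_lt_trans _ _ (\int[dV]_(z in H) (cst (M `^ p)%:E z))%E).
  apply: ge0_le_integral => //.
  - by move=> z _; rewrite lee_fin powR_ge0.
  - apply/measurable_EFinP; apply: (@measurableT_comp _ _ _ _ _ _ (fun x : R => x `^ p)); first exact: measurable_powR.
    by apply: measurable_cabs; case: mf.
  - move=> z Hz; rewrite lee_fin; apply: ge0_ler_powR; rewrite ?nnegrE ?cabs_ge0//; last exact: fM.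
    exact: le_trans (cabs_ge0 _) (fM z Hz).
rewrite (integral_cst _ mH); apply: lte_mul_pinfty; rewrite ?lee_fin ?powR_ge0//.
exact: dV_Hgamma.
Qed.

Lemma integral_trunc (F : pt R -> R) n :
  (\int[dV]_(z in H) (\1_(T n) z * F z)%:E = \int[dV]_(z in T n) (F z)%:E)%E.
Proof.
have -> : T n = H `&` T n by apply/seteqP; split => [z [Hz h]|z [Hz h]].
rewrite integral_mkcondr; apply: eq_integral => z /[!inE] Hz; rewrite /patch.
have -> : \1_(H `&` T n) z = \1_(T n) z :> R.
  by rewrite !indicE; congr (nat_of_bool _)%:R; apply/idP/idP; rewrite !inE => -[].
by rewrite indicE; case: ifP => _; rewrite ?mul1r ?mul0r.
Qed.

(* [e |e|^(q-2)] cut off near [z2 = 0]: its pairing with [e] is the truncated integral of [|e|^q]. *)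
Definition dual_mono (q : R) n z : R[i] := ((\1_(T n) z * cabs (e z) `^ (q - 2))%:C)%C * e z.

Lemma cabs_dual_mono q n z : 2 <= q -> cabs (dual_mono q n z) = \1_(T n) z * cabs (e z) `^ (q - 1).
Proof.
move=> q2; rewrite /dual_mono cabsM cabs_real ger0_norm ?mulr_ge0 ?powR_ge0//.
rewrite -mulrA; congr (_ * _).
rewrite -{2}(powRr1 (cabs_ge0 (e z))) -powRD; first by congr (_ `^ _); ring.
by rewrite gt_eqF// ltr_wpDl// subr_ge0.
Qed.

Lemma dual_mono_bound q n : 2 <= q -> exists M, forall z, H z -> cabs (dual_mono q n z) <= M.
Proof.
move=> q2; exists ((dyadic R n ^+ m)^-1 `^ (q - 1)) => z Hz; rewrite cabs_dual_mono// indicE.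
have d0 := dyadic_gt0 R n.
case: (boolP (z \in T n)) => [|_]; last by rewrite mul0r powR_ge0.
rewrite inE mul1r => -[_ h]; apply: ge0_ler_powR; rewrite ?nnegrE ?cabs_ge0 ?invr_ge0 ?exprn_ge0 ?(ltW d0)//.
  by rewrite subr_ge0 (le_trans _ q2)// ler1n.
rewrite cabs_mono -[leRHS]mul1r; apply: ler_pM; rewrite ?exprn_ge0 ?invr_ge0 ?exprn_ge0 ?cabs_ge0//.
  by rewrite exprn_ile1 ?cabs_ge0// ltW// (Hgamma_cz1_lt1 gamma0 Hz).
rewrite lef_pV2 ?posrE ?exprn_gt0 ?(Hgamma_cz2_gt0 Hz)//.
by apply: lerXn2r; rewrite ?nnegrE ?cabs_ge0 ?(ltW d0).
Qed.

Lemma dual_mono_Lp p q n : 0 <= p -> 2 <= q -> Lp p H (dual_mono q n).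
Proof.
move=> p0 q2; have [M HM] := dual_mono_bound n q2; apply: bounded_Lp HM => //.
apply: cmeasurableM; last exact: cmeasurable_mono.
split=> /=; last exact: measurable_cst.
apply: measurable_funM; first by apply: measurable_indic; exact: measurable_trunc_dom.
by apply/measurable_EFinP; exact: measurable_cabs_mono.
Qed.

Lemma dual_mono_integral p q n : 0 < p -> 2 <= q ->
  (\int[dV]_(z in H) (cabs (dual_mono q n z) `^ p)%:E = \int[dV]_(z in T n) (cabs (e z) `^ ((q - 1) * p))%:E)%E.
Proof.
move=> p0 q2; rewrite -integral_trunc; apply: eq_integral => z _.
rewrite cabs_dual_mono// powRM ?powR_ge0// powRrM indicE; congr (_ * _)%:E.
by case: (_ \in _); rewrite ?one_powR// powR0// gt_eqF.
Qed.

Lemma ReIm_scale (c w : R[i]) : complex.Re (c * w) * complex.Re w + complex.Im (c * w) * complex.Im w =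
  complex.Re c * (complex.Re w * complex.Re w + complex.Im w * complex.Im w).
Proof. by rewrite ReM ImM; ring. Qed.

Lemma ip_dual_mono q n : 2 <= q -> ip (dual_mono q n) e = fine (\int[dV]_(z in T n) (cabs (e z) `^ q)%:E).
Proof.
move=> q2; rewrite -integral_trunc; congr fine; apply: eq_integral => z _; congr EFin.
rewrite ReIm_scale /=.
have -> : cabs (e z) `^ q = cabs (e z) `^ (q - 2) * (cabs (e z) ^+ 2).
  rewrite -(powR_mulrn 2 (cabs_ge0 _)) -powRD; first by congr (_ `^ _); ring.
  by rewrite gt_eqF// ltr_wpDl// subr_ge0.
by rewrite cabs_sqr !expr2 mulrA.
Qed.

Hypothesis k2 : 0 < kappa 2.

(** For q = 2 the factor |e|^(q - 2) is 1, so [dual_mono 2 n] is [e] cut off. These functions have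
    bounded norms and tend to [e] pointwise, and Fatou's lemma applies. *)
Lemma mono_A2 : A2 e.
Proof.
have mH := measurable_Hgamma gamma.
split; first exact: mono_holomorphic.
have le22 : 2 <= 2 :> R by [].
have [B HB] := trunc_integral_le gamma0 (ltW (ltr0n R 2)) k2.
apply: (@sqint_fatou _ _ _ dV H mH (dual_mono 2) e B _ _ _).1.
- by move=> n; apply/Lp2E; apply: dual_mono_Lp.
- move=> n; have I1 := HB n; rewrite ip_sq.
  have E : (\int[dV]_(x in H) (cabs (dual_mono 2 n x) ^+ 2)%:E = \int[dV]_(z in T n) (cabs (e z) `^ 2)%:E)%E.
    have E2 : 2 = (2 - 1) * 2 :> R by ring.
    rewrite {2}E2 -dual_mono_integral//; apply: eq_integral => x _.
    by rewrite powR2 ?cabs_ge0.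
  rewrite E -lee_fin fineK// ge0_fin_numE ?(le_lt_trans I1) ?ltry//.
  by apply: integral_ge0 => x _; rewrite lee_fin powR_ge0.
- move=> z Hz t t0; have z20 := Hgamma_cz2_gt0 Hz.
  (* From this index on 2^n exceeds 1 / |z2|, so z belongs to the truncated domain and the sequence
     is constant. *)
  exists (Num.truncn (cabs (cz2 z))^-1) => n Nn.
  have -> : dual_mono 2 n z = e z.
    rewrite /dual_mono subrr powRr0 mulr1 indicE mem_set ?mul1r//; split=> //.
    rewrite /dyadic exprVn -(invrK (cabs (cz2 z))) lef_pV2 ?posrE ?invr_gt0 ?exprn_gt0//.
    apply/ltW/(lt_le_trans (truncnS_gt _)).
    by rewrite -natrX ler_nat; apply: leq_trans (ltn_expl _ (ltnSn 1)); rewrite ltnS.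
  by rewrite subrr cabs0 ltW.
Qed.

Variables (K : pt R -> pt R -> R[i]) (HK : is_bergman_kernel H K) (a0 : (0 < a)%N).

(** The cut-off and |e| are torus invariant, so the test function has the weight of [e], and so has
    its projection. Pairing with [e] determines the real part of the coefficient, which suffices for
    lower bounds on its modulus. *)
Lemma bergman_op_dual_mono q n : 2 <= q -> exists C, (forall z, H z -> bergman_op H K (dual_mono q n) z = C * e z) /\
  complex.Re C * ip e e = fine (\int[dV]_(z in T n) (cabs (e z) `^ q)%:E).
Proof.
have mH := measurable_Hgamma gamma.
move=> q2; have sf : sqint (dual_mono q n) by apply/Lp2E; apply: dual_mono_Lp.
have [gA orth] := bergman_op_is_proj gamma0 HK sf; have eA := mono_A2.
have [C HC] : exists C, forall z, H z -> bergman_op H K (dual_mono q n) z = C * e z.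
  apply: (weight_mono gamma0 a0 gA.1) => u v z u1 v1 Hz.
  apply: (bergman_op_weight gamma0 HK) => // w Hw.
  have E1 : \1_(T n) (torus_rot u v w) = \1_(T n) w :> R.
    have rotE : T n (torus_rot u v w) <-> T n w.
      rewrite /trunc_dom /= {2}/torus_rot cz2_pt_of cabsM v1 mul1r.
      by split=> -[h1 h2]; split=> //; apply/(Hgamma_torus gamma w u1 v1).
    by rewrite !indicE; congr (nat_of_bool _)%:R; apply/idP/idP; rewrite !inE => /rotE.
  have E2 : cabs (e (torus_rot u v w)) = cabs (e w).
    by rewrite mono_torus cabsM cabsM !cabsX cabsV u1 v1 invr1 !expr1n !mul1r.
  have E3 := f_equal2 (fun s t : R => ((s * t `^ (q - 2))%:C)%C * e (torus_rot u v w)) E1 E2.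
  apply: (etrans E3); rewrite mono_torus; exact: mulrCA.
exists C; split=> //; rewrite -ip_dual_mono//.
have -> : ip (dual_mono q n) e = ip (bergman_op H K (dual_mono q n)) e.
  by apply/eqP; rewrite -subr_eq0 -ipBl// ?orth//; [exact: gA.2 | exact: eA.2].
have -> : ip (bergman_op H K (dual_mono q n)) e = ip (fun z => C * e z) e.
  by apply: eq_ip => z Hz //; exact: HC.
rewrite -(ipZl mH _ eA.2 eA.2); apply: eq_Rintegral => z _.
by rewrite ReIm_scale; move: (e z) => w; rewrite ReM ImM /=; ring.
Qed.

End TruncatedMonomials.

(** * Failure of boundedness for [p <> 2] *)

Section Unboundedness.
Variables (R : realType) (gamma : R) (gamma0 : 0 < gamma) (girr : ~ (exists q : rat, gamma = ratr q)).
Local Notation H := (Hgamma gamma).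
Local Notation dV := (@dV R).
Local Notation ip := (ip dV H).
Local Notation T := (trunc_dom gamma).
Local Notation kappa a m q := (q * (a%:R / gamma - m%:R) + 2 / gamma + 2).

(** Up to the factors 2 / gamma and q / gamma, the two quantities are the signed distances of a -
    gamma m from the ends of the interval to which density is applied. *)
Lemma exponent_window (q : R) : 2 < q ->
  exists a m : nat, [/\ (0 < a)%N, 0 < kappa a m 2 & kappa a m q <= 0].
Proof.
move=> q2; have q0 : 0 < q := lt_trans (ltr0n R 2) q2.
have g1 : 0 < 1 + gamma by rewrite addr_gt0.
have lh : - (1 + gamma) < - (2 / q * (1 + gamma)) by rewrite ltrN2 gtr_pMl// ltr_pdivrMr// mul1r.
have [a [m [a0 m0 /andP[h1 h2]]]] := irrational_dense gamma0 girr lh.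
exists a, m; split=> //.
- have -> : kappa a m 2 = 2 / gamma * (a%:R - gamma * m%:R + (1 + gamma)) by field; rewrite gt_eqF.
  by rewrite mulr_gt0 ?divr_gt0// -(opprK (1 + gamma)) subr_gt0.
- have -> : kappa a m q = q / gamma * (a%:R - gamma * m%:R + 2 / q * (1 + gamma)) by field; rewrite !gt_eqF.
  by rewrite pmulr_rle0 ?divr_gt0// -lerBrDr sub0r ltW.
Qed.

Variables (p : R) (p1 : 1 < p) (K : pt R -> pt R -> R[i]) (HK : is_bergman_kernel H K).

Lemma integral_scale (C : R[i]) (h f : pt R -> R[i]) :
  measurable_fun H (fun z => (cabs (h z) `^ p)%:E) -> (forall z, H z -> f z = C * h z) ->
  (\int[dV]_(z in H) (cabs (f z) `^ p)%:E = (cabs C `^ p)%:E * \int[dV]_(z in H) (cabs (h z) `^ p)%:E)%E.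
Proof.
have mH := measurable_Hgamma gamma.
move=> mh fC; have h0 z : H z -> (0 <= (cabs (h z) `^ p)%:E)%E by rewrite lee_fin powR_ge0.
apply: etrans (ge0_integralZl_EFin dV mH h0 mh (powR_ge0 (cabs C) p)).
by apply: eq_integral => z /[!inE] Hz; rewrite fC// cabsM powRM ?cabs_ge0// EFinM.
Qed.

Section Estimates.
Variables (a m : nat) (q : R).
Hypotheses (a0 : (0 < a)%N) (q2 : 2 < q) (k2 : 0 < kappa a m 2) (kq : kappa a m q <= 0).
Hypothesis bounded : bergman_bounded_Lp p H K.
Local Notation e := (@mono R a m).
Local Notation I n := (\int[dV]_(z in T n) (cabs (e z) `^ q)%:E)%E.

Let q0 : 0 <= q. Proof. by rewrite ltW// (lt_trans _ q2). Qed.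
Let p0 : 0 < p := lt_trans ltr01 p1.

(** The test function is bounded, hence in L^s for the conjugate exponent s = q / (q - 1), and
    |e|^((q - 1) s) is |e|^q. *)
Lemma trunc_integral_fin n : I n \is a fin_num.
Proof.
have q1 : 0 < q - 1 by rewrite subr_gt0 (lt_trans _ q2)// ltr1n.
have qq : 0 < q / (q - 1) by rewrite divr_gt0// (lt_trans _ q2).
have [_] := dual_mono_Lp gamma0 a m n (ltW qq) (ltW q2).
rewrite dual_mono_integral ?(ltW q2)//.
have -> : (q - 1) * (q / (q - 1)) = q by field; rewrite gt_eqF.
move=> fin.
rewrite ge0_fin_numE//; apply: integral_ge0 => z _; by rewrite lee_fin powR_ge0.
Qed.

Lemma trunc_integral_growth : exists2 J : R, 0 < J & forall n, n%:R * J <= fine (I n).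
Proof.
have [J J0 HJ] := trunc_integral_ge gamma0 q0 kq; exists J => // n.
by rewrite -lee_fin fineK ?trunc_integral_fin//; exact: HJ.
Qed.

(** Boundedness puts the image of [dual_mono q 1] in L^p. This image is a multiple of [e] with
    nonzero coefficient, since the truncated integral at 1 is positive; at index 0 the truncated
    domain is empty. *)
Lemma mono_Lp_fin : (\int[dV]_(z in H) (cabs (e z) `^ p)%:E < +oo)%E.
Proof.
have [J J0 HJ] := trunc_integral_growth; have := HJ 1%N; rewrite mul1r => I1.
have [C [HC EC]] := bergman_op_dual_mono gamma0 k2 HK a0 1 (ltW q2).
have C0 : C != 0.
  by apply/eqP => C0; move: I1; rewrite -EC C0 mul0r leNgt J0.
have [B HB] := bounded; have [_ [[_ [_ +]] _]] := HB _ (dual_mono_Lp gamma0 a m 1 (ltW p0) (ltW q2)).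
rewrite (integral_scale _ HC); last exact: measurable_cabs_mono.
have c0 : 0 < cabs C `^ p by rewrite powR_gt0// cabs_gt0.
case: (\int[dV]_(z in H) _)%E => [r _||]; [exact: ltry | by rewrite gt0_muley ?lte_fin// ltxx | by []].
Qed.

Lemma unbounded_gt2 : q = p -> False.
Proof.
have mH := measurable_Hgamma gamma.
move=> qp; have [J J0 HJ] := trunc_integral_growth.
have fin := mono_Lp_fin.
have E0 : (0 <= \int[dV]_(z in H) (cabs (e z) `^ p)%:E)%E by apply: integral_ge0 => z _; rewrite lee_fin powR_ge0.
set E := (\int[dV]_(z in H) _)%E in fin E0 *.
have Ef : E \is a fin_num by rewrite ge0_fin_numE.
pose n := (Num.truncn (fine E / J)).+1.
have : fine E / J < n%:R by apply: truncnS_gt.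
rewrite ltr_pdivrMr// ltNge => /negP; apply; apply: le_trans (HJ n) _.
rewrite -lee_fin !fineK ?trunc_integral_fin// qp; apply: ge0_subset_integral => //.
- exact: measurable_trunc_dom.
- exact: measurable_cabs_mono.
- by move=> z _; rewrite lee_fin powR_ge0.
- by move=> z [].
Qed.

Lemma unbounded_lt2 : p < 2 -> q = p / (p - 1) -> False.
Proof.
have mH := measurable_Hgamma gamma.
move=> p2 qE; have pm0 : 0 < p - 1 by rewrite subr_gt0.
have [J J0 HJ] := trunc_integral_growth.
have fin := mono_Lp_fin.
have E0 : (0 <= \int[dV]_(z in H) (cabs (e z) `^ p)%:E)%E by apply: integral_ge0 => z _; rewrite lee_fin powR_ge0.
have Egt : (0 < \int[dV]_(z in H) (cabs (e z) `^ p)%:E)%E.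
  rewrite lt_def E0 andbT; apply/eqP => E00.
  (* With exponent 2 the test function is [e] on the truncated domain, so [M] bounds |e| there and
     |e|^q <= M^(q - p) |e|^p. A vanishing L^p norm would then make [I 1] vanish. *)
  have [M HM] := dual_mono_bound gamma0 a m 1 (lexx (2 : R)).
  have : (I 1 <= (M `^ (q - p))%:E * \int[dV]_(z in H) (cabs (e z) `^ p)%:E)%E.
    rewrite -ge0_integralZl_EFin ?powR_ge0//; last 2 first.
    - by move=> z _; rewrite lee_fin powR_ge0.
    - exact: measurable_cabs_mono.
    apply: (@le_trans _ _ (\int[dV]_(z in T 1) ((M `^ (q - p))%:E * (cabs (e z) `^ p)%:E))%E).
      apply: ge0_le_integral.
      - exact: measurable_trunc_dom.
      - by move=> z _; rewrite lee_fin powR_ge0.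
      - exact: measurable_cabs_mono.
      - by apply: measurable_funeM; exact: measurable_cabs_mono.
      - move=> z Tz; rewrite -EFinM lee_fin; have [Hz _] := Tz; have := HM z Hz.
        rewrite cabs_dual_mono// indicE mem_set// mul1r (_ : 2 - 1 = 1); last by ring.
        rewrite powRr1 ?cabs_ge0// => le.
        have qp : 0 < q - p by rewrite subr_gt0 (lt_trans p2).
        have -> : cabs (e z) `^ q = cabs (e z) `^ (q - p) * cabs (e z) `^ p.
          by rewrite -powRD ?subrK// gt_eqF// (lt_trans _ q2).
        apply: ler_wpM2r; first exact: powR_ge0.
        apply: ge0_ler_powR; rewrite ?nnegrE ?cabs_ge0 ?(ltW qp)//; exact: le_trans (cabs_ge0 _) le.
    apply: ge0_subset_integral => //.
    - exact: measurable_trunc_dom.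
    - by apply: measurable_funeM; exact: measurable_cabs_mono.
    - by move=> z _; rewrite mule_ge0// lee_fin powR_ge0.
    - by move=> z [].
  rewrite E00 mule0 => le0; have := HJ 1%N; rewrite mul1r leNgt (le_lt_trans _ J0)//.
  by rewrite -lee_fin fineK ?trunc_integral_fin.
set E := (\int[dV]_(z in H) _)%E in fin E0 Egt *.
have Ef : E \is a fin_num by rewrite ge0_fin_numE.
pose ep := fine E `^ p^-1; have ep0 : 0 < ep by rewrite powR_gt0// fine_gt0// Egt.
pose N := ip e e.
have N0 : 0 < N.
  rewrite lt_def ip_ge0 andbT; apply/eqP => N00.
  have [C [HC EC]] := bergman_op_dual_mono gamma0 k2 HK a0 1 (ltW q2).
  by have := HJ 1%N; rewrite mul1r -EC -/N N00 mulr0 leNgt J0.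
have [B HB] := bounded.
(* Conjugacy of p and q: the p-th power of |e|^(q - 1) is |e|^q, so the test function has L^p norm
   I_n^(1/p). *)
have qp : (q - 1) * p = q by rewrite qE; field; rewrite gt_eqF.
have DI n : (\int[dV]_(z in H) (cabs (dual_mono gamma a m q n z) `^ p)%:E = I n)%E.
  have := dual_mono_integral gamma a m n p0 (ltW q2); rewrite qp; exact.
(* The image is C e, of norm |C| times [ep], and |C| is at least Re C = I_n / N. *)
have key n : fine (I n) * (ep / N) <= B * fine (I n) `^ p^-1.
  have [C [HC EC]] := bergman_op_dual_mono gamma0 k2 HK a0 n (ltW q2).
  have [_ [_ +]] := HB _ (dual_mono_Lp gamma0 a m n (ltW p0) (ltW q2)).
  rewrite /Lpnorm (integral_scale _ HC); last exact: measurable_cabs_mono.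
  rewrite DI -/E (fineM _ Ef)//= powRM ?powR_ge0 ?fine_ge0// -powRrM divff ?gt_eqF// powRr1 ?cabs_ge0// -/ep.
  apply: le_trans; rewrite -EC -/N.
  have -> : complex.Re C * N * (ep / N) = complex.Re C * ep by field; rewrite gt_eqF.
  rewrite ler_pM2r//; exact: le_trans (ler_norm _) (ler_normr_cabs_Re _).
have aux (x y B' N' ep' : R) : 0 < N' -> 0 < ep' -> x * (ep' / N') <= B' * y -> x <= B' * N' / ep' * y.
  move=> N'0 ep'0 le; rewrite -(ler_pM2r (divr_gt0 ep'0 N'0)); apply: le_trans le _.
  by rewrite le_eqVlt; apply/orP; left; apply/eqP; field; rewrite !gt_eqF.
pose b := B * N / ep.
(* Since 1/p + 1/q = 1, dividing [key] by I_n^(1/p) leaves I_n^(1/q) <= b. Positivity of n makes I_n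
   positive, so the division is legitimate. *)
have bnd n : (0 < n)%N -> n%:R * J <= b `^ q.
  move=> n0; have x0 : 0 < fine (I n) by apply: lt_le_trans (HJ n); rewrite mulr_gt0// ltr0n.
  apply: le_trans (HJ n) _; move: (key n) x0; set x := fine _ => kx x0.
  have y0 : 0 < x `^ p^-1 by rewrite powR_gt0.
  have q1 : q^-1 + p^-1 = 1 by rewrite qE; field; rewrite !gt_eqF.
  have le : x `^ q^-1 <= b.
    rewrite -(ler_pM2r y0) -powRD ?q1 ?powRr1 ?(ltW x0)// ?oner_eq0//.
    exact: aux N0 ep0 kx.
  have -> : x = (x `^ q^-1) `^ q by rewrite -powRrM mulVf ?powRr1 ?(ltW x0)// gt_eqF// (lt_trans _ q2).
  apply: ge0_ler_powR; rewrite ?nnegrE ?powR_ge0 ?q0//; exact: le_trans (powR_ge0 _ _) le.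
pose n := (Num.truncn (b `^ q / J)).+1.
have : b `^ q / J < n%:R by apply: truncnS_gt.
by rewrite ltr_pdivrMr// ltNge bnd.
Qed.

End Estimates.

Lemma bergman_bounded_eq2 : bergman_bounded_Lp p H K -> p = 2.
Proof.
move=> bounded; have [pl|pg|//] := ltgtP p 2.
- have pm0 : 0 < p - 1 by rewrite subr_gt0.
  have q2 : 2 < p / (p - 1) by rewrite ltr_pdivlMr//; lra.
  have [a [m [a0 k2 kq]]] := exponent_window q2.
  by case: (unbounded_lt2 a0 q2 k2 kq bounded pl erefl).
- have [a [m [a0 k2 kq]]] := exponent_window pg.
  by case: (unbounded_gt2 a0 pg k2 kq bounded erefl).
Qed.

End Unboundedness.

Unset Implicit Arguments.

Theorem theorem0p2 (R : realType) (gamma : R) (p : R) (K : pt R -> pt R -> R[i]) :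
  0 < gamma ->
  ~ (exists q : rat, gamma = ratr q) ->
  1 < p ->
  is_bergman_kernel (Hgamma gamma) K ->
  (bergman_bounded_Lp p (Hgamma gamma) K <-> p = 2).
Proof.
move=> gamma0 girr p1 HK; split; first exact: (bergman_bounded_eq2 gamma0 girr p1 HK).
by move=> ->; exact: (bergman_bounded_L2 gamma0 HK).
Qed.
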